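(* Let $\bm\lambda$ and $\bm\mu$ be horizontal-strips. If the weighted graphs $\Pi(\bm\lambda)$ and $\Pi(\bm\mu)$ are isomorphic, then $G_{\bm\lambda}(\bm x;q)=G_{\bm\mu}(\bm x;q)$.
   Context: A row is a set of cells $R=a/b=\{(1,j): b+1\le j\le a\}$ for integers $a\ge b\ge 0$; the content of the cell $(1,j)$ is $c((1,j))=j-1$. Write $l(R)=b$, $r(R)=a-1$, and $|R|$ for the number of cells; $R^+=(a+1)/(b+1)$ is the row shifted one cell to the right. For rows $R,R'$ put $M(R,R')=|R\cap R'|$ if $l(R)\le l(R')$ and $M(R,R')=|R\cap R'^+|$ if $l(R)>l(R')$. A horizontal-strip is a finite sequence of rows $\bm\lambda=(R_1,\dots,R_n)$. The weighted graph $\Pi(\bm\lambda)$ has vertices $1,\dots,n$, vertex $i$ of weight $|R_i|$, and for $i<j$ an edge between $i$ and $j$ of weight $M(R_i,R_j)$ (weight-zero edges omitted). For $\bm\mu=(S_1,\dots,S_m)$, $\Pi(\bm\lambda)\cong\Pi(\bm\mu)$ means $m=n$ and there is a permutation $\varphi$ of $\{1,\dots,n\}$ preserving vertex weights ($|R_i|=|S_{\varphi_i}|$) and edge weights. A semistandard filling of a row is a left-to-right weakly increasing map to $\{1,2,\dots\}$; $\mathrm{SSYT}_{\bm\lambda}$ is the set of tuples $\bm T=(T^{(1)},\dots,T^{(n)})$ with $T^{(i)}$ a semistandard filling of $R_i$. Two entries $T^{(i)}(u)$, $T^{(j)}(v)$ with $i<j$ form an inversion if either $c(u)=c(v)$ and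 $T^{(i)}(u)>T^{(j)}(v)$, or $c(u)=c(v)+1$ and $T^{(i)}(u)<T^{(j)}(v)$. The LLT polynomial is $G_{\bm\lambda}(\bm x;q)=\sum_{\bm T\in\mathrm{SSYT}_{\bm\lambda}}q^{\mathrm{inv}(\bm T)}\bm x^{\bm T}$, where $\mathrm{inv}(\bm T)$ is the number of inversions and $\bm x^{\bm T}=\prod_{k\ge1}x_k^{\#\{\text{entries of }\bm T\text{ equal to }k\}}$. *)

(* Defs.v *)
From HB Require Import structures.
From mathcomp Require Import all_boot all_order all_algebra all_fingroup.
From mathcomp Require Import finmap.
From mathcomp Require Import boolp classical_sets functions cardinality fsbigop.

Set Implicit Arguments.
Unset Strict Implicit.
Unset Printing Implicit Defensive.

Import GRing.Theory.

Local Open Scope nat_scope.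
Local Open Scope fset_scope.

(* [Row b a _] is the row a/b, with cells (1, b+1), ..., (1, a); it is empty
   when a = b. *)
Record hrow := Row { row_b : nat; row_a : nat; row_leq : row_b <= row_a }.

Definition cells (R : hrow) : {fset nat * nat} :=
  [fset (1, j) | j in iota (row_b R).+1 (row_a R - row_b R)].

(* Subtraction on nat: the second coordinate of a cell is at least 1. *)
Definition content (u : nat * nat) : nat := u.2 - 1.

Definition row_l (R : hrow) : nat := row_b R.

Lemma row_shift_subproof (R : hrow) : (row_b R).+1 <= (row_a R).+1.
Proof. by rewrite ltnS row_leq. Qed.

Definition row_shift (R : hrow) : hrow := Row (row_shift_subproof R).

Definition rowM (R R' : hrow) : nat :=
  if row_l R <= row_l R' then #|` cells R `&` cells R'|
  else #|` cells R `&` cells (row_shift R')|.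

(* Edges are symmetric; weight 0 means that there is no edge. *)
Record wgraph := WGraph {
  wg_order : nat;
  vweight : 'I_wg_order -> nat;
  eweight : 'I_wg_order -> 'I_wg_order -> nat
}.

Definition wg_iso (G H : wgraph) : Prop :=
  exists (e : wg_order G = wg_order H) (phi : {perm 'I_(wg_order G)}),
    (forall i, vweight i = vweight (cast_ord e (phi i))) /\
    (forall i j, eweight i j =
       eweight (cast_ord e (phi i)) (cast_ord e (phi j))).

Definition hstrip (n : nat) := n.-tuple hrow.

Definition strip_graph (n : nat) (lam : hstrip n) : wgraph :=
  {| wg_order := n;
     vweight := fun i => #|` cells (tnth lam i)|;
     eweight := fun i j =>
       if i < j then rowM (tnth lam i) (tnth lam j)
       else if j < i then rowM (tnth lam j) (tnth lam i)
       else 0 |}.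

Definition filling (n : nat) (lam : hstrip n) :=
  {dffun forall i : 'I_n, {ffun cells (tnth lam i) -> nat}}.

Definition semistandard (R : hrow) (t : {ffun cells R -> nat}) : Prop :=
  (forall u, 0 < t u) /\
  (forall u v : cells R, (val u).2 <= (val v).2 -> t u <= t v).

Definition SSYT (n : nat) (lam : hstrip n) : set (filling lam) :=
  [set T : filling lam | forall i, semistandard (T i)]%classic.
Arguments SSYT {n} lam T.

Definition inversion (n : nat) (lam : hstrip n) (T : filling lam)
    (i j : 'I_n) (u : cells (tnth lam i)) (v : cells (tnth lam j)) : bool :=
  ((content (val u) == content (val v)) && (T i u > T j v))
  || ((content (val u) == (content (val v)).+1) && (T i u < T j v)).

Definition inv_num (n : nat) (lam : hstrip n) (T : filling lam) : nat :=
  \sum_(i < n) \sum_(j < n | i < j)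
    #|[set uv : cells (tnth lam i) * cells (tnth lam j)
       | inversion T uv.1 uv.2]|.

Definition entry_count (n : nat) (lam : hstrip n) (T : filling lam) (k : nat) : nat :=
  \sum_(i < n) #|[set u : cells (tnth lam i) | T i u == k]|.

(* A monomial in x_1, x_2, ... is its finitely supported exponent function; a
   formal power series in the x_k over int[q] is its coefficient function.
   Entries of tableaux are positive, so x_0 never occurs. *)
Definition monomial := {fsfun nat -> nat with 0}.

Definition power_series := monomial -> {poly int}.

Definition SSYT_mon (n : nat) (lam : hstrip n) (m : monomial) :
    set (filling lam) :=
  [set T : filling lam | SSYT lam T /\ forall k, entry_count T k = m k]%classic.
Arguments SSYT_mon {n} lam m T.

(* The finitely supported sum in [LLT] below is therefore a true sum. *)
Lemma finite_SSYT_mon (n : nat) (lam : hstrip n) (m : monomial) :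
  finite_set (SSYT_mon lam m).
Proof.
pose F := {dffun forall i : 'I_n, {ffun cells (tnth lam i) -> finsupp m}}.
pose g (f : F) : filling lam := [ffun i => [ffun u => val (f i u)]].
apply: (@sub_finite_set _ _ (g @` [set: F])%classic); last first.
  exact/finite_image/finite_finset.
move=> T [_ Tm].
have Tin i u : T i u \in finsupp m.
  rewrite mem_finsupp -Tm -lt0n /entry_count (bigD1 i) //= ltn_addr //.
  by apply/card_gt0P; exists u; rewrite inE.
exists [ffun i => [ffun u => FSetSub (Tin i u)]] => //.
by apply/ffunP => i; apply/ffunP => u; rewrite !ffunE.
Qed.

(* The coefficient of x^m is the sum of q^inv(T) over the T in SSYT with
   x^T = x^m; the polynomial variable 'X is q. *)
Definition LLT (n : nat) (lam : hstrip n) : power_series :=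
  fun m => (\sum_(T \in SSYT_mon lam m) ('X^(inv_num T) : {poly int}))%R.

(* Main.v *)
Require Import Defs.
From mathcomp Require Import all_boot all_order all_algebra all_fingroup.
From mathcomp Require Import zify ring lra.
Import Order.TTheory GRing.Theory Num.Theory.
Set Implicit Arguments. Unset Strict Implicit. Unset Printing Implicit Defensive.

(* Place the i-th of n rows at the rational position [l(R_i) + i/n]. Inversions and
   weights then depend only on the integers [d i j = floor (p j - p i)], so G is a
   function of the row sizes and of an alcove of the affine braid arrangement.
   Crossing the wall between two rows does not change G when it keeps their weight;
   otherwise G satisfies [G_w = q G_(w+1) + (1 - q) G'], where G' replaces the two
   rows by their union and intersection, which increases the sum of the squares of the
   sizes. The weights of G' are determined by those of G, so one can induct on that sum.

   Up to crossings that keep all weights, two configurations with the same weights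
   differ by the orientation of the incomparable (not weakly nested) pairs. Call
   a set B of rows a block if every row outside B is disjoint from all rows of B, on one
   side, or contains them all. Reversing the positions of B keeps all weights, and
   walking from a configuration to its reversal through walls and their mirror images
   shows that it also keeps G. Finally any two configurations with the same weights are
   linked by block reversals: among the pairs of B, colour those oriented oppositely,
   those oriented alike, and those of nonzero weight; no triangle is rainbow, so by
   Gallai's theorem one colour is disconnected, and its components give smaller blocks. *)

(** * Two rows, column by column *)

Local Open Scope ring_scope.

Section Transfer.
Variables (K : comNzRingType) (q : K) (M : nat) (w : nat -> nat -> K).

Fixpoint rows (k p : nat) : seq (seq nat) :=
  if k is k'.+1 then
    flatten [seq [seq x :: s | s <- rows k' x] | x <- [seq x <- iota 0 M | p <= x]%N]
  else [:: [::]].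

Lemma rowsS (k p : nat) : rows k.+1 p =
  flatten [seq [seq x :: s | s <- rows k x] | x <- [seq x <- iota 0 M | p <= x]%N].
Proof. by []. Qed.

Fixpoint rweight (j : nat) (s : seq nat) : K :=
  if s is x :: s' then w j x * rweight j.+1 s' else 1.

(* The row [t] precedes [s] in the strip and starts in the same column; [p] is the
   entry to the left of [s]. *)
Fixpoint rinv (p : nat) (s t : seq nat) {struct t} : nat :=
  if t is y :: t' then
    if s is x :: s' then (x < y)%N + (y < p)%N + rinv x s' t' else (y < p)%N
  else 0%N.

Definition row_sum (p k j : nat) : K := \sum_(s <- rows k p) rweight j s.

Definition pair_sum (p r k k' j : nat) : K :=
  \sum_(s <- rows k p) \sum_(t <- rows k' r)
     rweight j s * rweight j t * q ^+ rinv p s t.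

Lemma big_rowsS (F : seq nat -> K) (k p : nat) :
  \sum_(s <- rows k.+1 p) F s =
  \sum_(0 <= x < M | (p <= x)%N) \sum_(s <- rows k x) F (x :: s).
Proof.
rewrite /= big_flatten big_map big_filter /index_iota subn0.
by apply: eq_bigr => x _; rewrite big_map.
Qed.

Lemma pair_sum_0 (p r k j : nat) : pair_sum p r k 0 j = row_sum p k j.
Proof. by apply: eq_bigr => s _; rewrite big_seq1 /= !mulr1. Qed.

Lemma pair_sum_0S (p r k j : nat) : pair_sum p r 0 k.+1 j =
  \sum_(0 <= y < M | (r <= y)%N) w j y * q ^+ (y < p)%N * row_sum y k j.+1.
Proof.
rewrite /pair_sum big_seq1 big_rowsS; apply: eq_bigr => y _.
by rewrite mulr_sumr; apply: eq_bigr => t _ /=; rewrite mul1r mulrAC.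
Qed.

Lemma row_sumS (p k j : nat) : row_sum p k.+1 j =
  \sum_(0 <= y < M | (p <= y)%N) w j y * row_sum y k j.+1.
Proof. by rewrite /row_sum big_rowsS; apply: eq_bigr => y _; rewrite mulr_sumr. Qed.

Lemma row_sum0 (p j : nat) : row_sum p 0 j = 1.
Proof. by rewrite /row_sum big_seq1. Qed.

Lemma pair_sumSS (p r k k' j : nat) : pair_sum p r k.+1 k'.+1 j =
  \sum_(0 <= x < M | (p <= x)%N) \sum_(0 <= y < M | (r <= y)%N)
    w j x * w j y * q ^+ ((x < y) + (y < p))%N * pair_sum x y k k' j.+1.
Proof.
rewrite /pair_sum big_rowsS; apply: eq_bigr => x _.
transitivity (\sum_(s <- rows k x) \sum_(0 <= y < M | (r <= y)%N)
   \sum_(t <- rows k' y) rweight j (x :: s) * rweight j (y :: t) * q ^+ rinv p (x :: s) (y :: t)).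
  by apply: eq_bigr => s _; rewrite big_rowsS.
rewrite exchange_big /=; apply: eq_bigr => y _.
rewrite mulr_sumr; apply: eq_bigr => s _; rewrite mulr_sumr; apply: eq_bigr => t _.
by rewrite !exprD; ring.
Qed.

Lemma sum_split (F : nat -> K) (u v : nat) : (u <= v)%N ->
  \sum_(0 <= y < M | (u <= y)%N) F y =
  \sum_(0 <= y < M | (u <= y < v)%N) F y + \sum_(0 <= y < M | (v <= y)%N) F y.
Proof.
move=> uv; rewrite (bigID (fun y => y < v)%N) /=; congr (_ + _).
by apply: eq_bigl => y; lia.
Qed.

Lemma antisym_sum (P : pred nat) (s : seq nat) (g : nat -> nat -> K) :
  (forall x, P x -> g x x = 0) -> (forall x y, P x -> P y -> g x y + g y x = 0) ->
  \sum_(x <- s | P x) \sum_(y <- s | P y) g x y = 0.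
Proof.
move=> g0 gA; elim: s => [|a s IH]; first by rewrite big_nil.
rewrite big_cons; case: ifP => Pa; last first.
  by rewrite -[RHS]IH; apply: eq_bigr => x _; rewrite big_cons Pa.
rewrite big_cons Pa g0 // add0r.
under [X in _ + X]eq_bigr do rewrite big_cons Pa.
rewrite big_split /= IH addr0 -big_split /=.
by apply: big1 => y Py; rewrite gA.
Qed.

Lemma pair_sum_hi (u v k k' j : nat) : (u <= v)%N ->
  pair_sum v u k.+1 k'.+1 j =
  q * (\sum_(0 <= x < M | (v <= x)%N) \sum_(0 <= y < M | (u <= y < v)%N)
    w j x * w j y * pair_sum x y k k' j.+1) + pair_sum v v k.+1 k'.+1 j.
Proof.
move=> uv; rewrite !pair_sumSS mulr_sumr -big_split /=; apply: eq_bigr => x vx.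
rewrite (sum_split _ uv); congr (_ + _).
rewrite mulr_sumr; apply: eq_bigr => y /andP[_ yv].
by rewrite yv ltnNge (leq_trans (ltnW yv) vx) /= expr1; ring.
Qed.

Lemma pair_sum_lo (u v k k' j : nat) : (u <= v)%N ->
  pair_sum u v k.+1 k'.+1 j =
  q * (\sum_(0 <= x < M | (v <= x)%N) \sum_(0 <= y < M | (u <= y < v)%N)
    w j x * w j y * pair_sum y x k k' j.+1) + pair_sum v v k.+1 k'.+1 j.
Proof.
move=> uv; rewrite !pair_sumSS (sum_split _ uv); congr (_ + _); last first.
  apply: eq_bigr => x vx; apply: eq_bigr => y vy.
  by rewrite !(ltnNge y) vy (leq_trans uv vy).
rewrite exchange_big /= mulr_sumr; apply: eq_bigr => x vx; rewrite mulr_sumr.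
apply: eq_bigr => y /andP[uy yv].
by rewrite (leq_trans yv vx) (ltnNge x u) (leq_trans uv vx) /= addn0 expr1; ring.
Qed.

Lemma pair_sum_base (k' u v j : nat) : (u <= v)%N ->
  pair_sum v u 0 k' j = q * pair_sum u v k' 0 j + (1 - q) * pair_sum u v 0 k' j.
Proof.
move=> uv; rewrite pair_sum_0; case: k' => [|k'].
  by rewrite !pair_sum_0 !row_sum0; ring.
rewrite !pair_sum_0S row_sumS !(sum_split _ uv) mulrDr !mulr_sumr -addrA; congr (_ + _).
  by apply: eq_bigr => y /andP[uy yv]; rewrite yv expr1; ring.
rewrite -big_split /=; apply: eq_bigr => y vy.
by rewrite !ltnNge vy (leq_trans uv vy) /= expr0; ring.
Qed.

Lemma pair_sum_base0 (k' u v j : nat) : (u <= v)%N ->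
  pair_sum u v 0 k' j = row_sum v k' j.
Proof.
move=> uv; case: k' => [|k']; first by rewrite pair_sum_0 !row_sum0.
rewrite pair_sum_0S row_sumS; apply: eq_bigr => y vy.
by rewrite ltnNge (leq_trans uv vy) mulr1.
Qed.

Lemma pair_sum_AB (k k' j : nat) :
  (forall v, pair_sum v v k k' j = pair_sum v v k' k j) /\
  (forall u v, (u < v)%N -> q * pair_sum u v k k' j + pair_sum v u k k' j =
      pair_sum v u k' k j + q * pair_sum u v k' k j).
Proof.
elim: k k' j => [|k IH] k' j.
  split=> [v|u v uv]; first by rewrite pair_sum_0 pair_sum_base0.
  rewrite (pair_sum_base _ _ (ltnW uv)) !pair_sum_0 (pair_sum_base0 _ _ (ltnW uv)).
  by ring.
case: k' => [|k'].
  split=> [v|u v uv]; first by rewrite pair_sum_0 pair_sum_base0.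
  rewrite (pair_sum_base _ _ (ltnW uv)) !pair_sum_0 (pair_sum_base0 _ _ (ltnW uv)).
  by ring.
have A v : pair_sum v v k.+1 k'.+1 j = pair_sum v v k'.+1 k.+1 j.
  apply/eqP; rewrite -subr_eq0; apply/eqP.
  rewrite !pair_sumSS [X in _ - X]exchange_big -sumrB /=.
  under eq_bigr do rewrite -sumrB.
  apply: antisym_sum => [x vx|x y vx vy].
    by rewrite (IH k' j.+1).1 subrr.
  have [xy|yx|->] := ltngtP x y; last by rewrite (IH k' j.+1).1; ring.
    rewrite !(ltnNge y v) !(ltnNge x v) vx vy /= ?addn0 expr0 expr1.
    have /eqP := (IH k' j.+1).2 _ _ xy.
    rewrite -subr_eq0 => /eqP E.
    by rewrite -[RHS](mulr0 (w j x * w j y)) -E; ring.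
  rewrite !(ltnNge y v) !(ltnNge x v) vx vy /= ?addn0 expr0 expr1.
  have /eqP := (IH k' j.+1).2 _ _ yx.
  rewrite -subr_eq0 => /eqP E.
  by rewrite -[RHS](mulr0 (w j x * w j y)) -E; ring.
split=> // u v uv.
rewrite !(pair_sum_hi _ _ _ (ltnW uv)) !(pair_sum_lo _ _ _ (ltnW uv)) A.
set Z := pair_sum v v _ _ _.
set S1 := \sum_(_ <= _ < _ | _) _; set S2 := \sum_(_ <= _ < _ | _) _.
set S3 := \sum_(_ <= _ < _ | _) _; set S4 := \sum_(_ <= _ < _ | _) _.
have : q * S1 + S2 = S3 + q * S4.
  rewrite /S1 /S2 /S3 /S4 !mulr_sumr -!big_split /=; apply: eq_bigr => x vx.
  rewrite !mulr_sumr -!big_split /=; apply: eq_bigr => y /andP[_ yv].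
  transitivity (w j x * w j y * (q * pair_sum y x k k' j.+1 + pair_sum x y k k' j.+1)).
    by ring.
  by rewrite ((IH k' j.+1).2 _ _ (leq_trans yv vx)); ring.
move=> E; transitivity (q * (q * S1 + S2) + (q * Z + Z)); first by ring.
by rewrite E; ring.
Qed.

Lemma pair_sum_diag (v k k' j : nat) : pair_sum v v k k' j = pair_sum v v k' k j.
Proof. exact: (pair_sum_AB k k' j).1. Qed.

Lemma pair_sum_nested (u v k k' j : nat) : (u <= v)%N -> (k' <= k)%N ->
  pair_sum v u k k' j = pair_sum u v k' k j.
Proof.
elim: k k' u v j => [|k IH] [|k'] u v j uv // kk.
- by rewrite !pair_sum_0 !row_sum0.
- by rewrite pair_sum_0 pair_sum_base0.
rewrite (pair_sum_hi _ _ _ uv) (pair_sum_lo _ _ _ uv) pair_sum_diag; congr (q * _ + _).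
apply: eq_bigr => x vx; apply: eq_bigr => y /andP[_ yv].
by rewrite IH // (leq_trans (ltnW yv) vx).
Qed.

Lemma pair_sum_cross (u v k k' j : nat) : (u <= v)%N -> (k <= k')%N ->
  pair_sum v u k k' j = q * pair_sum u v k' k j + (1 - q) * pair_sum u v k k' j.
Proof.
elim: k k' u v j => [|k IH] [|k'] u v j uv // kk; try exact: pair_sum_base.
rewrite (pair_sum_hi _ _ _ uv) !(pair_sum_lo _ _ _ uv) (pair_sum_diag v k'.+1 k.+1).
set Z := pair_sum v v _ _ _.
set S1 := \sum_(_ <= _ < _ | _) _; set S2 := \sum_(_ <= _ < _ | _) _.
set S3 := \sum_(_ <= _ < _ | _) _.
have -> : S1 = q * S2 + (1 - q) * S3.
  rewrite /S1 /S2 /S3 !mulr_sumr -!big_split /=; apply: eq_bigr => x vx.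
  rewrite !mulr_sumr -!big_split /=; apply: eq_bigr => y /andP[_ yv].
  by rewrite IH // ?(leq_trans (ltnW yv) vx) //; ring.
by ring.
Qed.

End Transfer.

(** * The generating function of an alcove *)

Lemma rinvE (p : nat) (s t : seq nat) : rinv p s t =
  (\sum_(0 <= v < size t) (((v < size s) && (nth 0 s v < nth 0 t v)) +
     ((v <= size s) && (nth 0 t v < nth 0 (p :: s) v))))%N.
Proof.
elim: t p s => [|y t IH] p s; first by rewrite big_geq //; case: s.
case: s => [|x s] /=; rewrite big_nat_recl //= ?IH //.
by rewrite big1 ?addn0.
Qed.

Section Gen.
Variables (K : idomainType) (q : K) (x : nat -> K) (M L : nat) (I : finType).

Local Notation row := {ffun 'I_L.+1 -> 'I_M.+1}.

Definition entry (f : row) (u : nat) : nat := f (inord u).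

Definition row_filling (k : nat) (f : row) : bool :=
  [forall u : 'I_L.+1, (k <= u)%N ==> (f u == ord0)] &&
  [forall u : 'I_L.+1, (u.+1 < k)%N ==> (entry f u <= entry f u.+1)%N].

(* With the rows at positions [l(R_i) + i/n], both rules for inversions become the single
   condition that the cell of the smaller entry lies to the right of the cell of the larger
   one, at a distance in [0, 1). *)
Definition attacks (k k' : nat) (d : int) (f g : nat -> nat) : nat :=
  (\sum_(0 <= u < k) \sum_(0 <= v < k') ((u%:Z == v%:Z + d)%R && (g v < f u)))%N.

Definition gen (k : I -> nat) (d : I -> I -> int) : K :=
  \sum_(T : {ffun I -> row} | [forall i, row_filling (k i) (T i)])
    (\prod_i \prod_(0 <= u < k i) x (entry (T i) u)) *
    q ^+ (\sum_i \sum_j attacks (k i) (k j) (d i j) (entry (T i)) (entry (T j))).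

Lemma eq_gen (k k' : I -> nat) (d d' : I -> I -> int) :
  k =1 k' -> d =2 d' -> gen k d = gen k' d'.
Proof.
move=> kk dd; apply: eq_big => [T|T _].
  by apply: eq_forallb => i; rewrite kk.
congr (_ * q ^+ _); first by apply: eq_bigr => i _; rewrite kk.
by apply: eq_bigr => i _; apply: eq_bigr => j _; rewrite dd !kk.
Qed.

Lemma gen_relabel (s : {perm I}) (k : I -> nat) (d : I -> I -> int) :
  gen (fun i => k (s i)) (fun i j => d (s i) (s j)) = gen k d.
Proof.
pose h (T : {ffun I -> row}) := [ffun i => T (s i)].
pose h' (T : {ffun I -> row}) := [ffun i => T ((s^-1)%g i)].
have hK : cancel h' h by move=> T; apply/ffunP => i; rewrite !ffunE permK.
have h'K : cancel h h' by move=> T; apply/ffunP => i; rewrite !ffunE permKV.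
rewrite [LHS](reindex h) /=; last by exists h' => T _.
apply: eq_big => [T|T _].
  apply/forallP/forallP => H i.
    by have := H ((s^-1)%g i); rewrite ffunE permKV.
  by rewrite ffunE.
congr (_ * q ^+ _).
  rewrite [RHS](reindex_inj (@perm_inj _ s)); apply: eq_bigr => i _.
  by rewrite ffunE.
rewrite [RHS](reindex_inj (@perm_inj _ s)); apply: eq_bigr => i _.
rewrite [RHS](reindex_inj (@perm_inj _ s)); apply: eq_bigr => j _.
by rewrite !ffunE.
Qed.

Definition seq_of_row (k : nat) (f : row) : seq nat := mkseq (entry f) k.

Lemma mem_rows (k p : nat) (s : seq nat) : (s \in rows M.+1 k p) =
  [&& size s == k, path leq p s & all (fun y => y <= M)%N s].
Proof.
elim: k p s => [|k IH] p s.
  by rewrite /= inE; case: s.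
have xsE y : (y \in [seq y <- iota 0 M.+1 | p <= y]%N) = (p <= y <= M)%N.
  by rewrite mem_filter mem_iota.
rewrite rowsS; move: {-}[seq y <- iota 0 M.+1 | p <= y]%N xsE => xs xsE.
apply/flatten_mapP/idP => [[y]|].
  rewrite xsE => /andP[py yM] /mapP[t].
  by rewrite IH => /and3P[/eqP <- pt at'] ->; rewrite /= eqxx py pt yM.
case: s => [//|y s] /and3P[]; rewrite /= eqSS => sk /andP[py ps] /andP[yM As].
exists y; first by rewrite xsE py.
by apply/mapP; exists s => //; rewrite IH sk ps.
Qed.

Lemma rows_uniq (k p : nat) : uniq (rows M.+1 k p).
Proof.
elim: k p => [//|k IH] p; rewrite rowsS.
have : uniq [seq y <- iota 0 M.+1 | p <= y]%N by rewrite filter_uniq ?iota_uniq.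
elim: [seq _ <- _ | _] => [//|y ys IHy] /= /andP[yys uys].
rewrite cat_uniq IHy // andbT map_inj_uniq ?IH; last by move=> s t [].
apply/hasPn => s /flatten_mapP[z zys /mapP[t _ ->]].
by apply/mapP => -[t' _ [zy _]]; rewrite -zy zys in yys.
Qed.

Lemma sum_row_filling (k : nat) (F : seq nat -> K) : (k <= L.+1)%N ->
  \sum_(f : row | row_filling k f) F (seq_of_row k f) =
  \sum_(s <- rows M.+1 k 0) F s.
Proof.
move=> kL.
have -> : \sum_(f | row_filling k f) F (seq_of_row k f) =
    \sum_(s <- [seq seq_of_row k f | f <- index_enum row & row_filling k f]) F s.
  by rewrite big_map big_filter.
have entryE (f : row) (u : 'I_L.+1) : entry f u = f u by rewrite /entry inord_val.
apply: perm_big; apply: uniq_perm; last 1 first.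
- move=> s; rewrite mem_rows; apply/mapP/idP => [[f]|].
    rewrite mem_filter => /andP[/andP[/forallP f0 /forallP fs] _] ->.
    rewrite size_mkseq eqxx andTb; apply/andP; split.
      apply/(pathP 0) => i; rewrite size_mkseq => ik.
      rewrite nth_mkseq //; case: i ik => [//|i] ik /=.
      rewrite nth_mkseq ?(ltnW ik) //.
      by have := fs (inord i); rewrite inordK ?ik //; lia.
    apply/allP => y /mapP[i _ ->]; rewrite /entry; exact: leq_ord.
  move=> /and3P[/eqP sk ps As].
  pose f : row := [ffun u : 'I_L.+1 => inord (nth 0 s u)].
  have fE u : (u <= L)%N -> entry f u = nth 0 s u.
    move=> uL; rewrite /entry ffunE inordK ?inordK //.
    have [us|us] := ltnP u (size s); last by rewrite nth_default.
    by have /allP := As; apply; exact: mem_nth.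
  exists f; last first.
    apply: (@eq_from_nth _ 0); first by rewrite size_mkseq.
    by move=> i; rewrite sk => si; rewrite nth_mkseq // fE //; lia.
  rewrite mem_filter mem_index_enum andbT; apply/andP; split; apply/forallP => u.
    apply/implyP => ku; rewrite ffunE nth_default ?sk //.
    by apply/eqP/val_inj; rewrite /= inordK.
  apply/implyP => uk; rewrite !fE; [|lia|lia].
  by move/(pathP 0): ps => /(_ u.+1) /=; apply; rewrite sk.
- rewrite map_inj_in_uniq ?filter_uniq ?index_enum_uniq // => f g.
  rewrite !mem_filter => /andP[/andP[/forallP f0 _] _] /andP[/andP[/forallP g0 _] _] fg.
  apply/ffunP => u; have [ku|uk] := leqP k u.
    by have /implyP/(_ ku)/eqP -> := f0 u; have /implyP/(_ ku)/eqP -> := g0 u.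
  apply: val_inj; rewrite /= -!entryE.
  by have := congr1 (fun s => nth 0 s u) fg; rewrite !nth_mkseq.
exact: rows_uniq.
Qed.

End Gen.

Section Two.
Variables (K : idomainType) (q : K) (x : nat -> K) (M L : nat) (I : finType).
Local Notation row := {ffun 'I_L.+1 -> 'I_M.+1}.
Variables (a b : I).
Hypothesis ab : a != b.

Definition set_rows (T : {ffun I -> row}) (f g : row) : {ffun I -> row} :=
  [ffun i => if i == a then f else if i == b then g else T i].

Definition row0 : row := [ffun => ord0].

Definition other (c : I) : bool := (c != a) && (c != b).

Definition others_ok (k : I -> nat) (T : {ffun I -> row}) : bool :=
  [&& T a == row0, T b == row0 & [forall c, other c ==> row_filling (k c) (T c)]].

Definition cell_weight (k : I -> nat) (d : I -> I -> int) (T : {ffun I -> row})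
    (u y : nat) : K :=
  x y * q ^+ (\sum_(c | other c) \sum_(0 <= w < k c)
    (((u%:Z == w%:Z + d a c)%R && (entry (T c) w < y)) +
     ((w%:Z == u%:Z + d c a)%R && (y < entry (T c) w))))%N.

Definition others_weight (k : I -> nat) (d : I -> I -> int) (T : {ffun I -> row}) : K :=
  (\prod_(c | other c) \prod_(0 <= u < k c) x (entry (T c) u)) *
  q ^+ (\sum_(i | other i) \sum_(j | other j)
     attacks (k i) (k j) (d i j) (entry (T i)) (entry (T j)))%N.

Definition two_rows (w : nat -> nat -> K) (k k' m : nat) (e e' : int) : K :=
  \sum_(f : row | row_filling k f) \sum_(g : row | row_filling k' g)
    (\prod_(0 <= u < k) w u (entry f u)) *
    (\prod_(0 <= v < k') w (v + m)%N (entry g v)) *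
    q ^+ (attacks k k' e (entry f) (entry g) + attacks k' k e' (entry g) (entry f))%N.

Lemma sum_set_rows (k : I -> nat) (F : {ffun I -> row} -> K) :
  \sum_(T : {ffun I -> row} | [forall i, row_filling (k i) (T i)]) F T =
  \sum_(T | others_ok k T) \sum_(f | row_filling (k a) f)
     \sum_(g | row_filling (k b) g) F (set_rows T f g).
Proof.
under [RHS]eq_bigr do rewrite pair_big.
rewrite [RHS]pair_big /=.
pose h (p : {ffun I -> row} * (row * row)) := set_rows p.1 p.2.1 p.2.2.
pose h' T := (set_rows T row0 row0, (T a, T b)).
rewrite (reindex_onto h h') => [|T _]; last first.
  by apply/ffunP => i; rewrite /h !ffunE /=; case: eqP => [->|_] //; case: eqP => [->|].
apply: eq_bigl => -[T [f g]] /=; rewrite /h /h' /=.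
rewrite !xpair_eqE /= !ffunE eqxx (negPf (contra_neq esym ab)) !eqxx !andbT.
apply/andP/and3P => [[/forallP H /eqP <-]|[/and3P[/eqP Ta /eqP Tb /forallP H] Hf Hg]].
  split; last 2 first.
  - by have := H a; rewrite ffunE eqxx.
  - by have := H b; rewrite ffunE eq_sym (negPf ab) eqxx.
  rewrite /others_ok !ffunE eqxx (eq_sym b) (negPf ab) !eqxx /=.
  apply/forallP => c; apply/implyP => /andP[ca cb].
  by have := H c; rewrite !ffunE (negPf ca) (negPf cb).
split; last first.
  apply/eqP/ffunP => i; rewrite !ffunE.
  by case: eqP => [->|_]; rewrite ?Ta //; case: eqP => [->|].
apply/forallP => c; rewrite ffunE; case: eqP => [->//|/eqP ca].
by case: eqP => [->//|/eqP cb]; have := H c; rewrite /other ca cb.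
Qed.

Lemma prod_others (F : I -> K) :
  \prod_i F i = F a * (F b * \prod_(i | other i) F i).
Proof. by rewrite (bigD1 a) //= (bigD1 b) //= eq_sym. Qed.

Lemma sumn_others (F : I -> nat) :
  (\sum_i F i = F a + (F b + \sum_(i | other i) F i))%N.
Proof. by rewrite (bigD1 a) //= (bigD1 b) //= eq_sym. Qed.

Lemma attacks_self (k : nat) (f : nat -> nat) : attacks k k 0 f f = 0%N.
Proof.
apply: big1 => u _; apply: big1 => v _; rewrite addr0.
by case: eqP => //= -[->]; rewrite ltnn.
Qed.

Lemma gen_two_rows (k : I -> nat) (d : I -> I -> int) (m : nat) :
  (forall i, d i i = 0) ->
  (forall c, other c -> d a c = d b c + m%:Z /\ d c b = d c a + m%:Z) ->
  gen q x M L k d = \sum_(T : {ffun I -> row} | others_ok k T)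
    others_weight k d T *
    two_rows (cell_weight k d T) (k a) (k b) m (d a b) (d b a).
Proof.
move=> d0 dm; rewrite /gen sum_set_rows; apply: eq_bigr => T _.
rewrite mulr_sumr; apply: eq_bigr => f _; rewrite mulr_sumr; apply: eq_bigr => g _.
have Sa : set_rows T f g a = f by rewrite ffunE eqxx.
have Sb : set_rows T f g b = g by rewrite ffunE eq_sym (negPf ab) eqxx.
have Sc c : other c -> set_rows T f g c = T c.
  by case/andP=> ca cb; rewrite ffunE (negPf ca) (negPf cb).
rewrite prod_others Sa Sb (eq_bigr (fun c => \prod_(0 <= u < k c) x (entry (T c) u))); last first.
  by move=> c /Sc ->.
set P := \prod_(i | other i) _.
pose E u y := (\sum_(c | other c) \sum_(0 <= w < k c)
    (((u%:Z == w%:Z + d a c)%R && (entry (T c) w < y)) +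
     ((w%:Z == u%:Z + d c a)%R && (y < entry (T c) w))))%N.
have -> : \prod_(0 <= u < k a) cell_weight k d T u (entry f u) =
  (\prod_(0 <= u < k a) x (entry f u)) * q ^+ (\sum_(0 <= u < k a) E u (entry f u))%N.
  by rewrite big_split /= -(big_morph _ (exprD q) (expr0 q)).
have -> : \prod_(0 <= v < k b) cell_weight k d T (v + m) (entry g v) =
  (\prod_(0 <= u < k b) x (entry g u)) * q ^+ (\sum_(0 <= u < k b) E (u + m)%N (entry g u))%N.
  by rewrite big_split /= -(big_morph _ (exprD q) (expr0 q)).
rewrite /others_weight -/P.
set EO := (\sum_(i | other i) \sum_(j | other j) _)%N.
rewrite [X in q ^+ X](_ : _ = (EO + (\sum_(0 <= u < k a) E u (entry f u)) +
   (\sum_(0 <= u < k b) E (u + m)%N (entry g u)) +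
   (attacks (k a) (k b) (d a b) (entry f) (entry g) +
    attacks (k b) (k a) (d b a) (entry g) (entry f))))%N; first (rewrite !exprD;
  move: P (q ^+ EO) (\prod_(_ <= _ < k a) _) (\prod_(_ <= _ < k b) _);
  by move: (q ^+ _) (q ^+ _) (q ^+ _) (q ^+ _) => *; ring).

pose A i j := attacks (k i) (k j) (d i j) (entry (set_rows T f g i)) (entry (set_rows T f g j)).
have Ea : (\sum_(0 <= u < k a) E u (entry f u) = \sum_(c | other c) (A a c + A c a))%N.
  rewrite exchange_big /=; apply: eq_bigr => c oc.
  rewrite /A Sa Sc // /attacks [X in (_ + X)%N]exchange_big -big_split /=.
  by apply: eq_bigr => u _; rewrite -big_split.
have Eb : (\sum_(0 <= u < k b) E (u + m)%N (entry g u) = \sum_(c | other c) (A b c + A c b))%N.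
  rewrite exchange_big /=; apply: eq_bigr => c oc.
  rewrite /A Sb Sc // /attacks [X in (_ + X)%N]exchange_big -big_split /=.
  apply: eq_bigr => u _; rewrite -big_split; apply: eq_bigr => w _ /=.
  by have [-> ->] := dm c oc; congr ((_ && _) + (_ && _))%N; apply/eqP/eqP; lia.
rewrite Ea Eb sumn_others -/A.
have split3 i : (\sum_j A i j = A i a + (A i b + \sum_(j | other j) A i j))%N by exact: sumn_others.
rewrite !split3 (eq_bigr _ (fun i _ => split3 i)) !big_split /=.
have -> : A a a = 0%N by rewrite /A d0 attacks_self.
have -> : A b b = 0%N by rewrite /A d0 attacks_self.
have -> : EO = (\sum_(i | other i) \sum_(j | other j) A i j)%N.
  by apply: eq_bigr => i oi; apply: eq_bigr => j oj; rewrite /A !Sc.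
have -> : attacks (k a) (k b) (d a b) (entry f) (entry g) = A a b by rewrite /A Sa Sb.
have -> : attacks (k b) (k a) (d b a) (entry g) (entry f) = A b a by rewrite /A Sa Sb.
lia.
Qed.

End Two.

(** * Crossing a wall *)

Section Columns.
Variables (K : idomainType) (q : K) (M L : nat) (w : nat -> nat -> K).

Lemma big_rows_cat (N : nat) (F : seq nat -> K) (m k p : nat) : (m <= k)%N ->
  \sum_(s <- rows N k p) F s =
  \sum_(s <- rows N m p) \sum_(t <- rows N (k - m) (last p s)) F (s ++ t).
Proof.
elim: m k p F => [|m IH] k p F; first by rewrite subn0 big_seq1.
case: k => [//|k] mk; rewrite !big_rowsS; apply: eq_bigr => y _.
by rewrite (IH _ _ _ mk) subSS.
Qed.

Lemma rweight_cat (j : nat) (s t : seq nat) :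
  rweight w j (s ++ t) = rweight w j s * rweight w (j + size s) t.
Proof.
elim: s j => [|y s IH] j /=; first by rewrite mul1r addn0.
by rewrite IH addSnnS mulrA.
Qed.

Lemma prod_rweight (m k : nat) (s : seq nat) : size s = k ->
  \prod_(0 <= u < k) w (u + m)%N (nth 0%N s u) = rweight w m s.
Proof.
elim: s k m => [|y s IH] k m <-; first by rewrite big_geq.
rewrite big_nat_recl //= -(IH (size s)) // add0n; congr (_ * _).
by apply: eq_bigr => u _; rewrite addSnnS.
Qed.

Lemma size_rows (k p : nat) (s : seq nat) : s \in rows M.+1 k p -> size s = k.
Proof. by rewrite mem_rows => /and3P[/eqP]. Qed.

Definition nth0 (s : seq nat) (u : nat) : nat := nth 0%N s u.

Lemma two_rows_seq (k k' m : nat) (e e' : int) : (k <= L.+1)%N -> (k' <= L.+1)%N ->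
  two_rows q M L w k k' m e e' =
  \sum_(s <- rows M.+1 k 0) \sum_(t <- rows M.+1 k' 0)
    rweight w 0 s * rweight w m t *
    q ^+ (attacks k k' e (nth0 s) (nth0 t) + attacks k' k e' (nth0 t) (nth0 s))%N.
Proof.
move=> kL kL'.
rewrite -(sum_row_filling M _ kL); apply: eq_bigr => f _.
rewrite -(sum_row_filling M _ kL'); apply: eq_bigr => g _.
rewrite -(@prod_rweight 0 k) ?size_mkseq // -(@prod_rweight m k') ?size_mkseq //.
have nthf u : (0 <= u < k)%N -> nth0 (seq_of_row k f) u = entry f u.
  by move=> /andP[_ uk]; rewrite /nth0 nth_mkseq.
have nthg u : (0 <= u < k')%N -> nth0 (seq_of_row k' g) u = entry g u.
  by move=> /andP[_ uk]; rewrite /nth0 nth_mkseq.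
congr (_ * _ * q ^+ (_ + _)).
- by apply: eq_big_nat => u uk; rewrite addn0 -nthf.
- by apply: eq_big_nat => u uk; rewrite -nthg.
- by apply: eq_big_nat => u uk; apply: eq_big_nat => v vk; rewrite nthf // nthg.
- by apply: eq_big_nat => u uk; apply: eq_big_nat => v vk; rewrite nthf // nthg.
Qed.

Lemma sum_delta (k : nat) (P : nat -> bool) (Q : nat -> bool) (u0 : nat) :
  (forall u, (u < k)%N -> P u = (u == u0)) ->
  (\sum_(0 <= u < k) (P u && Q u) = (u0 < k) && Q u0)%N.
Proof.
move=> H; rewrite big_mkord.
have [u0k|ku0] := ltnP u0 k; last first.
  by apply: big1 => u _; rewrite H //; case: eqP => // E; move: ku0; rewrite -E leqNgt ltn_ord.
rewrite (bigD1 (Ordinal u0k)) //= H // eqxx big1 ?addn0 // => u nu.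
by move: nu; rewrite H // -(inj_eq val_inj) /= => /negPf ->.
Qed.

Lemma sum_false (k : nat) (P : nat -> bool) :
  (forall u, (u < k)%N -> P u = false) -> (\sum_(0 <= u < k) P u = 0)%N.
Proof. by move=> H; rewrite big_nat big1 // => u /andP[_ /H ->]. Qed.

Lemma nth0_cat_lt (s t : seq nat) (u : nat) : (u < size s)%N -> nth0 (s ++ t) u = nth0 s u.
Proof. by move=> us; rewrite /nth0 nth_cat us. Qed.

Lemma nth0_cat_ge (s t : seq nat) (u : nat) : nth0 (s ++ t) (u + size s) = nth0 t u.
Proof. by rewrite /nth0 nth_cat ltnNge leq_addl /= addnK. Qed.

Lemma attacks_before (m k k' : nat) (s1 s2 t : seq nat) :
  size s1 = m -> (m + size s2 = k)%N -> size t = k' ->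
  (attacks k k' (m%:Z - 1) (nth0 (s1 ++ s2)) (nth0 t) +
   attacks k' k (- m%:Z) (nth0 t) (nth0 (s1 ++ s2)))%N = rinv (last 0%N s1) s2 t.
Proof.
move=> s1m s2k tk; rewrite rinvE tk big_split /= addnC; congr addn.
  apply: eq_big_nat => v /andP[_ vk].
  rewrite (@sum_delta _ (fun u => v%:Z == u%:Z + - m%:Z) _ (v + m)%N); last by lia.
  by rewrite -{2}s1m nth0_cat_ge -s2k (addnC m) ltn_add2r.
rewrite /attacks exchange_big; apply: eq_big_nat => v /andP[_ vk].
case: v vk => [|v] vk.
  rewrite leq0n andTb -[nth 0%N (_ :: _) 0]/(last 0%N s1) -[nth 0%N t 0]/(nth0 t 0).
  case: m s1m s2k => [|m] sm s2k.
    by rewrite (size0nil sm) ltn0 sum_false // => u uk; apply/negbTE; lia.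
  rewrite (@sum_delta _ _ _ m); last by lia.
  by rewrite nth0_cat_lt ?sm // -s2k (leq_trans (ltnSn m) (leq_addr _ _)) -(nth_last 0%N) sm.
rewrite (@sum_delta _ _ _ (v + m)%N); last by lia.
by rewrite -{2}s1m nth0_cat_ge -s2k (addnC m) ltn_add2r.
Qed.

Lemma attacks_after (m k k' : nat) (s1 s2 t : seq nat) :
  size s1 = m -> (m + size s2 = k)%N -> size t = k' ->
  (attacks k k' m%:Z (nth0 (s1 ++ s2)) (nth0 t) +
   attacks k' k (-1 - m%:Z) (nth0 t) (nth0 (s1 ++ s2)))%N = rinv 0 t s2.
Proof.
move=> s1m s2k tk; rewrite rinvE tk big_split /= /attacks.
rewrite [X in (_ + X)%N]exchange_big -!big_split /= -s2k.
rewrite (big_cat_nat (n := m)) ?leq_addr //= [X in (X + _)%N]big_nat.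
rewrite [X in (X + _)%N]big1 ?add0n => [|u /andP[_ um]]; last first.
  by rewrite !sum_false // => v vk; apply/negbTE; lia.
rewrite -{1}[m]add0n big_addn addKn; apply: eq_big_nat => u /andP[_ us] /=.
have -> : nth0 (s1 ++ s2) (u + m) = nth0 s2 u by rewrite -s1m nth0_cat_ge.
congr addn.
  by rewrite (@sum_delta _ _ _ u) //; lia.
case: u us => [|u] us; first by rewrite sum_false // => v vk; apply/negbTE; lia.
by rewrite (@sum_delta _ _ _ u) //; lia.
Qed.

Lemma two_rows_before (k k' m : nat) : (k <= L.+1)%N -> (k' <= L.+1)%N -> (m <= k)%N ->
  two_rows q M L w k k' m (m%:Z - 1) (- m%:Z) =
  \sum_(s <- rows M.+1 m 0) rweight w 0 s *
    pair_sum q M.+1 w (last 0%N s) 0 (k - m) k' m.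
Proof.
move=> kL kL' mk; rewrite two_rows_seq // (big_rows_cat _ _ _ mk).
rewrite big_seq [RHS]big_seq; apply: eq_bigr => s1 /size_rows s1m.
rewrite mulr_sumr big_seq [RHS]big_seq; apply: eq_bigr => s2 /size_rows s2m.
rewrite mulr_sumr big_seq [RHS]big_seq; apply: eq_bigr => t /size_rows tk.
by rewrite attacks_before // ?s2m ?subnKC // rweight_cat s1m add0n !mulrA.
Qed.

Lemma two_rows_after (k k' m : nat) : (k <= L.+1)%N -> (k' <= L.+1)%N -> (m <= k)%N ->
  two_rows q M L w k k' m m%:Z (-1 - m%:Z) =
  \sum_(s <- rows M.+1 m 0) rweight w 0 s *
    pair_sum q M.+1 w 0 (last 0%N s) k' (k - m) m.
Proof.
move=> kL kL' mk; rewrite two_rows_seq // (big_rows_cat _ _ _ mk).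
rewrite big_seq [RHS]big_seq; apply: eq_bigr => s1 /size_rows s1m.
rewrite /pair_sum exchange_big.
rewrite mulr_sumr big_seq [RHS]big_seq; apply: eq_bigr => t /size_rows tk.
rewrite mulr_sumr big_seq [RHS]big_seq; apply: eq_bigr => s2 /size_rows s2m.
rewrite attacks_after // ?s2m ?subnKC // rweight_cat s1m add0n.
by ring.
Qed.

Lemma two_rows_far (k k' m : nat) : (k <= L.+1)%N -> (k' <= L.+1)%N -> (k < m)%N ->
  two_rows q M L w k k' m (m%:Z - 1) (- m%:Z) =
  two_rows q M L w k k' m m%:Z (-1 - m%:Z).
Proof.
move=> kL kL' km; rewrite !two_rows_seq //; apply: eq_bigr => s _; apply: eq_bigr => t _.
congr (_ * q ^+ _); rewrite /attacks.
by congr addn; apply: eq_big_nat => u uk; apply: eq_big_nat => v vk;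
  congr (nat_of_bool (_ && _)); apply/eqP/eqP; lia.
Qed.

Lemma two_rows_commute (k k' m : nat) : (k <= L.+1)%N -> (k' <= L.+1)%N ->
  [|| m == 0, k < m | m + k' <= k]%N ->
  two_rows q M L w k k' m (m%:Z - 1) (- m%:Z) =
  two_rows q M L w k k' m m%:Z (-1 - m%:Z).
Proof.
move=> kL kL'; have [km _|mk] := ltnP k m; first exact: two_rows_far.
rewrite orFb two_rows_before // two_rows_after // => /orP[/eqP ->|nest].
  by rewrite !big_seq1 pair_sum_diag.
apply: eq_bigr => s _; congr (_ * _); apply: pair_sum_nested => //.
by lia.
Qed.

Lemma two_rows_cross (k k' m : nat) : (k <= L.+1)%N -> (m + k' <= L.+1)%N ->
  (m <= k)%N -> (k < m + k')%N ->
  two_rows q M L w k k' m (m%:Z - 1) (- m%:Z) =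
  q * two_rows q M L w k k' m m%:Z (-1 - m%:Z) +
  (1 - q) * two_rows q M L w (m + k') (k - m) m m%:Z (-1 - m%:Z).
Proof.
move=> kL kL' mk km.
have kL'' : (k' <= L.+1)%N by lia.
have kL3 : (k - m <= L.+1)%N by lia.
rewrite two_rows_before // !two_rows_after // ?leq_addr // addKn.
rewrite !mulr_sumr -big_split; apply: eq_bigr => s _ /=.
have kk : (k - m <= k')%N by lia.
by rewrite (pair_sum_cross _ _ _ _ (leq0n _) kk); ring.
Qed.

End Columns.

(** * Weights of pairs *)

(* For rows of sizes [k], [k'] whose (perturbed) left ends differ by a number with
   floor [d], this is the weight [M] of the pair. *)
Definition wt (k k' : nat) (d : int) : int :=
  Num.max 0 (Num.min (Num.min k%:Z k'%:Z) (Num.min (k%:Z - d) (k'%:Z + d + 1))).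

(* Incomparable pairs: neither row is weakly nested in the other. Up to the sign
   [0 <= d] the weight of such a pair determines [d] as soon as it is nonzero. *)
Definition inc (k k' : nat) (d : int) : bool := wt k k' d != Num.min k%:Z k'%:Z.

Variant wt_spec (k k' : nat) (d : int) : int -> bool -> Type :=
| WtLow of (k <= k')%N & d <= 0 & k%:Z - k'%:Z - 1 <= d : wt_spec k k' d k%:Z false
| WtHigh of (k' < k)%N & d <= k%:Z - k'%:Z & -1 <= d : wt_spec k k' d k'%:Z false
| WtEmpty of (k == 0%N) || (k' == 0%N) : wt_spec k k' d 0 false
| WtR of 0 < d & k%:Z - k'%:Z < d & d < k%:Z : wt_spec k k' d (k%:Z - d) true
| WtL of d < -1 & d < k%:Z - k'%:Z - 1 & - k'%:Z - 1 < d : wt_spec k k' d (k'%:Z + d + 1) true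
| WtFR of (0 < k)%N & (0 < k')%N & k%:Z <= d : wt_spec k k' d 0 true
| WtFL of (0 < k)%N & (0 < k')%N & d <= - k'%:Z - 1 : wt_spec k k' d 0 true.

Lemma wtP (k k' : nat) (d : int) : wt_spec k k' d (wt k k' d) (inc k k' d).
Proof.
rewrite /inc.
have [->|k0] := posnP k.
  have -> : wt 0 k' d = 0 by rewrite /wt; lia.
  have -> : (0 != Num.min 0%:Z k'%:Z) = false by lia.
  exact: WtEmpty.
have [->|k0'] := posnP k'.
  have -> : wt k 0 d = 0 by rewrite /wt; lia.
  have -> : (0 != Num.min k%:Z 0%:Z) = false by lia.
  by apply: WtEmpty; rewrite orbT.
have [kd|dk] := leP k%:Z d.
  have -> : wt k k' d = 0 by rewrite /wt; lia.
  have -> : (0 != Num.min k%:Z k'%:Z) = true by lia.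
  exact: WtFR.
have [kd|dk'] := leP d (- k'%:Z - 1).
  have -> : wt k k' d = 0 by rewrite /wt; lia.
  have -> : (0 != Num.min k%:Z k'%:Z) = true by lia.
  exact: WtFL.
have [d0|d0] := ltP d (Num.min (-1) (k%:Z - k'%:Z - 1)).
  have -> : wt k k' d = k'%:Z + d + 1 by rewrite /wt; lia.
  have -> : (k'%:Z + d + 1 != Num.min k%:Z k'%:Z) = true by lia.
  by apply: WtL; lia.
have [d1|d1] := ltP (Num.max 0 (k%:Z - k'%:Z)) d.
  have -> : wt k k' d = k%:Z - d by rewrite /wt; lia.
  have -> : (k%:Z - d != Num.min k%:Z k'%:Z) = true by lia.
  by apply: WtR; lia.
have [kk|kk] := leqP k k'.
  have -> : wt k k' d = k%:Z by rewrite /wt; lia.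
  have -> : (k%:Z != Num.min k%:Z k'%:Z) = false by lia.
  by apply: WtLow => //; lia.
have -> : wt k k' d = k'%:Z by rewrite /wt; lia.
have -> : (k'%:Z != Num.min k%:Z k'%:Z) = false by lia.
by apply: WtHigh => //; lia.
Qed.

Lemma wt_rev (k k' : nat) (d : int) : wt k k' (k%:Z - k'%:Z - 1 - d) = wt k k' d.
Proof. by rewrite /wt; lia. Qed.

Lemma wt_sym (k k' : nat) (d : int) : wt k' k (-1 - d) = wt k k' d.
Proof. by rewrite /wt; lia. Qed.

Lemma inc_sym (k k' : nat) (d : int) : inc k' k (-1 - d) = inc k k' d.
Proof. by rewrite /inc wt_sym minC. Qed.

Lemma step_same (k k' : nat) (d d' : int) : wt k k' d = wt k k' d' -> d < d' ->
  (inc k k' d -> (0 <= d) = (0 <= d')) ->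
  wt k k' (d + 1) = wt k k' d /\ (inc k k' d -> (0 <= d + 1) = (0 <= d')).
Proof.
case: (wtP k k' d); case: (wtP k k' d'); case: (wtP k k' (d + 1)); lia.
Qed.

Lemma step_opp (k k' : nat) (d d' : int) : wt k k' d = wt k k' d' -> d < d' ->
  (inc k k' d -> (0 <= d) = ~~ (0 <= d')) ->
  (wt k k' (d + 1) = wt k k' d /\ (inc k k' d -> (0 <= d + 1) = ~~ (0 <= d'))) \/
  (wt k k' (d + 1) = wt k k' d + 1 /\ inc k k' d).
Proof.
case: (wtP k k' d); case: (wtP k k' d'); case: (wtP k k' (d + 1)); lia.
Qed.

Lemma opp_spec (k k' : nat) (d d' : int) :
  wt k k' d = wt k k' d' -> inc k k' d -> (0 <= d) = ~~ (0 <= d') ->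
  ((0 < d) /\ (k%:Z - k'%:Z < d) /\ (d' < -1) /\ (d' < k%:Z - k'%:Z - 1) /\
    ((k%:Z - d = k'%:Z + d' + 1 /\ d < k%:Z) \/ (k%:Z <= d /\ d' <= - k'%:Z - 1))) \/
  ((0 < d') /\ (k%:Z - k'%:Z < d') /\ (d < -1) /\ (d < k%:Z - k'%:Z - 1) /\
    ((k%:Z - d' = k'%:Z + d + 1 /\ d' < k%:Z) \/ (k%:Z <= d' /\ d <= - k'%:Z - 1))).
Proof. by case: (wtP k k' d); case: (wtP k k' d'); lia. Qed.

Lemma same_spec (k k' : nat) (d d' : int) :
  wt k k' d = wt k k' d' -> inc k k' d -> (0 <= d) = (0 <= d') ->
  ((0 < d) /\ (k%:Z - k'%:Z < d) /\ (0 < d') /\ (k%:Z - k'%:Z < d') /\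
    ((d = d' /\ d < k%:Z) \/ (k%:Z <= d /\ k%:Z <= d'))) \/
  ((d' < -1) /\ (d' < k%:Z - k'%:Z - 1) /\ (d < -1) /\ (d < k%:Z - k'%:Z - 1) /\
    ((d = d' /\ - k'%:Z - 1 < d) \/ (d <= - k'%:Z - 1 /\ d' <= - k'%:Z - 1))).
Proof. by case: (wtP k k' d); case: (wtP k k' d'); lia. Qed.

Lemma rainbow (kx ky kz : nat) (xy xz yz xy' xz' yz' : int) :
  (0 < kx)%N -> (0 < ky)%N -> (0 < kz)%N ->
  wt kx ky xy = wt kx ky xy' -> wt kx kz xz = wt kx kz xz' -> wt ky kz yz = wt ky kz yz' ->
  xy + yz <= xz <= xy + yz + 1 -> xy' + yz' <= xz' <= xy' + yz' + 1 ->
  inc kx ky xy -> (0 <= xy) = ~~ (0 <= xy') ->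
  inc kx kz xz -> (0 <= xz) = (0 <= xz') -> wt ky kz yz = 0.
Proof.
move=> x0 y0 z0 w1 w2 w3 t1 t2 i1 s1 i2 s2.
move: (opp_spec w1 i1 s1) (same_spec w2 i2 s2) => {w1 i1 s1 w2 i2 s2} A B.
case: (wtP ky kz yz) w3; case: (wtP ky kz yz'); lia.
Qed.

Lemma wt_meet (k1 ka kb : nat) (m : nat) (d : int) : (m <= ka)%N -> (ka < m + kb)%N ->
  wt k1 (ka - m) (d + m%:Z) =
  Num.min (ka - m)%:Z (Num.min (wt k1 ka d) (wt k1 kb (d + m%:Z))).
Proof.
case: (wtP k1 ka d); case: (wtP k1 kb _); case: (wtP k1 (ka - m) _); lia.
Qed.

Lemma wt_join (k1 ka kb : nat) (m : nat) (d : int) : (m <= ka)%N -> (ka < m + kb)%N ->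
  wt k1 (m + kb) d =
  Num.min k1%:Z (wt k1 ka d + wt k1 kb (d + m%:Z) - wt k1 (ka - m) (d + m%:Z)).
Proof.
move=> h1 h2.
case: (wtP k1 ka d) => *; case: (wtP k1 kb _) => *; try (exfalso; lia);
  case: (wtP k1 (ka - m) _) => *; try (exfalso; lia); case: (wtP k1 (m + kb) _); lia.
Qed.

(** * Alcoves *)

Section Alcoves.
Variables (I : finType).
Implicit Types (d : I -> I -> int).

Record alcove d : Prop := Alcove {
  alcove0 : forall i, d i i = 0;
  alcoveN : forall i j, i != j -> d j i = -1 - d i j;
  alcoveD : forall i j l, d i j + d j l <= d i l <= d i j + d j l + 1 }.

Definition crossing d d1 (a b : I) : Prop :=
  [/\ a != b, d1 a b = d a b + 1 &
    forall i j, (i, j) != (a, b) -> (i, j) != (b, a) -> d1 i j = d i j].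

Lemma crossing_sym d d1 a b : alcove d -> alcove d1 ->
  crossing d d1 a b -> crossing d1 d b a.
Proof.
move=> Ad Ad1 [ab dab E]; split; first by rewrite eq_sym.
  by rewrite (alcoveN Ad ab) (alcoveN Ad1 ab) dab; lia.
by move=> i j ij ji; rewrite E.
Qed.

Lemma crossing_cols d d1 a b : alcove d -> alcove d1 -> crossing d d1 a b ->
  forall c, other a b c -> d a c = d b c + d1 a b /\ d c b = d c a + d1 a b.
Proof.
move=> Ad Ad1 [ab dab E] c /andP[ca cb].
have e1 : d1 c a = d c a by apply: E; rewrite xpair_eqE ?(negPf ca) ?(negPf cb) ?andbF.
have e2 : d1 c b = d c b by apply: E; rewrite xpair_eqE ?(negPf ca) ?(negPf cb) ?andbF.
have e3 : d1 a c = d a c by apply: E; rewrite xpair_eqE ?(negPf ca) ?(negPf cb) ?andbF.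
have e4 : d1 b c = d b c by apply: E; rewrite xpair_eqE ?(negPf ca) ?(negPf cb) ?andbF.
have := alcoveD Ad c a b; have := alcoveD Ad1 c a b.
have := alcoveD Ad a b c; have := alcoveD Ad1 a b c.
rewrite e1 e2 e3 e4 dab; lia.
Qed.

Section Generating.
Variables (K : idomainType) (q : K) (x : nat -> K) (M L : nat).
Local Notation G := (gen q x M L).

Lemma eq_big_two_rows (k k1 : I -> nat) d d1 a b :
  (forall c, other a b c -> k1 c = k c) ->
  (forall c, other a b c -> d1 a c = d a c /\ d1 c a = d c a) ->
  (forall c c', other a b c -> other a b c' -> d1 c c' = d c c') ->
  (others_ok a b k1 =1 others_ok a b k (M := M) (L := L)) /\
  forall T, others_weight q x a b k1 d1 T = others_weight q x a b k d T (M := M) (L := L) /\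
   cell_weight q x a b k1 d1 T =2 cell_weight q x a b k d T (M := M) (L := L).
Proof.
move=> ek ed edd; split=> [T|T].
  rewrite /others_ok; congr [&& _, _ & _]; apply: eq_forallb => c.
  by case oc : (other a b c) => //=; rewrite ek.
split.
  congr (_ * q ^+ _); first by apply: eq_bigr => c oc; rewrite ek.
  by apply: eq_bigr => c oc; apply: eq_bigr => c' oc'; rewrite !ek // edd.
move=> u y; congr (_ * q ^+ _); apply: eq_bigr => c oc; rewrite ek //.
by have [-> ->] := ed c oc.
Qed.

Lemma crossing_other d d1 a b : crossing d d1 a b ->
  (forall c, other a b c -> d1 a c = d a c /\ d1 c a = d c a) /\
  (forall c c', other a b c -> other a b c' -> d1 c c' = d c c').
Proof.
move=> [ab _ E]; split=> [c /andP[ca cb]|c c' /andP[ca cb] _].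
  by rewrite !E ?xpair_eqE ?(negPf ca) ?(negPf cb) ?andbF.
by rewrite E ?xpair_eqE ?(negPf ca) ?(negPf cb).
Qed.

Lemma crossing_gen2 (k : I -> nat) d d1 a b (m : nat) :
  alcove d -> alcove d1 -> crossing d d1 a b -> d1 a b = m%:Z ->
  G k d = \sum_(T : {ffun I -> {ffun 'I_L.+1 -> 'I_M.+1}} | others_ok a b k T)
    others_weight q x a b k d T *
    two_rows q M L (cell_weight q x a b k d T) (k a) (k b) m (m%:Z - 1) (- m%:Z).
Proof.
move=> Ad Ad1 cr dm; have [ab dab _] := cr.
rewrite (gen_two_rows q x M L ab k (m := m) (alcove0 Ad)); last first.
  by rewrite -dm; exact: crossing_cols.
have -> : d a b = m%:Z - 1 by lia.
by have -> : d b a = - m%:Z by rewrite (alcoveN Ad ab); lia.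
Qed.

Lemma crossing_gen2' (k k1 : I -> nat) d d1 a b (m : nat) :
  (forall c, other a b c -> k1 c = k c) ->
  alcove d -> alcove d1 -> crossing d d1 a b -> d1 a b = m%:Z ->
  G k1 d1 = \sum_(T : {ffun I -> {ffun 'I_L.+1 -> 'I_M.+1}} | others_ok a b k T)
    others_weight q x a b k d T *
    two_rows q M L (cell_weight q x a b k d T) (k1 a) (k1 b) m m%:Z (-1 - m%:Z).
Proof.
move=> ek Ad Ad1 cr dm; have [ab dab _] := cr.
have [od odd] := crossing_other cr.
have [eP eT] := eq_big_two_rows ek od odd.
rewrite (gen_two_rows q x M L ab k1 (m := m) (alcove0 Ad1)); last first.
  move=> c oc; rewrite -dm.
  have [_ _ E] := cr; have [dac dca] := od c oc; have [h1 h2] := crossing_cols Ad Ad1 cr oc.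
  case/andP: oc => ca cb.
  have -> : d1 b c = d b c by rewrite E ?xpair_eqE ?(negPf ca) ?(negPf cb) ?andbF.
  have -> : d1 c b = d c b by rewrite E ?xpair_eqE ?(negPf ca) ?(negPf cb) ?andbF.
  by rewrite dac dca; split.
rewrite dm (alcoveN Ad1 ab) dm.
apply: eq_big => // T _; have [-> ew] := eT T; congr (_ * _).
apply: eq_bigr => f _; apply: eq_bigr => g _; congr (_ * _ * _).
  by apply: eq_bigr => u _; rewrite ew.
by apply: eq_bigr => u _; rewrite ew.
Qed.

Lemma gen_commute (k : I -> nat) d d1 a b :
  (forall i, (k i <= L.+1)%N) -> alcove d -> alcove d1 -> crossing d d1 a b ->
  wt (k a) (k b) (d a b) = wt (k a) (k b) (d1 a b) -> G k d = G k d1.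
Proof.
move=> kL; wlog dab : d d1 a b / 0 <= d1 a b => [W Ad Ad1 cr E|].
  have [h|h] := leP 0 (d1 a b); first exact: W cr E.
  have [ab dab _] := cr; apply/esym/(W d1 d b a) => //.
  - by rewrite (alcoveN Ad ab); lia.
  - exact: crossing_sym.
  by rewrite (alcoveN Ad ab) (alcoveN Ad1 ab) !wt_sym.
move=> Ad Ad1 cr E.
case dm : (d1 a b) dab => [m|//] _.
rewrite (crossing_gen2 k Ad Ad1 cr dm) (crossing_gen2' (k := k) _ Ad Ad1 cr dm) //.
apply: eq_bigr => T _; congr (_ * _); apply: two_rows_commute => //.
have [ab dab _] := cr; have dE : d a b = m%:Z - 1 by lia.
by move: E; rewrite dE dm /wt; lia.
Qed.

Lemma gen_crossing (k : I -> nat) d d1 a b (m : nat) :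
  (forall i, (k i <= L.+1)%N) -> alcove d -> alcove d1 -> crossing d d1 a b ->
  d1 a b = m%:Z -> (m <= k a)%N -> (k a < m + k b)%N -> (m + k b <= L.+1)%N ->
  G k d = q * G k d1 + (1 - q) *
    G (fun i => if i == a then (m + k b)%N else if i == b then (k a - m)%N else k i) d1.
Proof.
move=> kL Ad Ad1 cr dm mk km mL; have [ab _ _] := cr.
rewrite (crossing_gen2 k Ad Ad1 cr dm) !(crossing_gen2' (k := k) _ Ad Ad1 cr dm) //; last first.
  by move=> c /andP[/negPf -> /negPf ->].
rewrite eqxx eq_sym (negPf ab) eqxx !mulr_sumr -big_split; apply: eq_bigr => T _ /=.
by rewrite two_rows_cross //; ring.
Qed.

End Generating.
End Alcoves.

(** * Generic positions *)

Section Floor.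
Variable R : archiRealFieldType.
Implicit Types (y z c : R).
Local Notation floor := Num.floor.

Lemma floor_lt_nonint y : y \isn't a Num.int -> (floor y)%:~R < y.
Proof. by rewrite intrEfloor lt_neqAle floor_le andbT. Qed.

Lemma nonintN y : (- y \is a Num.int) = (y \is a Num.int).
Proof. exact: rpredN. Qed.

Lemma floorN_nonint y : y \isn't a Num.int -> floor (- y) = -1 - floor y.
Proof.
move=> ny; apply/eqP; rewrite floor_eq.
have := floor_lt_nonint ny; have := floorD1_gt y.
rewrite !intrD !intrN; move: ((floor y)%:~R : R) => f /=; rewrite !mulr1z; lra.
Qed.

Lemma nonint_open (n : int) z : n%:~R < z < n%:~R + 1 -> z \isn't a Num.int /\ floor z = n.
Proof.
move=> h; have fz : floor z = n.
  by apply/eqP; rewrite floor_eq intrD mulr1z; lra.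
by split=> //; rewrite intrEfloor fz; apply/eqP; lra.
Qed.

Lemma exists_between (s t : seq R) :
  (forall u v, u \in s -> v \in t -> u < v) ->
  exists z, (forall u, u \in s -> u < z) /\ (forall v, v \in t -> z < v).
Proof.
have maxs (r : seq R) (u : R) : exists2 m, m \in u :: r & forall v, v \in u :: r -> v <= m.
  elim: r u => [|v r IH] u; first by exists u; rewrite ?inE // => v; rewrite inE => /eqP ->.
  have [m mr mP] := IH u; have [vm|mv] := leP v m.
    exists m; first by move: mr; rewrite !inE => /orP[->|->]; rewrite ?orbT.
    by move=> w; rewrite !inE => /or3P[wu|/eqP->//|wr]; apply: mP; rewrite inE ?wu ?wr ?orbT.
  exists v; first by rewrite !inE eqxx orbT.
  move=> w; rewrite !inE => /or3P[wu|/eqP->//|wr]; apply: le_trans (ltW mv); apply: mP;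
  by rewrite inE ?wu ?wr ?orbT.
have mins (r : seq R) (u : R) : exists2 m, m \in u :: r & forall v, v \in u :: r -> m <= v.
  have [m mr mP] := maxs [seq - v | v <- r] (- u).
  exists (- m).
    move: mr; rewrite !inE => /orP[/eqP->|/mapP[v vr ->]]; rewrite opprK ?eqxx //.
    by rewrite vr orbT.
  move=> v; rewrite inE => vr; rewrite lerNl; apply: mP; rewrite inE.
  case/orP: vr => [/eqP->|vr]; first by rewrite eqxx.
  by rewrite map_f ?orbT.
case: s t => [|u s] [|v t] st.
- by exists 0.
- have [m _ mP] := mins t v; exists (m - 1); split=> // w /mP; lra.
- have [m _ mP] := maxs s u; exists (m + 1); split=> // w /mP; lra.
have [m /st ms mP] := maxs s u; have [m' /ms mm mP'] := mins t v.
by exists ((m + m') / 2); split=> w => [/mP|/mP']; lra.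
Qed.

Lemma near_above (y : R) (cs ts : seq R) : (forall t, t \in ts -> y < t) ->
  exists z, [/\ y < z, z < y + 1, forall t, t \in ts -> z < t & forall c, c \in cs ->
    Num.floor (z - c) = Num.floor (y - c) /\ z - c \isn't a Num.int].
Proof.
pose ub c : R := (Num.floor (y - c) + 1)%:~R + c.
move=> yts; have [|z [zy zc]] := @exists_between [:: y] (y + 1 :: ts ++ map ub cs).
  move=> u v; rewrite !inE => /eqP -> /orP[/eqP->|]; first by lra.
  rewrite mem_cat => /orP[/yts //|/mapP[c _ ->]].
  by rewrite /ub; have := floorD1_gt (y - c); lra.
have yz := zy y (mem_head _ _).
exists z; split=> // [|t tt|c cs_c]; first by apply: zc; rewrite mem_head.
  by apply: zc; rewrite inE mem_cat tt orbT.
have /zc h : ub c \in (y + 1 :: ts ++ map ub cs) by rewrite inE mem_cat map_f ?orbT.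
have h' := floor_le (y - c).
have [] := @nonint_open (Num.floor (y - c)) (z - c); last by [].
by move: h; rewrite /ub intrD mulr1z; move: ((Num.floor _)%:~R : R) h' => f; lra.
Qed.

Lemma near_below (y : R) (cs : seq R) : (forall c, c \in cs -> y - c \isn't a Num.int) ->
  exists z, [/\ y - 1 < z, z < y & forall c, c \in cs ->
    floor (z - c) = floor (y - c) /\ z - c \isn't a Num.int].
Proof.
move=> nc.
have [//|z [z1 z2 _ zc]] := @near_above (- y) [seq - c | c <- cs] [::].
exists (- z); split; [lra|lra|move=> c cs_c].
have [|e ni] := zc (- c); first by rewrite map_f.
have nz : - z - c \isn't a Num.int by rewrite -nonintN opprD opprK.
split=> //; have := floorN_nonint nz; rewrite opprD opprK e.
by rewrite -opprD (floorN_nonint (nc _ cs_c)) => /addrI/oppr_inj.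
Qed.

End Floor.

Section Positions.
Variables (R : archiRealFieldType) (I : finType).
Implicit Types (p : I -> R) (d : I -> I -> int).

Definition disp p (i j : I) : int := Num.floor (p j - p i).

Definition generic p : Prop := forall i j, i != j -> p j - p i \isn't a Num.int.

Lemma alcove_disp p : generic p -> alcove (disp p).
Proof.
move=> gp; split=> [i|i j ij|i j l]; rewrite /disp.
- by rewrite subrr floor0.
- by rewrite -opprB floorN_nonint ?gp.
have := floor_itv (p j - p i); have := floor_itv (p l - p j).
have := floor_itv (p l - p i); rewrite !intrD.
set x := Num.floor _; set y := Num.floor _; set z := Num.floor _ => h1 h2 h3.
have h4 : (z + y)%:~R < (x + 1)%:~R :> R by rewrite !intrD; lra.
have h5 : x%:~R < (z + y + 2)%:~R :> R by rewrite !intrD; lra.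
by move: h4 h5; rewrite !ltr_int; lia.
Qed.

Definition upd p (b : I) (z : R) (i : I) : R := if i == b then z else p i.

Lemma upd_same p b z : upd p b z b = z. Proof. by rewrite /upd eqxx. Qed.

Lemma upd_other p b z i : i != b -> upd p b z i = p i.
Proof. by rewrite /upd => /negPf ->. Qed.

Lemma upd_disp p b z : generic p -> (forall c, c != b -> z - p c \isn't a Num.int) ->
  generic (upd p b z) /\
  forall d1, alcove d1 -> (forall c, c != b -> d1 c b = Num.floor (z - p c)) ->
  (forall i j, i != b -> j != b -> d1 i j = disp p i j) -> disp (upd p b z) =2 d1.
Proof.
move=> gp nz.
have gu : generic (upd p b z).
  move=> i j ij; have [ib|ib] := eqVneq i b; have [jb|jb] := eqVneq j b.
  - by move: ij; rewrite ib jb eqxx.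
  - by rewrite ib upd_same upd_other // -nonintN opprB nz.
  - by rewrite jb upd_same upd_other // nz.
  by rewrite !upd_other // gp.
split=> // d1 A1 d1b d1o i j.
have Ac c : c != b -> disp (upd p b z) c b = d1 c b.
  by move=> cb; rewrite d1b // /disp upd_same upd_other.
have [->|ij] := eqVneq i j; first by rewrite (alcove0 A1) (alcove0 (alcove_disp gu)).
have [jb|jb] := eqVneq j b; first by rewrite jb Ac // -jb.
have [ib|ib] := eqVneq i b.
  by rewrite ib (alcoveN A1 jb) (alcoveN (alcove_disp gu) jb) Ac.
by rewrite d1o // /disp !upd_other.
Qed.

Definition wall p a b : Prop :=
  a != b /\ forall c, other a b c ->
    Num.floor (p a + (disp p a b + 1)%:~R - p c) = disp p c b.

Lemma exists_wall p d : generic p -> alcove d -> (exists i j, disp p i j != d i j) ->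
  exists a b, disp p a b < d a b /\ wall p a b.
Proof.
move=> gp Ad [i0 [j0 ne]]; have Ap := alcove_disp gp.
pose P (ij : I * I) := disp p ij.1 ij.2 < d ij.1 ij.2.
pose gap (ij : I * I) : R := (disp p ij.1 ij.2 + 1)%:~R - (p ij.2 - p ij.1).
have [ij0 Pij] : exists ij, P ij.
  have ij : i0 != j0.
    by apply: contra_neq ne => ->; rewrite (alcove0 Ap) (alcove0 Ad).
  have [h|h] := ltP (disp p i0 j0) (d i0 j0); first by exists (i0, j0).
  exists (j0, i0); rewrite /P /= (alcoveN Ap ij) (alcoveN Ad ij); lia.
case: (@arg_minP _ R _ ij0 P gap Pij) => -[a b] /= Pab gmin.
have ab : a != b.
  by apply/eqP => ab; move: Pab; rewrite /P /= ab (alcove0 Ap) (alcove0 Ad).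
exists a, b; split=> //; split=> // c /andP[ca cb].
set m := disp p a b + 1.
pose t := Num.floor (p a + m%:~R - p c).
have tP := floor_itv (p a + m%:~R - p c); rewrite -/t intrD mulr1z in tP.
have nt : p a + m%:~R - p c \isn't a Num.int.
  by rewrite addrAC rpredDr ?intr_int // gp.
have tlt := floor_lt_nonint nt; rewrite -/t in tlt.
have gab : 0 < gap (a, b) by rewrite /gap /= subr_gt0 floorD1_gt.
have dab := floor_itv (p b - p a); rewrite -/(disp p a b) intrD mulr1z in dab.
have gE : gap (a, b) = m%:~R - (p b - p a) by [].
rewrite -/t; apply/esym/eqP; rewrite /disp floor_eq intrD mulr1z.
apply/andP; split; last by move: tlt; lra.
rewrite leNgt; apply/negP => lt.
have m1 : m%:~R = (disp p a b)%:~R + 1 :> R by rewrite /m intrD mulr1z.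
have dac : disp p a c = m - t - 1.
  apply/eqP; rewrite floor_eq !intrD !intrN !mulr1z; lra.
have dcb : disp p c b = t - 1.
  apply/eqP; rewrite floor_eq !intrD !intrN !mulr1z; lra.
have h1 : d a c <= disp p a c.
  rewrite leNgt; apply/negP => /(gmin (a, c)); rewrite leNgt => /negP; apply.
  by rewrite gE /gap /= dac !intrD !intrN !mulr1z; lra.
have h2 : d c b <= disp p c b.
  rewrite leNgt; apply/negP => /(gmin (c, b)); rewrite leNgt => /negP; apply.
  by rewrite gE /gap /= dcb !intrD !intrN !mulr1z; lra.
have := alcoveD Ad a c b; move: Pab h1 h2; rewrite /P /= dac dcb /m; clear; lia.
Qed.

Lemma cross_wall p a b (cs : seq R) : generic p -> wall p a b ->
  let y := p a + (disp p a b + 1)%:~R in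
  (forall c, c \in cs -> y - c \isn't a Num.int) ->
  exists z0 z1, [/\ generic (upd p b z0), generic (upd p b z1),
    disp (upd p b z0) =2 disp p, crossing (disp p) (disp (upd p b z1)) a b &
    forall c, c \in cs -> [/\ Num.floor (z0 - c) = Num.floor (y - c),
       Num.floor (z1 - c) = Num.floor (y - c),
       z0 - c \isn't a Num.int & z1 - c \isn't a Num.int]].
Proof.
move=> gp [ab W] y ycs; have Ap := alcove_disp gp.
pose cs' := cs ++ [seq p c | c <- enum I & other a b c].
have ycs' c : c \in cs' -> y - c \isn't a Num.int.
  rewrite mem_cat => /orP[/ycs //|/mapP[e]]; rewrite mem_filter => /andP[/andP[ea eb] _] ->.
  by rewrite /y addrAC rpredDr ?intr_int // gp.
have in_cs' c : other a b c -> p c \in cs'.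
  by move=> oc; rewrite mem_cat map_f ?orbT // mem_filter oc mem_enum.
have [z0 [z0l z0r z0P]] := near_below ycs'.
have [//|z1 [z1l z1r _ z1P]] := @near_above _ y cs' [::].
have mE : (disp p a b + 1)%:~R = (disp p a b)%:~R + 1 :> R by rewrite intrD mulr1z.
have [ni0 f0] : z0 - p a \isn't a Num.int /\ Num.floor (z0 - p a) = disp p a b.
  by apply: nonint_open; move: z0l z0r; rewrite /y mE; lra.
have [ni1 f1] : z1 - p a \isn't a Num.int /\ Num.floor (z1 - p a) = disp p a b + 1.
  by apply: nonint_open; move: z1l z1r; rewrite /y mE; lra.
have N0 c : c != b -> z0 - p c \isn't a Num.int.
  move=> cb; have [->//|ca] := eqVneq c a.
  by have [] := z0P (p c) (in_cs' c _); rewrite /other ?ca.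
have N1 c : c != b -> z1 - p c \isn't a Num.int.
  move=> cb; have [->//|ca] := eqVneq c a.
  by have [] := z1P (p c) (in_cs' c _); rewrite /other ?ca.
have [g0 D0] := upd_disp gp N0; have [g1 _] := upd_disp gp N1.
exists z0, z1; split=> //; last 1 first.
- move=> c cc; have c' : c \in cs' by rewrite mem_cat cc.
  by have [? ?] := z0P c c'; have [? ?] := z1P c c'.
- apply: D0 => // c cb; have [->//|ca] := eqVneq c a.
  by have [|-> _] := z0P (p c) (in_cs' c _); rewrite /other ?ca // W // /other ca.
split=> //; first by rewrite /disp upd_same upd_other.
have A1 := alcove_disp g1.
have Eb c : c != b -> c != a -> disp (upd p b z1) c b = disp p c b.
  move=> cb ca; rewrite /disp upd_same upd_other //.
  by have [|-> _] := z1P (p c) (in_cs' c _); rewrite /other ?ca // W // /other ca.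
move=> i j; rewrite !xpair_eqE => n1 n2.
have [->|ij] := eqVneq i j; first by rewrite (alcove0 A1) (alcove0 Ap).
have [jb|jb] := eqVneq j b.
  by rewrite jb; apply: Eb; rewrite -?jb //; move: n1; rewrite jb eqxx andbT.
have [ib|ib] := eqVneq i b.
  rewrite ib (alcoveN A1 jb) (alcoveN Ap jb) Eb //.
  by move: n2; rewrite ib eqxx.
by rewrite /disp !upd_other.
Qed.

End Positions.

(** * Reversing a block *)

Definition same_pair (o : bool) (k k' : nat) (d d' : int) : Prop :=
  wt k k' d = wt k k' d' /\ (inc k k' d -> (0 <= d) = o (+) (0 <= d')).

Lemma same_pair_inc o k k' d d' : same_pair o k k' d d' -> inc k k' d = inc k k' d'.
Proof. by rewrite /inc => -[->]. Qed.

Lemma same_pair_flip o k k' d d' :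
  same_pair o k k' d d' -> same_pair o k' k (-1 - d) (-1 - d').
Proof.
case=> E H; rewrite /same_pair !wt_sym inc_sym; split=> // /H.
by case: o {H} => /=; lia.
Qed.

Lemma same_pair_sym o k k' d d' : same_pair o k k' d d' -> same_pair o k k' d' d.
Proof.
move=> S; have [E H] := S; split=> // ic; rewrite -(same_pair_inc S) in ic.
by rewrite (H ic) addbA addbb.
Qed.

Lemma same_pair_comp o k k' d d1 d2 :
  same_pair o k k' d d1 -> same_pair o k k' d d2 -> same_pair false k k' d1 d2.
Proof.
move=> S1 S2; have [E1 H1] := S1; have [E2 H2] := S2.
split=> [|i1]; first by rewrite -E1.
rewrite -(same_pair_inc S1) in i1; move: (H1 i1) (H2 i1).
by case: (0 <= d); case: (0 <= d1); case: (0 <= d2); case: o {S1 S2 H1 H2}.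
Qed.

Lemma same_pair_step o k k' d d' : same_pair o k k' d d' -> d < d' ->
  (same_pair o k k' (d + 1) d' /\ wt k k' (d + 1) = wt k k' d) \/
  [/\ o, inc k k' d & wt k k' (d + 1) = wt k k' d + 1].
Proof.
have iE e : wt k k' (d + 1) = wt k k' d -> inc k k' (d + 1) -> (e : Prop) \/ inc k k' d.
  by rewrite /inc => ->; right.
case: o => -[E H] dd.
  have [[E1 H1]|[E1 i1]] := step_opp E dd H; last by right; split.
  left; split=> //; split=> [|i1]; first by rewrite E1.
  by case: (iE False E1 i1) => // /H1.
have [E1 H1] := step_same E dd H.
left; split=> //; split=> [|i1]; first by rewrite E1.
by case: (iE False E1 i1) => // /H1.
Qed.

Lemma inc_up k k' d : inc k k' d -> wt k k' (d + 1) = wt k k' d + 1 ->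
  d < -1 /\ (- 1 - d <= k'%:Z /\ k'%:Z < (-1 - d) + k%:Z).
Proof. case: (wtP k k' d) => //; case: (wtP k k' (d + 1)); lia. Qed.

Section Mirror.
Variable (I : finType).
Implicit Types (d : I -> I -> int) (k : I -> nat) (B : {set I}).

Definition mirror B k d d' : Prop := forall i j, i != j ->
  same_pair ((i \in B) && (j \in B)) (k i) (k j) (d i j) (d' i j).

(* The rows outside [B] do not notice a suitably centred reversal of [B]. *)
Definition block B k d : Prop := forall J, J \notin B ->
  [\/ k J = 0%N, forall i, i \in B -> (k i)%:Z <= d i J,
      forall i, i \in B -> d i J + (k J)%:Z < 0 |
      forall i, i \in B -> (k i <= k J)%N /\ ~~ inc (k i) (k J) (d i J)].

Definition sep d d' : nat := (\sum_i \sum_j `|d i j - d' i j|)%N.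

Definition deficit k d : nat :=
  (\sum_i \sum_j `|Num.min (k i)%:Z (k j)%:Z - wt (k i) (k j) (d i j)|)%N.

Lemma sum2_lt (F F' : I -> I -> nat) (a b : I) :
  (forall i j, F i j <= F' i j)%N -> (F a b < F' a b)%N ->
  (\sum_i \sum_j F i j < \sum_i \sum_j F' i j)%N.
Proof.
move=> FF Fab; rewrite [ltnLHS](bigD1 a) // [ltnRHS](bigD1 a) //=.
rewrite -addSn leq_add //; last by apply: leq_sum => i _; exact: leq_sum.
rewrite [ltnLHS](bigD1 b) // [ltnRHS](bigD1 b) //=.
by rewrite -addSn leq_add // leq_sum.
Qed.

Lemma crossing_pairs d d1 a b (P : I -> I -> int -> Prop) :
  alcove d -> alcove d1 -> crossing d d1 a b ->
  (forall i j e, i != j -> P i j e -> P j i (-1 - e)) ->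
  (forall i j, i != j -> P i j (d i j)) -> P a b (d1 a b) ->
  forall i j, i != j -> P i j (d1 i j).
Proof.
move=> Ad Ad1 [ab _ E] sym PD Pab i j ij.
have [/eqP|h1] := eqVneq (i, j) (a, b).
  by rewrite xpair_eqE => /andP[/eqP -> /eqP ->].
have [/eqP|h2] := eqVneq (i, j) (b, a); last by rewrite E //; exact: PD.
rewrite xpair_eqE => /andP[/eqP -> /eqP ->].
by rewrite (alcoveN Ad1 ab); exact: sym.
Qed.

Lemma crossing_sep d d1 d' a b : alcove d -> alcove d1 -> alcove d' ->
  crossing d d1 a b -> d a b < d' a b -> (sep d1 d' < sep d d')%N.
Proof.
move=> Ad Ad1 Ad' cr dd; have [ab dab E] := cr; apply: (sum2_lt (a := a) (b := b)); last by lia.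
move=> i j; have [->|ij] := eqVneq i j; first by rewrite (alcove0 Ad) (alcove0 Ad1).
apply: (crossing_pairs (P := fun i j e => `|e - d' i j| <= `|d i j - d' i j|)%N Ad Ad1 cr) ij => //.
  by move=> {}i {}j e ij; rewrite (alcoveN Ad ij) (alcoveN Ad' ij); lia.
by lia.
Qed.

Lemma crossing_mirror B k d d1 d' a b : alcove d -> alcove d1 -> alcove d' ->
  crossing d d1 a b -> mirror B k d d' ->
  same_pair ((a \in B) && (b \in B)) (k a) (k b) (d1 a b) (d' a b) -> mirror B k d1 d'.
Proof.
move=> Ad Ad1 Ad' cr mir ab i j ij.
apply: (crossing_pairs (P := fun i j e =>
  same_pair ((i \in B) && (j \in B)) (k i) (k j) e (d' i j)) Ad Ad1 cr) ij => //.
by move=> {}i {}j e ij; rewrite (alcoveN Ad' ij) andbC; exact: same_pair_flip.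
Qed.

Variables (R : archiRealFieldType) (K : idomainType) (q : K) (x : nat -> K) (M L : nat).
Local Notation G := (gen q x M L).
Implicit Types (p : I -> R).

Lemma gen_same_sign k p p' : (forall i, (k i <= L.+1)%N) -> generic p -> generic p' ->
  mirror set0 k (disp p) (disp p') -> G k (disp p) = G k (disp p').
Proof.
move=> kL gp gp' mir; have [n] := ubnP (sep (disp p) (disp p')).
elim: n p gp mir => // n IH p gp mir; rewrite ltnS => sn.
have [/existsP[i /existsP[j ne]]|none] :=
  boolP [exists i, exists j, disp p i j != disp p' i j]; last first.
  apply: eq_gen => // i j; apply/eqP; apply: contraNT none => ne.
  by apply/existsP; exists i; apply/existsP; exists j.
have [Ap Ap'] := (alcove_disp gp, alcove_disp gp').
have [|a [b [lab W]]] := exists_wall gp Ap'; first by exists i, j.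
have [//|z0 [z1 [_ g1 _ cr _]]] := cross_wall (cs := [::]) gp W.
have Ap1 := alcove_disp g1; have [ab dab _] := cr.
have [[S E]|[]] := same_pair_step (mir a b ab) lab; last by rewrite inE.
rewrite (gen_commute q x M kL Ap Ap1 cr) ?dab ?E //.
apply: IH => //.
  by apply: crossing_mirror Ap Ap1 Ap' cr mir _; rewrite dab.
exact: leq_trans (crossing_sep Ap Ap1 Ap' cr lab) sn.
Qed.

Definition rev_pos (c : R) B k p (i : I) : R :=
  if i \in B then c - p i - (k i)%:R else p i.

Definition rev_bounds (k k' : nat) (u u' v : R) : Prop :=
  [\/ k' = 0%N, u + k%:R < v /\ u' + k%:R < v, v + k'%:R < u /\ v + k'%:R < u' |
    (k <= k')%N /\ (v - 1 < u /\ u + k%:R < v + k'%:R + 1) /\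
                   (v - 1 < u' /\ u' + k%:R < v + k'%:R + 1)].

Lemma rev_bounds_pair (n n' : nat) (u u' v : R) : (0 < n)%N -> rev_bounds n n' u u' v ->
  same_pair false n n' (Num.floor (v - u)) (Num.floor (v - u')).
Proof.
have right (w : R) : w + n%:R < v -> n%:Z <= Num.floor (v - w).
  by move=> h; rewrite floor_ge_int -[n%:Z%:~R]/(n%:R : R); lra.
have left (w : R) : v + n'%:R < w -> Num.floor (v - w) < - n'%:Z.
  by move=> h; rewrite floor_lt_int intrN -[n'%:Z%:~R]/(n'%:R : R); lra.
have cover (w : R) : v - 1 < w /\ w + n%:R < v + n'%:R + 1 ->
    Num.floor (v - w) < 1 /\ n%:Z - n'%:Z - 1 <= Num.floor (v - w).
  move=> h; rewrite floor_lt_int floor_ge_int !intrD !intrN.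
  by rewrite -[n%:Z%:~R]/(n%:R : R) -[n'%:Z%:~R]/(n'%:R : R); lra.
rewrite /same_pair => n0 [->|[/right h /right h']|[/left h /left h']|[nn [/cover h /cover h']]].
- by case: (wtP n 0 _); case: (wtP n 0 _); lia.
- move: h h' {right left cover}; move: (Num.floor _) (Num.floor _) => f f'.
  by case: (wtP n n' _); case: (wtP n n' _); lia.
- move: h h' {right left cover}; move: (Num.floor _) (Num.floor _) => f f'.
  by case: (wtP n n' _); case: (wtP n n' _); lia.
move: h h' {right left cover}; move: (Num.floor _) (Num.floor _) => f f'.
by case: (wtP n n' _); case: (wtP n n' _); lia.
Qed.

Lemma rev_center B k p :
  (forall J, J \notin B -> [\/ k J = 0%N, forall i, i \in B -> p i + (k i)%:R < p J,
     forall i, i \in B -> p J + (k J)%:R < p i |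
     forall i, i \in B -> (k i <= k J)%N /\
        (p J - 1 < p i /\ p i + (k i)%:R < p J + (k J)%:R + 1)]) ->
  exists c, forall i J, i \in B -> J \notin B ->
    c - p i - (k i)%:R - p J \isn't a Num.int /\
    rev_bounds (k i) (k J) (p i) (c - p i - (k i)%:R) (p J).
Proof.
move=> bl.
pose isR J := [forall i in B, p i + (k i)%:R < p J].
pose isL J := [forall i in B, p J + (k J)%:R < p i].
pose isC J := [forall i in B, (p J - 1 < p i) && (p i + (k i)%:R < p J + (k J)%:R + 1)].
pose As := [seq p J + (k J)%:R | J <- enum I & isL J] ++ [seq p J - 1 | J <- enum I & isC J].
pose Zs := [seq p J | J <- enum I & isR J] ++ [seq p J + (k J)%:R + 1 | J <- enum I & isC J].
have [u v|A [As_A A_p]] := @exists_between R As [seq p i | i <- enum B].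
  rewrite mem_cat => /orP[]/mapP[J]; rewrite mem_filter => /andP[/forall_inP h _] ->.
    by move=> /mapP[i]; rewrite mem_enum => iB ->; exact: h.
  by move=> /mapP[i]; rewrite mem_enum => iB ->; have /andP[] := h i iB.
have [u v|Z0 [r_Z Z_Zs]] := @exists_between R [seq p i + (k i)%:R | i <- enum B] Zs.
  move=> /mapP[i]; rewrite mem_enum => iB ->; rewrite mem_cat.
  case/orP=> /mapP[J]; rewrite mem_filter => /andP[/forall_inP h _] ->; first exact: h.
  by have /andP[] := h i iB.
have [//|Z [Z0Z _ ZZs ni]] :=
  @near_above R Z0 [seq p i + (k i)%:R + p J - A | i <- enum I, J <- enum I] Zs.
exists (A + Z) => i J iB JB.
have Api : A < p i by apply: A_p; rewrite map_f // mem_enum.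
have piZ : p i + (k i)%:R < Z by
  apply: lt_trans Z0Z; apply: r_Z; rewrite (map_f (fun i => p i + _)) // mem_enum.
split.
  have [|_] := ni (p i + (k i)%:R + p J - A); first by
    apply/allpairsP; exists (i, J); rewrite !mem_enum.
  by congr (~~ (_ \is a _)); ring.
have [k0|h|h|h] := bl J JB.
- exact: Or41.
- apply: Or42; split; first exact: h.
  suff : Z < p J by lra.
  apply: ZZs; rewrite mem_cat map_f // mem_filter mem_enum andbT.
  by apply/forall_inP.
- apply: Or43; split; first exact: h.
  suff : p J + (k J)%:R < A by lra.
  apply: As_A; rewrite mem_cat (map_f (fun J => p J + _)) // mem_filter mem_enum andbT.
  by apply/forall_inP.
apply: Or44; have [kk hh] := h i iB; split=> //; split=> //.
have cJ : J \in [seq J <- enum I | isC J].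
  by rewrite mem_filter mem_enum andbT; apply/forall_inP => j /h[_ [-> ->]].
have h1 : p J - 1 < A.
  by apply: As_A; rewrite mem_cat (map_f (fun J => p J - 1)) ?orbT.
have h2 : Z < p J + (k J)%:R + 1.
  by apply: ZZs; rewrite mem_cat (map_f (fun J => p J + _ + 1)) ?orbT.
lra.
Qed.

(* [p1] is the reference position at which the centre was chosen, [p] a
   perturbation of it: only the row crossing a wall differs. *)
Lemma rev_mirror (c : R) B k p p1 : generic p ->
  (forall i, i \in B -> (0 < k i)%N) ->
  (forall J, J \notin B -> p J = p1 J) ->
  (forall i J, i \in B -> J \notin B ->
    [/\ c - p i - (k i)%:R - p J \isn't a Num.int,
        Num.floor (p J - p i) = Num.floor (p J - p1 i),
        Num.floor (p J - (c - p i - (k i)%:R)) = Num.floor (p J - (c - p1 i - (k i)%:R)) &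
        rev_bounds (k i) (k J) (p1 i) (c - p1 i - (k i)%:R) (p1 J)]) ->
  [/\ generic (rev_pos c B k p), mirror B k (disp p) (disp (rev_pos c B k p)) &
    forall i j, i \in B -> j \in B -> i != j ->
      disp (rev_pos c B k p) i j = (k i)%:Z - (k j)%:Z - 1 - disp p i j].
Proof.
move=> gp k0 out mix.
have inB i j : i \in B -> j \in B ->
    rev_pos c B k p j - rev_pos c B k p i = - (p j - p i) + ((k i)%:Z - (k j)%:Z)%:~R.
  by move=> iB jB; rewrite /rev_pos iB jB intrD intrN -!pmulrn; ring.
have gr : generic (rev_pos c B k p).
  move=> i j ij; have [iB|iB] := boolP (i \in B); have [jB|jB] := boolP (j \in B).
  - by rewrite inB // rpredDr ?intr_int // nonintN gp.
  - by rewrite /rev_pos iB (negPf jB) -nonintN opprB; have [] := mix i j iB jB.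
  - by rewrite /rev_pos jB (negPf iB); have [] := mix j i jB iB.
  by rewrite /rev_pos (negPf jB) (negPf iB) gp.
have dB i j : i \in B -> j \in B -> i != j ->
    disp (rev_pos c B k p) i j = (k i)%:Z - (k j)%:Z - 1 - disp p i j.
  move=> iB jB ij; rewrite /disp inB // floorDrz ?intr_int // intrKfloor floorN_nonint ?gp //.
  by lia.
split=> // i j ij.
have mixed a b : a \in B -> b \notin B ->
    same_pair false (k a) (k b) (disp p a b) (disp (rev_pos c B k p) a b).
  move=> aB bB; have [_ e1 e2 rb] := mix a b aB bB.
  have := rev_bounds_pair (k0 a aB) rb.
  by rewrite /disp /rev_pos aB (negPf bB) e1 e2 out.
have [iB|iB] := boolP (i \in B); have [jB|jB] := boolP (j \in B) => /=.
- rewrite dB // /same_pair wt_rev; split=> // ic.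
  by case: (wtP _ _ _) ic => //=; lia.
- exact: mixed.
- rewrite (alcoveN (alcove_disp gp) (i := j)) 1?eq_sym //.
  rewrite (alcoveN (alcove_disp gr) (i := j)) 1?eq_sym //.
  by apply: same_pair_flip; exact: mixed.
by rewrite /disp /rev_pos (negPf iB) (negPf jB); split.
Qed.

Lemma block_bounds B k d p : (forall i, i \in B -> (0 < k i)%N) -> block B k d ->
  (forall i J, i \in B -> J \notin B ->
     p J - p i \isn't a Num.int /\ Num.floor (p J - p i) = d i J) ->
  forall J, J \notin B -> [\/ k J = 0%N, forall i, i \in B -> p i + (k i)%:R < p J,
     forall i, i \in B -> p J + (k J)%:R < p i |
     forall i, i \in B -> (k i <= k J)%N /\
        (p J - 1 < p i /\ p i + (k i)%:R < p J + (k J)%:R + 1)].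
Proof.
move=> k0 bl pd J JB.
have E i : i \in B -> (d i J)%:~R < p J - p i < (d i J)%:~R + 1.
  move=> iB; have [ni <-] := pd i J iB JB.
  by rewrite floor_lt_nonint //=; have := floorD1_gt (p J - p i); rewrite intrD mulr1z.
have nE (n : nat) : n%:Z%:~R = n%:R :> R by rewrite -pmulrn.
have [->|h|h|h] := bl J JB; [exact: Or41|apply: Or42|apply: Or43|apply: Or44] => i iB.
- have := h i iB; rewrite -(ler_int R) nE; have := E i iB; lra.
- have := h i iB => h1; have : (d i J + 1 <= - (k J)%:Z) by lia.
  by rewrite -(ler_int R) intrD mulr1z intrN nE; have := E i iB; lra.
have [kk ni] := h i iB; split=> //.
have [h1 h2] : d i J <= 0 /\ (k i)%:Z - (k J)%:Z - 1 <= d i J.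
  by have := k0 i iB; case: (wtP (k i) (k J) (d i J)) ni => //; lia.
move: h1 h2; rewrite -!(ler_int R) mulr0z !intrD !intrN mulr1z !nE; have := E i iB; lra.
Qed.

Lemma exists_mirror B k p : generic p -> (forall i, i \in B -> (0 < k i)%N) ->
  block B k (disp p) ->
  exists2 r : I -> R, generic r & mirror B k (disp p) (disp r).
Proof.
move=> gp k0 bl.
have [|c cP] := @rev_center B k p.
  apply: block_bounds bl _ => // i J iB JB; split=> //; apply: gp.
  by apply: contraNneq JB => <-.
have [|gr mr _] := @rev_mirror c B k p p gp k0 (fun _ _ => erefl).
  by move=> i J iB JB; have [] := cP i J iB JB.
by exists (rev_pos c B k p).
Qed.

End Mirror.

Section MirrorInvariance.
Variables (I : finType) (R : archiRealFieldType) (K : idomainType).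
Variables (q : K) (x : nat -> K) (M L : nat).
Local Notation G := (gen q x M L).
Implicit Types (p r : I -> R) (k : I -> nat) (B : {set I}) (d : I -> I -> int).

Definition same_wt k d d' : Prop :=
  forall i j, i != j -> wt (k i) (k j) (d i j) = wt (k i) (k j) (d' i j).

Lemma mirror_same_wt B k d d' : mirror B k d d' -> same_wt k d d'.
Proof. by move=> mir i j /mir []. Qed.

Lemma block_same_wt k B d d1 : (forall i, i \in B -> (0 < k i)%N) -> block B k d ->
  (forall i J, i \in B -> J \notin B -> same_pair false (k i) (k J) (d i J) (d1 i J)) ->
  block B k d1.
Proof.
move=> k0 bl S J JB.
have SJ i : i \in B -> same_pair false (k i) (k J) (d i J) (d1 i J) by move=> iB; exact: S.
have [J0|J0] := posnP (k J); first exact: Or41.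
have [h|h|h|h] := bl J JB; [exact: Or41|apply: Or42|apply: Or43|apply: Or44] => i iB.
- have [] := SJ i iB; have := h i iB; have := k0 i iB.
  case: (wtP _ _ (d i J)); case: (wtP _ _ (d1 i J)) => //=; lia.
- have [] := SJ i iB; have := h i iB; have := k0 i iB.
  case: (wtP _ _ (d i J)); case: (wtP _ _ (d1 i J)) => //=; lia.
by have [kk ni] := h i iB; rewrite -(same_pair_inc (SJ i iB)).
Qed.

Hypothesis q0 : q != 0.
Variable k : I -> nat.
Hypothesis kL : (\sum_i k i <= L.+1)%N.
Hypothesis IHsq : forall k2 p r, (\sum_i k2 i = \sum_i k i)%N ->
  (\sum_i k i ^ 2 < \sum_i k2 i ^ 2)%N -> generic p -> generic r ->
  same_wt k2 (disp p) (disp r) -> G k2 (disp p) = G k2 (disp r).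

Lemma size_le i : (k i <= L.+1)%N.
Proof. by apply: leq_trans kL; rewrite (bigD1 i) //= leq_addr. Qed.

Lemma two_sizes_le (a b : I) : a != b -> (k a + k b <= L.+1)%N.
Proof.
by move=> ab; apply: leq_trans kL; rewrite (bigD1 a) //= (bigD1 b) 1?eq_sym //= addnA leq_addr.
Qed.

Definition join_sizes (a b : I) (u v : nat) (i : I) : nat :=
  if i == a then u else if i == b then v else k i.

Lemma join_sizes_sum (f : nat -> nat) a b u v : a != b ->
  (\sum_i f (join_sizes a b u v i) + (f (k a) + f (k b)) =
   \sum_i f (k i) + (f u + f v))%N.
Proof.
move=> ab; rewrite !(sumn_others ab) /join_sizes eqxx eq_sym (negPf ab) eqxx.
rewrite (eq_bigr (fun i => f (k i))); first by lia.
by move=> i /andP[/negPf -> /negPf ->].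
Qed.

Lemma pair_cases (P : I -> I -> Prop) a b : a != b ->
  (forall i j, i != j -> P i j -> P j i) -> P b a ->
  (forall c, other a b c -> P c a /\ P c b) ->
  (forall c c', other a b c -> other a b c' -> c != c' -> P c c') ->
  forall i j, i != j -> P i j.
Proof.
move=> ab sym Pba Pc Pcc i j ij.
have ca c : c != a -> P c a.
  by have [->//|cb ca] := eqVneq c b; have [] := Pc c; rewrite /other ?ca.
have cb c : c != b -> P c b.
  have [->|ca' cb] := eqVneq c a; first by move=> _; apply: sym => //; rewrite eq_sym.
  by have [] := Pc c; rewrite /other ?ca'.
have [ja|ja] := eqVneq j a; first by rewrite ja; apply: ca; rewrite -ja.
have [jb|jb] := eqVneq j b; first by rewrite jb; apply: cb; rewrite -jb.
have [ia|ia] := eqVneq i a; first by apply: sym; rewrite ia //; exact: ca.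
have [ib|ib] := eqVneq i b; first by apply: sym; rewrite ib //; exact: cb.
by apply: Pcc; rewrite ?/other ?ia ?ja.
Qed.

(* [gen_crossing] expands both sides; the two configurations with the rows [a], [b]
   replaced by their union and intersection have the same weights, by [wt_meet] and
   [wt_join], and are equal by the induction hypothesis. *)
Lemma join_step a b m m' p p1 r r1 :
  generic p -> generic p1 -> generic r -> generic r1 ->
  crossing (disp p) (disp p1) a b -> crossing (disp r1) (disp r) a b ->
  disp p b a = m%:Z -> disp r a b = m'%:Z -> (m' + k b = m + k a)%N ->
  (0 < m)%N -> (m <= k b)%N -> (k b < m + k a)%N ->
  same_wt k (disp p) (disp r) ->
  G k (disp p1) = G k (disp r1) -> G k (disp p) = G k (disp r).
Proof.
move=> gp gp1 gr gr1 crp crr dp dr mm m0 mb ba swt E.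
have [ab _ _] := crp; have abL := two_sizes_le ab.
have [Ap Ap1] := (alcove_disp gp, alcove_disp gp1).
have [Ar Ar1] := (alcove_disp gr, alcove_disp gr1).
have crp' := crossing_sym Ap Ap1 crp.
have Ep : G k (disp p1) = q * G k (disp p) +
    (1 - q) * G (join_sizes b a (m + k a) (k b - m)) (disp p).
  by apply: (gen_crossing q x M size_le Ap1 Ap crp' dp); lia.
have Er : G k (disp r1) = q * G k (disp r) +
    (1 - q) * G (join_sizes a b (m + k a) (k b - m)) (disp r).
  rewrite -mm (_ : (k b - m = k a - m')%N); last by lia.
  by apply: (gen_crossing q x M size_le Ar1 Ar crr dr); lia.
pose s := tperm a b; pose rs i := r (s i).
have sE i : join_sizes a b (m + k a) (k b - m) (s i) = join_sizes b a (m + k a) (k b - m) i.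
  rewrite /join_sizes; have [->|ib] := eqVneq i b; first by rewrite tpermR eqxx.
  have [->|ia] := eqVneq i a; first by rewrite tpermL eq_sym (negPf ab) eqxx.
  by rewrite tpermD; [rewrite (negPf ia) (negPf ib)|rewrite eq_sym|rewrite eq_sym].
have dab : disp p a b = -1 - m%:Z by rewrite (alcoveN Ap) 1?eq_sym // dp.
have dba : disp r b a = -1 - m'%:Z by rewrite (alcoveN Ar ab) dr.
have EU : G (join_sizes b a (m + k a) (k b - m)) (disp p) =
          G (join_sizes a b (m + k a) (k b - m)) (disp r).
  transitivity (G (join_sizes b a (m + k a) (k b - m)) (disp rs)); last first.
    rewrite -(gen_relabel _ _ _ _ s _ (disp r)).
    by apply: eq_gen => // i; rewrite sE.
  have sum_join f : (\sum_i f (join_sizes b a (m + k a) (k b - m) i) + (f (k b) + f (k a)) =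
    \sum_i f (k i) + (f (m + k a) + f (k b - m)))%N by apply: join_sizes_sum; rewrite eq_sym.
  have grs : generic rs by move=> i j ij; apply: gr; rewrite (inj_eq perm_inj).
  apply: IHsq => //.
  - by have := sum_join id; rewrite /=; lia.
  - by have := sum_join (fun n => n ^ 2)%N; rewrite /=; clear -m0 ba mb; nia.
  have ba_wt : wt (m + k a) (k b - m) (disp p b a) = wt (m + k a) (k b - m) (disp rs b a).
    by rewrite /disp /rs tpermL tpermR -!/(disp _ _ _) dp dr /wt; lia.
  have other_wt c : other a b c ->
    wt (k c) (m + k a) (disp p c b) = wt (k c) (m + k a) (disp rs c b) /\
    wt (k c) (k b - m) (disp p c a) = wt (k c) (k b - m) (disp rs c a).
    move=> oc; have [ca cb] := andP oc.
    have sc : s c = c by rewrite tpermD // eq_sym.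
    have drb : disp rs c b = disp r c a by rewrite /disp /rs tpermR sc.
    have dra : disp rs c a = disp r c b by rewrite /disp /rs tpermL sc.
    have oc' : other b a c by rewrite /other andbC.
    have [_ pE] := crossing_cols Ap1 Ap crp' oc'; rewrite dp in pE.
    have [_ rE] := crossing_cols Ar1 Ar crr oc; rewrite dr in rE.
    have [_ _ Er1] := crr; have [_ _ Ep1] := crp'.
    have p1E : disp p c b = disp p1 c b.
      by rewrite Ep1 // xpair_eqE ?(negPf ca) ?(negPf cb).
    have p1E' : disp p c a = disp p1 c a.
      by rewrite Ep1 // xpair_eqE ?(negPf ca) ?(negPf cb).
    have r1E : disp r c b = disp r1 c b.
      by rewrite Er1 // xpair_eqE ?(negPf ca) ?(negPf cb).
    have r1E' : disp r c a = disp r1 c a.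
      by rewrite Er1 // xpair_eqE ?(negPf ca) ?(negPf cb).
    rewrite -p1E -p1E' in pE; rewrite -r1E -r1E' in rE.
    have kE : (k b - m = k a - m')%N by lia.
    have meetE : wt (k c) (k b - m) (disp p c a) = wt (k c) (k b - m) (disp r c b).
      have := wt_meet (k c) (disp p c b) mb ba; rewrite -pE => ->.
      have -> : wt (k c) (k b - m) (disp r c b) = wt (k c) (k a - m') (disp r c b).
        by rewrite kE.
      rewrite rE (@wt_meet _ _ (k b)); [|lia|lia]; rewrite -rE -kE !swt //.
      by rewrite [X in _ = Num.min _ X]minC.
    rewrite drb dra; split=> //.
    have := wt_join (k c) (disp p c b) mb ba; rewrite -pE => ->.
    have := @wt_join (k c) (k a) (k b) m' (disp r c a).
    rewrite -rE -kE mm meetE => ->; [|lia|lia].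
    by rewrite !swt // (addrC (wt (k c) (k b) _)).
  apply: (pair_cases ab) => [i j||c|c c' oc oc'].
  - move=> ij; rewrite (alcoveN Ap ij) (alcoveN (alcove_disp grs) ij) !wt_sym.
    by move=> ->.
  - by rewrite /join_sizes !eqxx (negPf ab).
  - move=> oc; have [h1 h2] := other_wt c oc; case/andP: (oc) => ca cb.
    by rewrite /join_sizes !eqxx (negPf ab) (negPf ca) (negPf cb).
  case/andP: (oc) => ca cb; case/andP: (oc') => ca' cb'.
  rewrite /join_sizes (negPf ca) (negPf cb) (negPf ca') (negPf cb') => cc'.
  by rewrite swt // /disp /rs !tpermD // eq_sym.
have : q * G k (disp p) = q * G k (disp r).
  by move: Ep Er; rewrite E EU => -> /addIr.
by move/(mulfI q0).
Qed.

Lemma crossing_deficit d d1 a b : alcove d -> alcove d1 -> crossing d d1 a b ->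
  inc (k a) (k b) (d a b) -> wt (k a) (k b) (d1 a b) = wt (k a) (k b) (d a b) + 1 ->
  (deficit k d1 < deficit k d)%N.
Proof.
move=> Ad Ad1 cr ic E; have wle n n' e : wt n n' e <= Num.min n%:Z n'%:Z by rewrite /wt; lia.
have wlt : wt (k a) (k b) (d a b) < Num.min (k a)%:Z (k b)%:Z.
  by rewrite lt_neqAle wle andbT.
apply: (sum2_lt (a := a) (b := b)); last by rewrite E; move: wlt; clear; lia.
move=> i j; have [->|ij] := eqVneq i j; first by rewrite (alcove0 Ad) (alcove0 Ad1).
apply: (crossing_pairs (P := fun i j e =>
  `|Num.min (k i)%:Z (k j)%:Z - wt (k i) (k j) e| <=
  `|Num.min (k i)%:Z (k j)%:Z - wt (k i) (k j) (d i j)|)%N Ad Ad1 cr) ij => //.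
  by move=> {}i {}j e ij; rewrite (alcoveN Ad ij) !wt_sym minC.
by rewrite E; move: wlt; clear; lia.
Qed.

Lemma crossing_mirrored B p a b : generic p -> wall p a b ->
  (forall i, i \in B -> (0 < k i)%N) -> block B k (disp p) -> a \in B -> b \in B ->
  exists p1 r r1 : I -> R,
    [/\ [/\ generic p1, generic r & generic r1],
        crossing (disp p) (disp p1) a b, crossing (disp r1) (disp r) a b,
        mirror B k (disp p) (disp r) & mirror B k (disp p1) (disp r1)] /\
    disp r a b = (k a)%:Z - (k b)%:Z - 1 - disp p a b.
Proof.
move=> gp W k0 bl aB bB; have [ab Wc] := W.
set y := p a + (disp p a b + 1)%:~R.
have yni c : c != b -> c != a -> y - p c \isn't a Num.int.
  by move=> cb ca; rewrite /y addrAC rpredDr ?intr_int // gp // eq_sym.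
have phat i J : i \in B -> J \notin B -> upd p b y J - upd p b y i \isn't a Num.int /\
    Num.floor (upd p b y J - upd p b y i) = disp p i J.
  move=> iB JB.
  have Jb : J != b by apply: contraNneq JB => ->.
  have Ja : J != a by apply: contraNneq JB => ->.
  have iJ : i != J by apply: contraNneq JB => <-.
  rewrite (upd_other _ _ Jb); have [->|ib] := eqVneq i b; last by rewrite upd_other // gp.
  have ni := yni J Jb Ja; rewrite upd_same -opprB nonintN floorN_nonint //; split=> //.
  by rewrite Wc /other ?Ja // (alcoveN (alcove_disp gp) Jb).
have [c cP] := rev_center (block_bounds k0 bl phat).
pose cs := [seq c - (k b)%:R - p J | J <- enum I & J \notin B].
have in_cs J : J \notin B -> c - (k b)%:R - p J \in cs.
  by move=> JB; rewrite (map_f (fun J => c - (k b)%:R - p J)) // mem_filter JB mem_enum.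
have ycs e : e \in cs -> y - e \isn't a Num.int.
  move=> /mapP[J]; rewrite mem_filter => /andP[JB _] ->.
  have Jb : J != b by apply: contraNneq JB => ->.
  have [] := cP b J bB JB; rewrite upd_same upd_other // => ni _.
  by rewrite -nonintN (_ : - _ = c - y - (k b)%:R - p J) //; ring.
have [z0 [z1 [g0 g1 D0 cr zP]]] := cross_wall gp W ycs.
have mirr z : generic (upd p b z) ->
    (forall e, e \in cs -> Num.floor (z - e) = Num.floor (y - e) /\ z - e \isn't a Num.int) ->
    (forall J, J \notin B -> disp (upd p b z) b J = disp p b J) ->
    [/\ generic (rev_pos c B k (upd p b z)),
      mirror B k (disp (upd p b z)) (disp (rev_pos c B k (upd p b z))) &
      forall i j, i \in B -> j \in B -> i != j -> disp (rev_pos c B k (upd p b z)) i j =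
        (k i)%:Z - (k j)%:Z - 1 - disp (upd p b z) i j].
  move=> gz zcs zb; apply: (rev_mirror (p1 := upd p b y)) => //.
    by move=> J JB; rewrite !upd_other //; apply: contraNneq JB => ->.
  move=> i J iB JB; have Jb : J != b by apply: contraNneq JB => ->.
  have [ni rb] := cP i J iB JB; have [_ fh] := phat i J iB JB.
  rewrite !(upd_other _ _ Jb) in ni rb fh *.
  have [ib|ib] := eqVneq i b; last by move: ni rb fh; rewrite !(upd_other _ _ ib); split.
  move: ni rb fh; rewrite ib !upd_same => ni rb fh.
  have [zf zn] := zcs _ (in_cs J JB); have yn := ycs _ (in_cs J JB).
  have e0 t : c - t - (k b)%:R - p J = - (t - (c - (k b)%:R - p J)) by ring.
  have e1 t : p J - (c - t - (k b)%:R) = t - (c - (k b)%:R - p J) by ring.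
  split=> //; first by rewrite e0 nonintN.
    by have := zb J JB; rewrite /disp upd_same upd_other // fh.
  by rewrite !e1.
have [_ _ Ecr] := cr.
have dbJ J : J \notin B -> disp (upd p b z1) b J = disp p b J.
  move=> JB; have Jb : J != b by apply: contraNneq JB => ->.
  have Ja : J != a by apply: contraNneq JB => ->.
  by apply: Ecr; rewrite xpair_eqE ?(negPf Ja) ?(negPf Jb) ?andbF.
have [||gr0 mr0 dr0] := mirr z0 g0; [by move=> e /zP[]|by move=> J _; rewrite D0|].
have [||gr1 mr1 dr1] := mirr z1 g1; [by move=> e /zP[]|exact: dbJ|].
exists (upd p b z1), (rev_pos c B k (upd p b z0)), (rev_pos c B k (upd p b z1)).
split; last by rewrite dr0 // D0.
split=> //; last by move=> i j ij; rewrite -D0; exact: mr0.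
split=> //; first by rewrite dr0 // dr1 // D0; have [_ -> _] := cr; lia.
move=> i j n1 n2.
have [->|ij] := eqVneq i j.
  by rewrite (alcove0 (alcove_disp gr0)) (alcove0 (alcove_disp gr1)).
have mix e J : e \in B -> J \notin B ->
    disp (rev_pos c B k (upd p b z0)) e J = disp (rev_pos c B k (upd p b z1)) e J.
  move=> eB JB; have Jb : J != b by apply: contraNneq JB => ->.
  rewrite /disp /rev_pos eB (negPf JB) !(upd_other _ _ Jb).
  have [->|eb] := eqVneq e b; last by rewrite !(upd_other _ _ eb).
  rewrite !upd_same; have [f0 f1 _ _] := zP _ (in_cs J JB).
  have e1 t : p J - (c - t - (k b)%:R) = t - (c - (k b)%:R - p J) by ring.
  by rewrite !e1 f0 f1.
have [iB|iB] := boolP (i \in B); have [jB|jB] := boolP (j \in B).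
- by rewrite dr0 // dr1 // D0 Ecr.
- exact: mix.
- by rewrite (alcoveN (alcove_disp gr0) (i := j)) 1?eq_sym // mix //
    (alcoveN (alcove_disp gr1) (i := i)) // opprB addrC subrK.
have ib : i != b by apply: contraNneq iB => ->.
have jb : j != b by apply: contraNneq jB => ->.
by rewrite /disp /rev_pos (negPf iB) (negPf jB) !upd_other.
Qed.

Lemma gen_mirror B p p' : (forall i, i \in B -> (0 < k i)%N) ->
  generic p -> generic p' -> block B k (disp p) -> mirror B k (disp p) (disp p') ->
  G k (disp p) = G k (disp p').
Proof.
move=> k0; have [n] := ubnP (deficit k (disp p)).
elim: n p p' => // n IHn p p'; rewrite ltnS => defn.
have [s] := ubnP (sep (disp p) (disp p')).
elim: s p defn => // s IHs p defn; rewrite ltnS => seps gp gp' bl mir.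
have [/existsP[i /existsP[j ne]]|none] :=
  boolP [exists i, exists j, disp p i j != disp p' i j]; last first.
  apply: eq_gen => // i j; apply/eqP; apply: contraNT none => ne.
  by apply/existsP; exists i; apply/existsP; exists j.
have [Ap Ap'] := (alcove_disp gp, alcove_disp gp').
have [|a [b [lab W]]] := exists_wall gp Ap'; first by exists i, j.
have [ab _] := W.
have [[S E]|[/andP[aB bB] ic E]] := same_pair_step (mir a b ab) lab.
  have [//|z0 [z1 [_ g1 _ cr _]]] := cross_wall (cs := [::]) gp W.
  have Ap1 := alcove_disp g1; have [_ dab _] := cr.
  have mir1 : mirror B k (disp (upd p b z1)) (disp p').
    by apply: crossing_mirror Ap Ap1 Ap' cr mir _; rewrite dab.
  have swt i' j' : i' != j' ->
    wt (k i') (k j') (disp p i' j') = wt (k i') (k j') (disp (upd p b z1) i' j').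
    by move=> ij; have [-> _] := mir i' j' ij; have [-> _] := mir1 i' j' ij.
  rewrite (gen_commute q x M size_le Ap Ap1 cr) ?dab ?E //.
  apply: IHs => //.
  - rewrite (_ : deficit k _ = deficit k (disp p)) //.
    apply: eq_bigr => i' _; apply: eq_bigr => j' _.
    have [->|ij] := eqVneq i' j'; first by rewrite (alcove0 Ap) (alcove0 Ap1).
    by rewrite swt.
  - exact: leq_trans (crossing_sep Ap Ap1 Ap' cr lab) seps.
  apply: block_same_wt k0 bl _ => i' J iB JB.
  have iJ : i' != J by apply: contraNneq JB => <-.
  apply: (@same_pair_comp false _ _ (disp p' i' J)); apply: same_pair_sym.
    by have := mir i' J iJ; rewrite (negPf JB) andbF.
  by have := mir1 i' J iJ; rewrite (negPf JB) andbF.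
have [d1 [d2 d3]] := inc_up ic E.
have [p1 [r [r1 [[[g1 gr gr1] crp crr mr mr1] dr]]]] := crossing_mirrored gp W k0 bl aB bB.
have Ap1 := alcove_disp g1; have [_ dab Ecr] := crp; rewrite -dab in E.
have -> : G k (disp p') = G k (disp r).
  apply: (gen_same_sign q x M size_le gp' gr) => i' j' ij; rewrite inE /=.
  exact: same_pair_comp (mir i' j' ij) (mr i' j' ij).
have dba := alcoveN Ap ab.
apply: (@join_step a b `|disp p b a| `|disp r a b| p p1 r r1) => //.
- by move: d1 dba; clear; lia.
- by move: d1 d2 d3 dr dba; clear; lia.
- by move: d1 d2 d3 dr dba; clear; lia.
- by move: d1 dba; clear; lia.
- by move: d1 d2 dba; clear; lia.
- by move: d1 d3 dba; clear; lia.
- exact: mirror_same_wt mr.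
apply: IHn => //; first exact: leq_trans (crossing_deficit Ap Ap1 crp ic E) defn.
apply: block_same_wt k0 bl _ => i' J iB JB.
by split; rewrite Ecr // xpair_eqE; apply: contraNN JB => /andP[_ /eqP ->].
Qed.

End MirrorInvariance.

(** * Gallai's theorem *)

Local Open Scope nat_scope.

Section Gallai.
Variable I : finType.
Implicit Types (r X Y Z : rel I) (V A : {set I}).

Definition cut_connected r V : Prop :=
  forall A, A \subset V -> A != set0 -> A != V ->
  exists x y, [/\ x \in A, y \in V, y \notin A & r x y].

Definition within r V : rel I := fun x y => [&& x \in V, y \in V & r x y].

Definition component r V x : {set I} := [set y | connect (within r V) x y].

Lemma component_refl r V x : x \in component r V x.
Proof. by rewrite inE connect0. Qed.

Lemma connect_ind (e : rel I) (Q : I -> Prop) x y : connect e x y ->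
  (forall u v, Q u -> e u v -> Q v) -> Q x -> Q y.
Proof.
case/connectP=> s; elim: s x => [|z s IH] x /= => [_ ->//|/andP[xz zs] yE QQ Qx].
by apply: (IH z) => //; exact: QQ xz.
Qed.

Lemma component_sub r V x : x \in V -> component r V x \subset V.
Proof.
move=> xV; apply/subsetP => y; rewrite inE => xy.
by apply: (connect_ind (Q := fun t => t \in V) xy) => // u v _ /and3P[].
Qed.

Lemma component_closed r V x y z : y \in component r V x -> y \in V -> z \in V ->
  r y z -> z \in component r V x.
Proof.
rewrite !inE => xy yV zV yz; apply: connect_trans xy _; apply: connect1.
by rewrite /within yV zV.
Qed.

Lemma component_sym r V x y : symmetric r -> y \in component r V x -> x \in component r V y.
Proof.
move=> rs; rewrite !inE sym_connect_sym // => u v.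
by rewrite /within rs andbCA.
Qed.

Lemma eq_component r r' V x : {in V &, r =2 r'} -> component r V x = component r' V x.
Proof.
move=> rr; apply/setP => y; rewrite !inE; apply: eq_connect => u v.
rewrite /within; have [uV|//] := boolP (u \in V); have [vV|//] := boolP (v \in V).
by rewrite rr.
Qed.

Lemma component_connected r V x : symmetric r -> x \in V ->
  cut_connected r (component r V x).
Proof.
move=> rs xV A AC A0 AV; have CV := subsetP (component_sub r xV).
have [y yA] := set0Pn _ A0.
have [/existsP[u /existsP[v /and4P[uA vC vA uv]]]|H] :=
    boolP [exists u, exists v, [&& u \in A, v \in component r V x, v \notin A & r u v]].
  by exists u, v.
case/negP: AV; rewrite eqEsubset AC; apply/subsetP => z.
have yC := subsetP AC _ yA.
have := component_sym rs yC; rewrite !inE => yx xz.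
have yz : connect (within r V) y z by apply: connect_trans yx xz.
apply: (connect_ind (Q := fun t => t \in A) yz) => // u v uA /and3P[uV vV uv].
apply: contraNT H => vA; apply/existsP; exists u; apply/existsP; exists v.
by rewrite uA vA uv (component_closed (y := u)) // (subsetP AC).
Qed.

Definition rainbow_free X Y Z V : Prop := forall x y z, x \in V -> y \in V -> z \in V ->
  x != y -> x != z -> y != z -> X x y -> Y x z -> Z y z -> False.

Lemma gallai_step X Y Z V v : symmetric X -> symmetric Y -> symmetric Z ->
  (forall x y, x \in V -> y \in V -> x != y -> [|| X x y, Y x y | Z x y]) ->
  rainbow_free X Y Z V -> v \in V ->
  cut_connected X V -> cut_connected Y V -> cut_connected Z V ->
  (exists w, w \in V :\ v) -> cut_connected X (V :\ v).
Proof.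
move=> Xs Ys Zs cov rf vV cX cY cZ [w0 w0V'] A AV' A0 AV.
have [/existsP[u /existsP[w /and4P[uA wV wA uw]]]|H] :=
    boolP [exists u, exists w, [&& u \in A, w \in V :\ v, w \notin A & X u w]].
  by exists u, w.
set V' := V :\ v in AV' AV H w0V'; exfalso.
have V'V x : x \in V' -> x \in V by rewrite !inE => /andP[].
have V'v x : x \in V' -> x != v by rewrite !inE => /andP[].
pose C z := component X V' z.
have CV z y : z \in V' -> y \in C z -> y \in V' by move=> zV; exact/subsetP/component_sub.
have vC z : z \in V' -> exists2 y, y \in C z & X v y.
  move=> zV; have [|||x [y [xC yV yC xy]]] := cX (C z).
  - by apply/subsetP => t /(CV _ _ zV); exact: V'V.
  - by apply/set0Pn; exists z; exact: component_refl.
  - apply: contraTneq vV => <-; apply/negP => /(CV _ _ zV).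
    by rewrite !inE eqxx.
  exists x => //; have [<-|yv] := eqVneq y v; first by rewrite Xs.
  case/negP: yC; apply: (component_closed xC (CV _ _ zV xC)) => //.
  by rewrite !inE yv.
have noX u w : u \in A -> w \in V' -> w \notin A -> X u w = false.
  move=> uA wV wA; apply: contraNF H => uw.
  by apply/existsP; exists u; apply/existsP; exists w; rewrite uA wV wA.
have CA z : z \in A -> C z \subset A.
  move=> zA; apply/subsetP => y; rewrite inE => zy.
  apply: (connect_ind (Q := fun t => t \in A) zy) => // s t sA /and3P[_ tV st].
  by apply: contraTT st => tA; rewrite noX.
have CA' z : z \in V' -> z \notin A -> forall y, y \in C z -> y \notin A.
  move=> zV zA y; rewrite inE => zy.
  apply: (connect_ind (Q := fun t => t \notin A) zy) => // s t sA /and3P[sV tV st].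
  by apply: contraTN st => tA; rewrite Xs noX.
have [a aA] := set0Pn _ A0; have aV := subsetP AV' _ aA.
have [b bV bA] : exists2 b, b \in V' & b \notin A.
  by apply/subsetPn; apply: contra AV => VA; rewrite eqEsubset AV'.
have otherC z : z \in V' -> exists2 w, w \in V' & w \notin C z.
  move=> zV; have [zA|zA] := boolP (z \in A).
    by exists b => //; apply: contra bA => /(subsetP (CA z zA)).
  by exists a => //; apply: contraL aA; exact: CA'.
have sameC z y : z \in V' -> y \in C z -> C y = C z.
  move=> zV yC; apply/setP => t.
  have zy := component_sym Xs yC; rewrite !inE in yC zy *.
  by apply/idP/idP; apply: connect_trans.
have noXC z y : z \in V' -> y \in V' -> y \notin C z -> X z y = false.
  move=> zV yV; apply: contraNF; exact: component_closed (component_refl _ _ _) zV yV.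
have spread (P Q : rel I) z y y' : symmetric P -> symmetric Q ->
    (forall x y, x \in V -> y \in V -> x != y -> [|| X x y, P x y | Q x y]) ->
    rainbow_free X P Q V -> z \in V' -> y \in V' -> z \notin C y ->
    ~~ Q z y -> y' \in C y -> ~~ Q z y'.
  move=> Ps Qs covP rfP zV yV zC nQ; rewrite inE => yy'.
  suff [] : y' \in C y /\ ~~ Q z y' by [].
  apply: (connect_ind (Q := fun t => t \in C y /\ ~~ Q z t) yy'); last first.
    by split=> //; exact: component_refl.
  move=> s t [sC ns] /and3P[sV tV st].
  have tC : t \in C y by apply: component_closed sC sV tV st.
  split=> //; apply/negP => Qzt.
  have zs : z != s by apply: contraNneq zC => ->.
  have zt : z != t by apply: contraNneq zC => ->.
  have [st_eq|sNt] := eqVneq s t; first by move: ns; rewrite st_eq Qzt.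
  have Xzs : X z s = false.
    apply: noXC => //; apply: contra zC => sz.
    by rewrite -(sameC _ _ yV sC) (sameC _ _ zV sz) component_refl.
  have := covP _ _ (V'V _ zV) (V'V _ sV) zs; rewrite Xzs (negPf ns) orbF /= => Pzs.
  apply: (rfP s t z); rewrite ?V'V // 1?eq_sym //.
    by rewrite Ps.
  by rewrite Qs.
have rf' : rainbow_free X Z Y V.
  move=> x y z xV yV zV xy xz yz Xxy Zxz Yyz.
  by apply: (rf y x z); rewrite // 1?eq_sym // Xs.
have cov' x y : x \in V -> y \in V -> x != y -> [|| X x y, Z x y | Y x y].
  by move=> xV yV xy; have /or3P[->|->|->] := cov x y xV yV xy; rewrite ?orbT.
have leaf (r : rel I) : cut_connected r V -> exists2 z, z \in V' & r v z.
  move=> cr; have [|||x [y [+ yV + xy]]] := cr [set v].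
  - by rewrite sub1set.
  - by apply/set0Pn; exists v; rewrite inE.
  - apply: contraTneq w0V' => vE; rewrite /V' -vE setDv inE; done.
  rewrite !inE => /eqP xE yv; exists y; first by rewrite !inE yv.
  by rewrite -xE.
have neC s t : s \in V' -> t \notin C s -> s \notin C t.
  by move=> sV; apply: contra => /component_sym; apply.
have [z zV Yz] := leaf Y cY; have [z' zV' Zz'] := leaf Z cZ.
have nZ w y : w \in V' -> w \notin C z -> y \in C w -> X v y -> ~~ Z z y.
  move=> wV wC yC Xy; apply/negP => Zzy; have yV := CV _ _ wV yC.
  have yz : y != z by apply: contraNneq (neC _ _ zV wC) => <-.
  have [vy vz] : v != y /\ v != z by rewrite !(eq_sym v) !V'v.
  by apply: (rf v y z vV (V'V _ yV) (V'V _ zV) vy vz yz Xy Yz); rewrite Zs.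
have nY w y : w \in V' -> w \notin C z' -> y \in C w -> X v y -> ~~ Y z' y.
  move=> wV wC yC Xy; apply/negP => Yzy; have yV := CV _ _ wV yC.
  have yz : y != z' by apply: contraNneq (neC _ _ zV' wC) => <-.
  have [vy vz] : v != y /\ v != z' by rewrite !(eq_sym v) !V'v.
  by apply: (rf' v y z' vV (V'V _ yV) (V'V _ zV') vy vz yz Xy Zz'); rewrite Ys.
have [z'C|z'C] := boolP (z' \in C z).
  have [w wV wC] := otherC z zV; have wC' : w \notin C z' by rewrite (sameC _ _ zV z'C).
  have [y yC Xy] := vC w wV; have yV := CV _ _ wV yC.
  have yz : y \notin C z by apply: contra wC => yz;
    rewrite -(sameC _ _ zV yz) (sameC _ _ wV yC) component_refl.
  have h1 : ~~ Z y z' by apply: (spread Y Z y z z') => //; rewrite Zs (nZ w).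
  have h2 : ~~ Y y z' by rewrite Ys (nY w).
  have yz' : y != z' by apply: contraNneq yz => ->.
  have := cov _ _ (V'V _ yV) (V'V _ zV') yz'.
  rewrite (negPf h1) (negPf h2) !orbF noXC //.
  by apply: contra yz => h; rewrite -(sameC _ _ zV z'C) (sameC _ _ yV h) component_refl.
have zC := neC _ _ zV z'C.
have [y yC Xy] := vC z' zV'; have [y2 y2C Xy2] := vC z zV.
have h1 : ~~ Z z z'.
  apply: (spread Y Z z y z') => //; first exact: CV yC.
  - by rewrite (sameC _ _ zV' yC).
  - exact: nZ yC Xy.
  by rewrite (sameC _ _ zV' yC) component_refl.
have h2 : ~~ Y z' z.
  apply: (spread Z Y z' y2 z) => //; first exact: CV y2C.
  - by rewrite (sameC _ _ zV y2C).
  - exact: nY y2C Xy2.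
  by rewrite (sameC _ _ zV y2C) component_refl.
have zz' : z != z' by apply: contraNneq zC => ->; exact: component_refl.
have := cov _ _ (V'V _ zV) (V'V _ zV') zz'.
by rewrite (negPf h1) Ys (negPf h2) !orbF noXC.
Qed.

Theorem gallai X Y Z V : symmetric X -> symmetric Y -> symmetric Z ->
  (forall x y, x \in V -> y \in V -> x != y -> [|| X x y, Y x y | Z x y]) ->
  (forall x y, x \in V -> y \in V -> ~~ [&& X x y, Y x y & Z x y]) ->
  rainbow_free X Y Z V -> 1 < #|V| ->
  cut_connected X V -> cut_connected Y V -> cut_connected Z V -> False.
Proof.
move=> Xs Ys Zs; have [n] := ubnP #|V|.
elim: n V => // n IH V; rewrite ltnS => Vn cov disj rf V1 cX cY cZ.
have [v vV] : exists v, v \in V by apply/set0Pn; rewrite -card_gt0 ltnW.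
have V'E : #|V| = (#|V :\ v|).+1 by rewrite (cardsD1 v) vV.
have w0 : exists w, w \in V :\ v by apply/set0Pn; rewrite -card_gt0 -ltnS -V'E.
have sub x : x \in V :\ v -> x \in V by rewrite inE => /andP[].
have perm3 (b1 b2 b3 : bool) : [|| b1, b2 | b3] ->
    [|| b2, b1 | b3] /\ [|| b3, b2 | b1].
  by case: b1; case: b2; case: b3.
have cX' : cut_connected X (V :\ v) by exact: (gallai_step (Y := Y) (Z := Z)).
have cY' : cut_connected Y (V :\ v).
  apply: (gallai_step (Y := X) (Z := Z)) => //.
    by move=> x y xV yV xy; have [] := perm3 _ _ _ (cov x y xV yV xy).
  move=> x y z xV yV zV xy xz yz Yxy Xxz Zyz.
  by apply: (rf x z y); rewrite // 1?eq_sym // Zs.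
have cZ' : cut_connected Z (V :\ v).
  apply: (gallai_step (Y := Y) (Z := X)) => //.
    by move=> x y xV yV xy; have [] := perm3 _ _ _ (cov x y xV yV xy).
  move=> x y z xV yV zV xy xz yz Zxy Yxz Xyz.
  by apply: (rf z y x); rewrite // 1?eq_sym // ?(Xs z) ?(Ys z) ?(Zs y).
have [V'1|V'1] := ltnP 1 #|V :\ v|.
  apply: (IH (V :\ v)) => //.
  - by rewrite -V'E.
  - by move=> x y /sub xV /sub yV; exact: cov.
  - by move=> x y /sub xV /sub yV; exact: disj.
  by move=> x y z /sub xV /sub yV /sub zV; exact: rf.
have V2 : #|V :\ v| = 1 by apply/eqP; rewrite eqn_leq V'1 -ltnS -V'E.
have [w Vw] := cards1P (introT eqP V2).
have edge (r : rel I) : cut_connected r V -> r v w.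
  move=> cr; have [|||x [y [+ yV + xy]]] := cr [set v].
  - by rewrite sub1set.
  - by apply/set0Pn; exists v; rewrite inE.
  - by apply: contraTneq V1 => <-; rewrite cards1.
  rewrite !inE => /eqP xE yv; have : y \in V :\ v by rewrite !inE yv.
  by rewrite Vw inE => /eqP <-; rewrite -xE.
have wV : w \in V by apply: sub; rewrite Vw inE.
by have := disj v w vV wV; rewrite !edge.
Qed.

End Gallai.

(** * Three and four rows *)

Local Open Scope ring_scope.

Lemma far_inc (k k' : nat) (d : int) : (0 < k)%N -> (0 < k')%N -> wt k k' d = 0 -> inc k k' d.
Proof. by rewrite /inc => k0 k0' ->; lia. Qed.

Lemma far_spec (k k' : nat) (d : int) : (0 < k)%N -> (0 < k')%N -> wt k k' d = 0 ->
  (k%:Z <= d) \/ (d <= - k'%:Z - 1).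
Proof. by case: (wtP k k' d); lia. Qed.

Lemma cmp_spec (k k' : nat) (d : int) : (0 < k)%N -> (0 < k')%N -> ~~ inc k k' d ->
  ((k <= k')%N /\ d <= 0 /\ k%:Z - k'%:Z - 1 <= d) \/
  ((k' < k)%N /\ d <= k%:Z - k'%:Z /\ -1 <= d).
Proof. by case: (wtP k k' d) => //; lia. Qed.

Lemma inc_spec (k k' : nat) (d : int) : inc k k' d ->
  (0 < d /\ k%:Z - k'%:Z < d) \/ (d < -1 /\ d < k%:Z - k'%:Z - 1).
Proof. by case: (wtP k k' d) => //; lia. Qed.

Lemma near_spec (k k' : nat) (d : int) : wt k k' d != 0 -> d < k%:Z /\ - k'%:Z - 1 < d.
Proof. by case: (wtP k k' d) => //; lia. Qed.

Lemma far_side_near (ky kt kt' : nat) (t_y t'_y t_t' : int) :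
  (0 < ky)%N -> (0 < kt)%N -> (0 < kt')%N ->
  t_t' + t'_y <= t_y <= t_t' + t'_y + 1 ->
  wt kt ky t_y = 0 -> wt kt' ky t'_y = 0 -> wt kt kt' t_t' != 0 ->
  (0 <= t_y) = (0 <= t'_y).
Proof.
move=> y0 t0 t0' D /(far_spec t0 y0) f1 /(far_spec t0' y0) f2 /near_spec n; lia.
Qed.

Lemma far_side_opp (ky kt kt' : nat) (ty t'y tt' ty' t'y' tt'' : int) :
  (0 < ky)%N -> (0 < kt)%N -> (0 < kt')%N ->
  tt' + t'y <= ty <= tt' + t'y + 1 -> tt'' + t'y' <= ty' <= tt'' + t'y' + 1 ->
  wt kt kt' tt' = wt kt kt' tt'' -> inc kt kt' tt' -> (0 <= tt') = ~~ (0 <= tt'') ->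
  wt kt ky ty = 0 -> wt kt' ky t'y = 0 -> wt kt ky ty' = 0 -> wt kt' ky t'y' = 0 ->
  (0 <= ty) = (0 <= ty') -> (0 <= t'y) = (0 <= t'y') ->
  (0 <= ty) = (0 <= t'y).
Proof.
move=> y0 t0 t0' D D' w i s /(far_spec t0 y0) f1 /(far_spec t0' y0) f2.
move=> /(far_spec t0 y0) f3 /(far_spec t0' y0) f4; move: (opp_spec w i s); lia.
Qed.

Lemma hull (ks ku kz : nat) (us zs uz : int) :
  (0 < ks)%N -> (0 < ku)%N -> (0 < kz)%N ->
  uz + zs <= us <= uz + zs + 1 ->
  ~~ inc ku ks us -> ~~ inc kz ks zs -> inc ku kz uz -> (ks < ku)%N ->
  (us + ks%:Z - ku%:Z < 0 \/ zs + ks%:Z - kz%:Z < 0) /\ (0 <= us \/ 0 <= zs).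
Proof.
move=> s0 u0 z0 D /(cmp_spec u0 s0) c1 /(cmp_spec z0 s0) c2 /inc_spec i; lia.
Qed.

Lemma two_far (kJ ku k1 k2 : nat) (uJ u1 u2 J1 J2 d12 : int) :
  (0 < kJ)%N -> (0 < ku)%N -> (0 < k1)%N -> (0 < k2)%N -> (kJ < ku)%N ->
  uJ + J1 <= u1 <= uJ + J1 + 1 -> uJ + J2 <= u2 <= uJ + J2 + 1 ->
  u1 + d12 <= u2 <= u1 + d12 + 1 -> J1 + d12 <= J2 <= J1 + d12 + 1 ->
  ~~ inc ku kJ uJ -> ~~ inc kJ k1 J1 -> ~~ inc kJ k2 J2 ->
  wt ku k1 u1 = 0 -> wt ku k2 u2 = 0 -> wt k1 k2 d12 != 0.
Proof.
move=> J0 u0 p1 p2 JU D1 D2 D3 D4 /(cmp_spec u0 J0) c1 /(cmp_spec J0 p1) c2 /(cmp_spec J0 p2) c3.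
move=> /(far_spec u0 p1) f1 /(far_spec u0 p2) f2.
apply/eqP => /(far_spec p1 p2); lia.
Qed.

(** * Blocks from components *)

Section Orientations.
Variables (I : finType) (k : I -> nat) (d' : I -> I -> int).
Hypothesis A' : alcove d'.
Implicit Types (d : I -> I -> int) (B T : {set I}).

Definition opposed d : rel I := fun i j =>
  [&& i != j, inc (k i) (k j) (d i j) & (0 <= d i j) != (0 <= d' i j)].
Definition aligned d : rel I := fun i j =>
  [&& i != j, inc (k i) (k j) (d i j) & (0 <= d i j) == (0 <= d' i j)].
Definition near d : rel I := fun i j => (i != j) && (wt (k i) (k j) (d i j) != 0).

Lemma sign_flip (e e' : int) : ((0 <= -1 - e) == (0 <= -1 - e')) = ((0 <= e) == (0 <= e')).
Proof. lia. Qed.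

Section Fixed.
Variable d : I -> I -> int.
Hypothesis (Ad : alcove d) (swt : same_wt k d d').

Lemma opposed_sym : symmetric (opposed d).
Proof.
move=> i j; rewrite /opposed eq_sym; have [//|ij] := eqVneq j i.
by rewrite (alcoveN Ad ij) (alcoveN A' ij) inc_sym sign_flip.
Qed.

Lemma aligned_sym : symmetric (aligned d).
Proof.
move=> i j; rewrite /aligned eq_sym; have [//|ij] := eqVneq j i.
by rewrite (alcoveN Ad ij) (alcoveN A' ij) inc_sym sign_flip.
Qed.

Lemma near_sym : symmetric (near d).
Proof.
move=> i j; rewrite /near eq_sym; have [//|ij] := eqVneq j i.
by rewrite (alcoveN Ad ij) wt_sym.
Qed.

Variable B : {set I}.
Hypothesis k0 : forall i, i \in B -> (0 < k i)%N.

Lemma not_near i j : i \in B -> j \in B -> i != j -> ~~ near d i j ->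
  wt (k i) (k j) (d i j) = 0 /\ inc (k i) (k j) (d i j).
Proof.
move=> iB jB ij; rewrite /near ij negbK => /eqP w0; split=> //.
exact: far_inc (k0 iB) (k0 jB) w0.
Qed.

Lemma relations_cover i j : i \in B -> j \in B -> i != j ->
  [|| opposed d i j, aligned d i j | near d i j].
Proof.
move=> iB jB ij; have [|nn] := boolP (near d i j); first by rewrite !orbT.
by rewrite orbF /opposed /aligned ij (not_near iB jB ij nn).2 /=; case: (_ == _).
Qed.

Lemma rainbow_free_relations : rainbow_free (opposed d) (aligned d) (near d) B.
Proof.
move=> x y z xB yB zB xy xz yz /and3P[_ ixy sxy] /and3P[_ ixz /eqP sxz] /andP[_ /eqP]; apply.
apply: (rainbow (k0 xB) (k0 yB) (k0 zB) (swt xy) (swt xz) (swt yz)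
          (alcoveD Ad x y z) (alcoveD A' x y z) ixy _ ixz sxz).
by move: sxy; case: (0 <= d x y); case: (0 <= d' x y).
Qed.

(* The rows that a block containing [T] is forced to swallow. *)
Definition inner T : {set I} :=
  [set J in B | [forall t in T, ~~ inc (k t) (k J) (d t J)] &&
                [exists t in T, (k J < k t)%N]].

Lemma component_neighbour (r : rel I) T u : cut_connected r T -> (1 < #|T|)%N ->
  u \in T -> exists2 z, z \in T & r u z.
Proof.
move=> cT T1 uT; have [|||x [z [+ zT _ rxz]]] := cT [set u].
- by rewrite sub1set.
- by apply/set0Pn; exists u; rewrite inE.
- by apply: contraTneq T1 => <-; rewrite cards1.
by rewrite inE => /eqP xu; exists z; rewrite -?xu.
Qed.

Section Component.
Variables (t0 : I).
Hypothesis t0B : t0 \in B.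
Let T := component (opposed d) B t0.
Hypothesis T1 : (1 < #|T|)%N.

Let TB t : t \in T -> t \in B.
Proof. by apply/subsetP; exact: component_sub. Qed.

Let Tconn : cut_connected (opposed d) T.
Proof. exact: component_connected opposed_sym t0B. Qed.

Lemma component_outsider v : v \in B -> v \notin T ->
  (forall t, t \in T -> aligned d t v /\ wt (k t) (k v) (d t v) = 0) \/
  (forall t, t \in T -> ~~ inc (k t) (k v) (d t v)).
Proof.
move=> vB vT.
have nopp t : t \in T -> ~~ opposed d t v.
  move=> tT; apply: contra vT => tv.
  exact: component_closed tT (TB tT) vB tv.
have neT t : t \in T -> t != v by apply: contraTneq => ->.
have step t u : t \in T -> u \in T -> aligned d t v -> opposed d t u ->
    wt (k u) (k v) (d u v) = 0 /\ aligned d u v.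
  move=> tT uT tv tu; have /and3P[ut _ _] := tu.
  have nn : ~~ near d u v.
    apply/negP => nuv.
    by apply: (rainbow_free_relations (TB tT) (TB uT) vB ut (neT _ tT) (neT _ uT) tu tv nuv).
  have [w0 iuv] := not_near (TB uT) vB (neT _ uT) nn; split=> //.
  have := nopp u uT; rewrite /opposed /aligned (neT _ uT) iuv /=.
  by rewrite negbK.
have [/existsP[t /andP[tT tv]]|H] := boolP [exists t, (t \in T) && aligned d t v].
  left; have allE u : u \in T -> aligned d u v.
    move=> uT; have tC := component_sym opposed_sym tT.
    have tu : connect (within (opposed d) B) t u.
      by move: tC uT; rewrite !inE; exact: connect_trans.
    have [] : u \in T /\ aligned d u v; last by [].
    apply: (connect_ind (Q := fun u => u \in T /\ aligned d u v) tu); last by [].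
    move=> a b [aT av] /and3P[aB bB ab].
    have bT : b \in T by exact: component_closed aT aB bB ab.
    by split=> //; have [] := step a b aT bT av ab.
  move=> u uT; split; first exact: allE.
  have [z zT uz] := component_neighbour Tconn T1 uT.
  by rewrite opposed_sym in uz; have [] := step z u zT uT (allE z zT) uz.
right=> t tT; apply: contra (nopp t tT) => itv; rewrite /opposed (neT _ tT) itv /=.
apply: contra H => s; apply/existsP; exists t.
by rewrite tT /aligned (neT _ tT) itv.
Qed.

Lemma inner_hull s : s \in inner T -> exists t1 t2, [/\ t1 \in T, t2 \in T,
  d t1 s + (k s)%:Z - (k t1)%:Z < 0 & 0 <= d t2 s].
Proof.
rewrite inE => /andP[sB /andP[/forall_inP cs /exists_inP[u uT su]]].
have [z zT /and3P[_ iuz _]] := component_neighbour Tconn T1 uT.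
have [[h1|h1] [h2|h2]] := hull (k0 sB) (k0 (TB uT)) (k0 (TB zT)) (alcoveD Ad u z s)
  (cs u uT) (cs z zT) iuz su.
- by exists u, u.
- by exists u, z.
- by exists z, u.
by exists z, z.
Qed.

Lemma component_block : block B k d -> block (T :|: inner T) k d.
Proof.
move=> bl J; rewrite inE negb_or => /andP[JT JS].
have sub i : i \in T :|: inner T -> i \in B.
  by rewrite inE => /orP[/TB //|]; rewrite inE => /andP[].
have [JB|JB] := boolP (J \in B); last first.
  by have [h|h|h|h] := bl J JB; [exact: Or41|apply: Or42|apply: Or43|apply: Or44] => i /sub /h.
have neT t : t \in T -> t != J by apply: contraTneq => ->.
have [far|cmp] := component_outsider JB JT.
  have side t : t \in T -> (0 <= d t J) = (0 <= d t0 J).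
    rewrite inE => t0t; have t0T : t0 \in T by exact: component_refl.
    have [] : t \in T /\ (0 <= d t J) = (0 <= d t0 J); last by [].
    apply: (connect_ind (Q := fun t => t \in T /\ (0 <= d t J) = (0 <= d t0 J)) t0t); last by [].
    move=> a b [aT <-] /and3P[aB bB ab].
    have bT : b \in T by exact: component_closed aT aB bB ab.
    split=> //; apply/esym; have /and3P[nab iab sab] := ab.
    have [/and3P[_ _ /eqP sa] wa] := far a aT; have [/and3P[_ _ /eqP sb] wb] := far b bT.
    apply: (far_side_opp (k0 JB) (k0 aB) (k0 bB) (alcoveD Ad a b J) (alcoveD A' a b J)
      (swt nab) iab _ wa wb _ _ sa sb).
    - by move: sab; case: (0 <= d a b); case: (0 <= d' a b).
    - by rewrite -(swt (neT a aT)).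
    - by rewrite -(swt (neT b bT)).
  have [r|l] := boolP (0 <= d t0 J).
    have rT t : t \in T -> (k t)%:Z <= d t J.
      move=> tT; have [_ w0] := far t tT; have := side t tT; rewrite r.
      by have := far_spec (k0 (TB tT)) (k0 JB) w0; lia.
    apply: Or42 => s; rewrite inE => /orP[/rT //|sS].
    have [t1 [_ [t1T _ h1 _]]] := inner_hull sS.
    by have := rT _ t1T; have := alcoveD Ad t1 s J; move: h1; clear; lia.
  have lT t : t \in T -> d t J + (k J)%:Z < 0.
    move=> tT; have [_ w0] := far t tT; have := side t tT; rewrite (negPf l).
    by have := far_spec (k0 (TB tT)) (k0 JB) w0; lia.
  apply: Or43 => s; rewrite inE => /orP[/lT //|sS].
  have [_ [t2 [_ t2T _ h2]]] := inner_hull sS.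
  by have := lT _ t2T; have := alcoveD Ad t2 s J; move: h2; clear; lia.
have ge t : t \in T -> (k t <= k J)%N.
  move=> tT; rewrite leqNgt; apply: contra JS => kt; rewrite inE JB /=.
  by apply/andP; split; [apply/forall_inP|apply/exists_inP; exists t].
apply: Or44 => s; rewrite inE => /orP[sT|sS]; first by split; [exact: ge|exact: cmp].
have [t1 [t2 [t1T t2T h1 h2]]] := inner_hull sS.
have [sB /exists_inP[u uT su]] : s \in B /\ [exists t in T, (k s < k t)%N].
  by move: sS; rewrite inE => /andP[-> /andP[_ ->]].
have sJ : (k s <= k J)%N by exact: leq_trans (ltnW su) (ge u uT).
split=> //.
have := cmp_spec (k0 (TB t1T)) (k0 JB) (cmp _ t1T).
have := cmp_spec (k0 (TB t2T)) (k0 JB) (cmp _ t2T).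
have := alcoveD Ad t1 s J; have := alcoveD Ad t2 s J.
have := ge _ t1T; have := ge _ t2T; have := k0 sB.
move: h1 h2 sJ; clear; move: (k s) (k t1) (k t2) (k J) (d t1 s) (d t2 s) (d t1 J) (d t2 J) (d s J).
move=> a b c e d1 d2 d3 d4 d5 h1 h2 h3 h4 h5 h6 h7 h8 h9 h10.
by case: (wtP a e d5) => //; lia.
Qed.

End Component.

Lemma component_sub_full (r : rel I) T t : symmetric r ->
  (forall u w, r u w -> inc (k u) (k w) (d u w)) -> t \in B ->
  B \subset T :|: inner T ->
  B \subset component r B t :|: inner (component r B t) -> T \subset B ->
  T != set0 -> component r B t \subset T.
Proof.
move=> rs rinc tB full full' TB Tn0; apply: contraT => /subsetPn[v vT' vT].
have T'B := subsetP (component_sub r tB); have vB := T'B _ vT'.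
have disj u : u \in component r B t -> u \notin T.
  move=> uT'; have vt := component_sym rs vT'.
  have vu : connect (within r B) v u by move: vt uT'; rewrite !inE; exact: connect_trans.
  apply: (connect_ind (Q := fun u => u \notin T) vu) => // a b aT /and3P[aB bB ab].
  apply/negP => bT; have := subsetP full _ aB; rewrite inE (negPf aT) inE /=.
  case/and3P=> _ /forall_inP/(_ b bT); rewrite rs in ab.
  by rewrite (rinc _ _ ab).
have [t0 t0T] := set0Pn _ Tn0.
have [t1 t1T t1max] : exists2 t1, t1 \in T & forall s, s \in T -> (k s <= k t1)%N.
  by case: (arg_maxnP k t0T) => t1 t1T t1max; exists t1.
have := subsetP full' _ (subsetP TB _ t1T); rewrite inE => /orP[/disj|].
  by rewrite t1T.
rewrite inE => /and3P[_ _ /exists_inP[w wT' tw]].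
have := subsetP full _ (T'B _ wT'); rewrite inE (negPf (disj _ wT')) inE /=.
case/and3P=> _ _ /exists_inP[s /t1max st ws].
by rewrite -(ltnn (k w)) (leq_trans ws) // (leq_trans st) // ltnW.
Qed.

Lemma no_two_full t t' : t \in B -> t' \in B -> cut_connected (near d) B ->
  let T := component (opposed d) B t in let T' := component (aligned d) B t' in
  (1 < #|T|)%N -> (1 < #|T'|)%N ->
  B \subset T :|: inner T -> B \subset T' :|: inner T' -> False.
Proof.
move=> tB t'B nearB T T' T1 T'1 full full'.
have TB : T \subset B by exact: component_sub.
have T'B : T' \subset B by exact: component_sub.
have Tn0 : T != set0 by rewrite -card_gt0 ltnW.
have T'n0 : T' != set0 by rewrite -card_gt0 ltnW.
have TT' : T = T'.
  apply/eqP; rewrite eqEsubset; apply/andP; split; apply: component_sub_full => //.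
  - exact: opposed_sym.
  - by move=> u w /and3P[].
  - exact: aligned_sym.
  by move=> u w /and3P[].
have cD : cut_connected (opposed d) T by exact: component_connected opposed_sym tB.
have cE : cut_connected (aligned d) T.
  by rewrite TT'; exact: component_connected aligned_sym t'B.
have inB x : x \in T -> x \in B by exact: (subsetP TB).
have rfT : rainbow_free (opposed d) (aligned d) (near d) T.
  by move=> x y z /inB xB /inB yB /inB zB; exact: rainbow_free_relations.
suff cN : cut_connected (near d) T.
  apply: (gallai opposed_sym aligned_sym near_sym _ _ rfT T1 cD cE cN).
    by move=> x y /inB xB /inB yB; exact: relations_cover.
  by move=> x y _ _; rewrite /opposed /aligned; case: (_ == (0 <= _)); rewrite ?andbF.
have [BT|/subsetPn[J JB JT]] := boolP (B \subset T).
  by have -> : T = B by apply/eqP; rewrite eqEsubset TB.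
have := subsetP full _ JB; rewrite inE (negPf JT) inE /=.
case/and3P=> _ /forall_inP cJ /exists_inP[u uT Ju].
have uB := inB _ uT.
pose C := component (near d) T u.
have CT : C \subset T by exact: component_sub.
suff TC : T \subset C.
  have -> : T = C by apply/eqP; rewrite eqEsubset TC.
  exact: component_connected near_sym uT.
have [//|/subsetPn[y yT yC]] := boolP (T \subset C).
have farC x z : x \in C -> z \in T -> z \notin C -> ~~ near d x z.
  move=> xC zT; apply: contra => xz.
  exact: component_closed xC (subsetP CT _ xC) zT xz.
have uC : u \in C by exact: component_refl.
have uJ : ~~ inc (k u) (k J) (d u J) by exact: cJ.
have neJ z : z \in T -> z != J by apply: contraTneq => ->.
have Jz z : z \in T -> ~~ inc (k J) (k z) (d J z).
  by move=> zT; rewrite (alcoveN Ad (neJ z zT)) inc_sym cJ.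
have neC x z : x \in C -> z \notin C -> x != z by move=> xC; apply: contraNneq => <-.
have far_near z z' : z \in T -> z' \in T -> z \notin C -> z' \notin C -> z != z' -> near d z z'.
  move=> zT z'T zC z'C zz'; rewrite /near zz' /=.
  have [w1 _] := not_near uB (inB _ zT) (neC _ _ uC zC) (farC _ _ uC zT zC).
  have [w2 _] := not_near uB (inB _ z'T) (neC _ _ uC z'C) (farC _ _ uC z'T z'C).
  apply: (two_far (k0 JB) (k0 uB) (k0 (inB _ zT)) (k0 (inB _ z'T)) Ju (alcoveD Ad u J z)
    (alcoveD Ad u J z') (alcoveD Ad u z z') (alcoveD Ad J z z') uJ (Jz _ zT) (Jz _ z'T) w1 w2).
have no_rainbow x z s : x \in T -> z \in T -> s \in T -> near d z s -> x != z -> x != s ->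
    opposed d x z -> aligned d x s -> False.
  move=> xT zT sT zs xz xs oxz axs; have /andP[zs' _] := zs.
  exact: (rfT x z s xT zT sT xz xs zs' oxz axs zs).
have DE x z : ~~ (opposed d x z && aligned d x z).
  by rewrite /opposed /aligned; case: (_ == (0 <= _)); rewrite ?andbF.
have cover x z : x \in C -> z \in T -> z \notin C -> opposed d x z || aligned d x z.
  move=> xC zT zC; have := relations_cover (inB _ (subsetP CT _ xC)) (inB _ zT) (neC _ _ xC zC).
  by rewrite (negPf (farC _ _ xC zT zC)) orbF.
have spreadC (r1 r2 : rel I) : symmetric r1 -> symmetric r2 ->
    (forall x z s, x \in T -> z \in T -> s \in T -> near d z s -> x != z -> x != s ->
       r1 x z -> r2 x s -> False) ->
    (forall x z, x \in C -> z \in T -> z \notin C -> r1 x z || r2 x z) ->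
    r1 u y -> forall x z, x \in C -> z \in T -> z \notin C -> r1 x z.
  move=> s1 s2 nor cov uy x z xC zT zC.
  have xy : r1 x y.
    have [] : x \in C /\ r1 x y; last by [].
    have ux : connect (within (near d) T) u x by move: xC; rewrite inE.
    apply: (connect_ind (Q := fun x => x \in C /\ r1 x y) ux); last by [].
    move=> a b [aC ay] /and3P[aT bT ab].
    have bC : b \in C by exact: component_closed aC aT bT ab.
    split=> //; have /orP[//|byy] := cov b y bC yT yC.
    exfalso; apply: (nor y a b yT aT bT ab); rewrite 1?eq_sym ?neC // ?(s1 y) ?(s2 y) //.
  have [<-//|yz] := eqVneq y z.
  have /orP[//|xz] := cov x z xC zT zC.
  exfalso; apply: (nor x y z (subsetP CT _ xC) yT zT); rewrite ?neC //.
  exact: far_near.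
have Tn : C != T by apply: contraNneq yC => ->.
have Cn : C != set0 by apply/set0Pn; exists u.
exfalso; have /orP[uy|uy] := cover u y uC yT yC.
  have [x [z [xC zT zC xz]]] := cE C CT Cn Tn.
  have xz' : opposed d x z.
    by apply: (spreadC (opposed d) (aligned d)) => //; [exact: opposed_sym|exact: aligned_sym].
  by have := DE x z; rewrite xz xz'.
have [x [z [xC zT zC xz]]] := cD C CT Cn Tn.
have xz' : aligned d x z.
  apply: (spreadC (aligned d) (opposed d)) => //; [exact: aligned_sym|exact: opposed_sym| |].
    move=> a b c aT bT cT bc ab ac abr acr.
    by apply: (no_rainbow a c b); rewrite // near_sym.
  by move=> a b aC bT bC; rewrite orbC; exact: cover.
by have := DE x z; rewrite xz xz'.
Qed.

End Fixed.
End Orientations.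

(** * Linking configurations with equal weights *)

Section Chain.
Variables (I : finType) (R : archiRealFieldType) (K : idomainType).
Variables (q : K) (x : nat -> K) (M L : nat).
Local Notation G := (gen q x M L).
Hypothesis q0 : q != 0.
Variable k : I -> nat.
Hypothesis kL : (\sum_i k i <= L.+1)%N.
Hypothesis IHsq : forall k2 (p r : I -> R), (\sum_i k2 i = \sum_i k i)%N ->
  (\sum_i k i ^ 2 < \sum_i k2 i ^ 2)%N -> generic p -> generic r ->
  same_wt k2 (disp p) (disp r) -> G k2 (disp p) = G k2 (disp r).
Implicit Types (p r : I -> R) (B : {set I}).

Lemma flip_block B p : generic p -> (forall i, i \in B -> (0 < k i)%N) -> block B k (disp p) ->
  exists r : I -> R, [/\ generic r, G k (disp p) = G k (disp r) & mirror B k (disp p) (disp r)].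
Proof.
move=> gp k0 bl; have [r gr mr] := exists_mirror gp k0 bl.
by exists r; split=> //; exact: (gen_mirror q0 kL IHsq k0 gp gr bl mr).
Qed.

Variable p' : I -> R.
Hypothesis gp' : generic p'.
Let A' := alcove_disp gp'.

Definition sorted_on B p r : Prop := forall i j, i != j ->
  same_pair false (k i) (k j) (disp r i j)
    (if (i \in B) && (j \in B) then disp p' i j else disp p i j).

Lemma same_pair_trans n n' e e1 e2 :
  same_pair false n n' e e1 -> same_pair false n n' e1 e2 -> same_pair false n n' e e2.
Proof. by move=> /same_pair_sym; exact: same_pair_comp. Qed.

Lemma same_pair_refl n n' e : same_pair false n n' e e. Proof. by split. Qed.

Lemma sorted_same_wt B p r : same_wt k (disp p) (disp p') -> sorted_on B p r ->
  same_wt k (disp r) (disp p').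
Proof.
by move=> swt sr i j ij; have [-> _] := sr i j ij; case: ifP => // _; exact: swt.
Qed.

Lemma sorted_on_sub B B1 p p1 p2 : B1 \subset B -> sorted_on B1 p p1 -> sorted_on B p1 p2 ->
  sorted_on B p p2.
Proof.
move=> B1B s1 s2 i j ij; have := s2 i j ij; have := s1 i j ij.
have [//|nB] := boolP ((i \in B) && (j \in B)).
rewrite (_ : (i \in B1) && (j \in B1) = false); first by move=> h1 h2; exact: same_pair_trans h2 h1.
by apply: contraNF nB => /andP[/(subsetP B1B) -> /(subsetP B1B) ->].
Qed.

Definition sortable B : Prop := forall p, generic p -> same_wt k (disp p) (disp p') ->
  block B k (disp p) ->
  exists r : I -> R, [/\ generic r, G k (disp p) = G k (disp r) & sorted_on B p r].

Lemma sorted_block B B1 p p1 : (forall i, i \in B -> (0 < k i)%N) -> B1 \subset B ->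
  sorted_on B1 p p1 -> block B k (disp p) -> block B k (disp p1).
Proof.
move=> k0 B1B s1 bl; apply: block_same_wt k0 bl _ => i J iB JB.
have iJ : i != J by apply: contraNneq JB => <-.
apply: same_pair_sym; have := s1 i J iJ.
by rewrite (_ : (J \in B1) = false) ?andbF //; apply: contraNF JB; exact: (subsetP B1B).
Qed.

Local Notation opp p := (opposed k (disp p') (disp p)).
Local Notation agr p := (aligned k (disp p') (disp p)).

Definition all_proper B p : Prop := forall t, t \in B ->
  (1 < #|component (opp p) B t|)%N ->
  ~~ (B \subset component (opp p) B t :|: inner k (disp p) B (component (opp p) B t)).

Lemma sort_proper B p : (forall i, i \in B -> (0 < k i)%N) ->
  (forall B1, B1 \proper B -> sortable B1) ->
  generic p -> same_wt k (disp p) (disp p') -> block B k (disp p) -> all_proper B p ->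
  exists r : I -> R, [/\ generic r, G k (disp p) = G k (disp r) & sorted_on B p r].
Proof.
move=> k0 IH.
pose opps p := [set ij : I * I | [&& ij.1 \in B, ij.2 \in B & opp p ij.1 ij.2]].
have [n] := ubnP #|opps p|; elim: n p => // n IHn p; rewrite ltnS => pn gp swt bl prop.
have Ap := alcove_disp gp.
have [/eqP o0|[[t u]]] := set_0Vmem (opps p).
  exists p; split=> // i j ij; case: ifP => [/andP[iB jB]|_]; last exact: same_pair_refl.
  split=> [|ic]; first exact: swt.
  apply/eqP; apply: contraTT isT => s.
  by have : (i, j) \in opps p; [rewrite inE iB jB /opposed ij ic|rewrite (eqP o0) inE].
rewrite inE /= => /and3P[tB uB tu]; have /and3P[tu' _ _] := tu.
set T := component (opp p) B t.
have tT : t \in T by exact: component_refl.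
have uT : u \in T by exact: component_closed tT tB uB tu.
have T1 : (1 < #|T|)%N.
  by rewrite (cardsD1 t) tT (cardsD1 u) in_setD1 uT eq_sym tu'.
pose B1 := T :|: inner k (disp p) B T.
have B1B : B1 \subset B.
  rewrite subUset component_sub //; apply/subsetP => s.
  by rewrite inE => /andP[].
have B1p : B1 \proper B by rewrite properEneq B1B andbT;
  apply: contra (prop t tB T1) => /eqP B1E; rewrite -/T -/B1 B1E.
have bl1 : block B1 k (disp p) by exact: (component_block A' Ap swt k0 tB T1 bl).
have [p1 [gp1 E1 s1]] := IH B1 B1p p gp swt bl1.
have Ap1 := alcove_disp gp1.
have swt1 := sorted_same_wt swt s1.
have subopp i j : i \in B -> j \in B -> opp p1 i j -> opp p i j.
  move=> iB jB /and3P[ij ic sg]; have [E H] := s1 i j ij.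
  rewrite /opposed ij; move: E H; case: ifP => [_|_] E H.
    by move: sg; rewrite (H ic) /= eqxx.
  by rewrite -(same_pair_inc (conj E H)) ic /= -[0 <= disp p i j]/(false (+) _) -H.
have [r [gr Er sr]] : exists r : I -> R,
    [/\ generic r, G k (disp p1) = G k (disp r) & sorted_on B p1 r].
  apply: IHn => //.
  - apply: leq_trans pn; apply: proper_card.
    apply/properP; split.
      apply/subsetP => -[i j]; rewrite !inE /= => /and3P[iB jB o].
      by rewrite iB jB subopp.
    exists (t, u); rewrite inE /= ?tB ?uB ?tu //=.
    have [tB1 uB1] : t \in B1 /\ u \in B1 by rewrite !in_setU tT uT.
    have [_ H] := s1 t u tu'; move: H; rewrite tB1 uB1 /opposed tu' /=.
    by move=> H; apply/negP => /andP[/H ->]; rewrite eqxx.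
  - exact: sorted_block s1 bl.
  move=> v vB T'1.
  set T' := component (opp p1) B v; pose T0 := component (opp p) B v.
  have T'T0 : T' \subset T0.
    apply/subsetP => w; rewrite inE => vw.
    have [] : w \in B /\ w \in T0; last by [].
    apply: (connect_ind (Q := fun w => w \in B /\ w \in T0) vw); last first.
      by split=> //; exact: component_refl.
    move=> a b [aB aT] /and3P[_ bB ab]; split=> //.
    exact: component_closed aT aB bB (subopp a b aB bB ab).
  have T01 : (1 < #|T0|)%N by apply: leq_trans T'1 (subset_leq_card T'T0).
  have /subsetPn[J JB] := prop v vB T01; rewrite inE negb_or => /andP[JT JS].
  apply/subsetPn; exists J => //; rewrite inE negb_or.
  rewrite (contra (subsetP T'T0 J) JT) /=; apply: contra JS.
  rewrite in_set JB /= => /andP[/forall_inP cJ /exists_inP[s sT' Js]].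
  have sT0 := subsetP T'T0 _ sT'.
  rewrite in_set JB /=; apply/andP; split; last by apply/exists_inP; exists s.
  have incE i j : i != j -> inc (k i) (k j) (disp p i j) = inc (k i) (k j) (disp p1 i j).
    by move=> ij; rewrite /inc (swt _ _ ij) (swt1 _ _ ij).
  have sJ : s != J by apply: contraNneq JT => <-.
  have [far|cmp] := component_outsider A' Ap swt k0 vB T01 JB JT; last by apply/forall_inP.
  by have [/and3P[_ + _] _] := far s sT0; rewrite incE // (negPf (cJ s sT')).
by exists r; split=> //; [rewrite E1|exact: sorted_on_sub s1 sr].
Qed.

Lemma sort_disconnected B x0 : (forall i, i \in B -> (0 < k i)%N) ->
  (forall B1, B1 \proper B -> sortable B1) -> x0 \in B ->
  (forall i, i \in B -> p' x0 <= p' i) ->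
  (exists2 p : I -> R, same_wt k (disp p) (disp p') & component (near k (disp p)) B x0 != B) ->
  sortable B.
Proof.
move=> k0 IH x0B x0min [p0 swt0 KB0] p gp swt bl.
have Ap := alcove_disp gp.
pose C := component (near k (disp p)) B x0.
have KB : C != B.
  have nearE : near k (disp p0) =2 near k (disp p).
    move=> i j; rewrite /near; have [//|ij] := eqVneq i j.
    by rewrite (swt0 _ _ ij) (swt _ _ ij).
  have CE : component (near k (disp p0)) B x0 = C by apply: eq_component => i j _ _.
  by rewrite -CE.
have CB : C \subset B by exact: component_sub.
have Cp : C \proper B by rewrite properEneq KB.
have inB z : z \in C -> z \in B by exact: (subsetP CB).
have x0C : x0 \in C by exact: component_refl.
have ne z y : z \in C -> y \notin C -> z != y by move=> zC; apply: contraNneq => <-.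
have farC z y : z \in C -> y \in B -> y \notin C ->
    wt (k z) (k y) (disp p z y) = 0 /\ inc (k z) (k y) (disp p z y).
  move=> zC yB yC; apply: (not_near k0 (inB z zC) yB (ne z y zC yC)).
  by apply: contra yC => zy; apply: component_closed zC (inB z zC) yB zy.
have side d : alcove d -> same_wt k (disp p) d -> forall y z, y \in B -> y \notin C ->
    z \in C -> (0 <= d z y) = (0 <= d x0 y).
  move=> Ad sd y z yB yC; rewrite inE => xz.
  have [] : z \in C /\ (0 <= d z y) = (0 <= d x0 y); last by [].
  apply: (connect_ind (Q := fun z => z \in C /\ (0 <= d z y) = (0 <= d x0 y)) xz); last by [].
  move=> a b [aC <-] /and3P[aB bB ab]; have /andP[nab wab] := ab.
  have bC : b \in C by exact: component_closed aC aB bB ab.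
  split=> //; apply/esym.
  apply: (far_side_near (k0 y yB) (k0 a aB) (k0 b bB) (alcoveD Ad a b y)).
  - by rewrite -sd ?ne // (farC a y aC yB yC).1.
  - by rewrite -sd ?ne // (farC b y bC yB yC).1.
  by rewrite -sd.
have side' y z : y \in B -> y \notin C -> z \in C -> 0 <= disp p' z y.
  move=> yB yC zC; rewrite (side _ A' swt y z yB yC zC) /disp floor_ge0 subr_ge0.
  exact: x0min.
pose Lf := [set y in B | (y \notin C) && (disp p x0 y < 0)].
have LfE y : (y \in Lf) = [&& y \in B, y \notin C & disp p x0 y < 0] by rewrite in_set.
pose B1 := C :|: Lf.
have B1B : B1 \subset B.
  by rewrite subUset CB; apply/subsetP => y; rewrite LfE => /andP[].
have k01 i : i \in B1 -> (0 < k i)%N by move=> /(subsetP B1B); exact: k0.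
have bl1 : block B1 k (disp p).
  move=> J JB1; have [JB|JB] := boolP (J \in B); last first.
    by have [h|h|h|h] := bl J JB;
    [exact: Or41|apply: Or42|apply: Or43|apply: Or44] => i /(subsetP B1B) /h.
  move: JB1; rewrite in_setU negb_or LfE JB /= => /andP[JC]; rewrite JC /= -leNgt => JR.
  have right z : z \in C -> (k z)%:Z <= disp p z J.
    move=> zC; have [w0 _] := farC z J zC JB JC.
    have := far_spec (k0 z (inB z zC)) (k0 J JB) w0.
    by rewrite -(side _ Ap (fun i j _ => erefl) J z JB JC zC) in JR; move: JR; clear; lia.
  apply: Or42 => i; rewrite in_setU => /orP[/right //|].
  rewrite LfE => /and3P[iB iC iL].
  have [w0 _] := farC x0 i x0C iB iC.
  have := far_spec (k0 x0 x0B) (k0 i iB) w0.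
  have := right x0 x0C; have := alcoveD Ap i x0 J; have := alcoveN Ap (ne x0 i x0C iC).
  by move: iL; clear; lia.
have [p1 [gp1 E1 m1]] := flip_block gp k01 bl1; have Ap1 := alcove_disp gp1.
have swt1 : same_wt k (disp p1) (disp p').
  by move=> i j ij; have [<- _] := m1 i j ij; exact: swt.
have swp1 : same_wt k (disp p) (disp p1).
  by move=> i j ij; have [-> _] := m1 i j ij.
have right1 y z : y \in B -> y \notin C -> z \in C -> 0 <= disp p1 z y.
  move=> yB yC zC; rewrite (side _ Ap1 swp1 y z yB yC zC).
  have [_ /(_ (farC x0 y x0C yB yC).2)] := m1 x0 y (ne _ _ x0C yC).
  rewrite !in_setU x0C (LfE y) yB (negPf yC) /=; case: ltP => h /=; last by move=> <-.
  by move=> /esym/negbFE.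
have bl1B : block B k (disp p1).
  apply: block_same_wt k0 bl _ => i J iB JB; have iJ : i != J by apply: contraNneq JB => <-.
  have := m1 i J iJ; rewrite (_ : J \in B1 = false) ?andbF //.
  by apply: contraNF JB; exact: (subsetP B1B).
have farR (r : I -> R) : generic r -> same_wt k (disp p) (disp r) ->
    (forall y z, y \in B -> y \notin C -> z \in C -> 0 <= disp r z y) ->
    forall y z, y \in B -> y \notin C -> z \in C -> (k z)%:Z <= disp r z y.
  move=> gr sr rr y z yB yC zC; have [w0 _] := farC z y zC yB yC.
  rewrite (sr _ _ (ne z y zC yC)) in w0.
  by have := far_spec (k0 z (inB z zC)) (k0 y yB) w0; have := rr y z yB yC zC; clear; lia.
have blC : block C k (disp p1).
  move=> J JC; have [JB|JB] := boolP (J \in B).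
    by apply: Or42 => z zC; apply: (farR p1 gp1 swp1 right1).
  by have [h|h|h|h] := bl1B J JB; [exact: Or41|apply: Or42|apply: Or43|apply: Or44] => i /inB /h.
have [p2 [gp2 E2 s2]] := IH C Cp p1 gp1 swt1 blC; have Ap2 := alcove_disp gp2.
have swt2 := sorted_same_wt swt1 s2.
have swp2 : same_wt k (disp p) (disp p2).
  by move=> i j ij; rewrite (swt _ _ ij) (swt2 _ _ ij).
have keep (r s : I -> R) : same_wt k (disp p) (disp s) ->
    sorted_on C r s \/ sorted_on (B :\: C) r s ->
    (forall y z, y \in B -> y \notin C -> z \in C -> 0 <= disp r z y) ->
    forall y z, y \in B -> y \notin C -> z \in C -> 0 <= disp s z y.
  move=> ss srt rr y z yB yC zC; have zy := ne z y zC yC.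
  have ic : inc (k z) (k y) (disp s z y).
    by have := (farC z y zC yB yC).2; rewrite /inc (ss _ _ zy).
  have [_ H] : same_pair false (k z) (k y) (disp s z y) (disp r z y).
    by case: srt => /(_ z y zy); rewrite ?in_setD zC (negPf yC) ?andbF.
  by rewrite (H ic) /= rr.
have right2 := keep p1 p2 swp2 (or_introl s2) right1.
have bl2 : block (B :\: C) k (disp p2).
  have bl2B := sorted_block k0 CB s2 bl1B.
  move=> J; rewrite in_setD negb_and negbK.
  have [JB|JB _] := boolP (J \in B); last first.
    have [h|h|h|h] := bl2B J JB; [exact: Or41|apply: Or42|apply: Or43|apply: Or44] => i;
    by rewrite in_setD => /andP[_ /h].
  rewrite orbF => JC; apply: Or43 => i; rewrite in_setD => /andP[iC iB].
  have := farR p2 gp2 swp2 right2 i J iB iC JC; have := alcoveN Ap2 (ne J i JC iC).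
  by clear; lia.
have BCp : B :\: C \proper B.
  rewrite properEneq subsetDl andbT; apply: contraTneq x0B => <-.
  by rewrite in_setD x0C.
have [p3 [gp3 E3 s3]] := IH _ BCp p2 gp2 swt2 bl2; have Ap3 := alcove_disp gp3.
have swt3 := sorted_same_wt swt2 s3.
have swp3 : same_wt k (disp p) (disp p3).
  by move=> i j ij; rewrite (swt _ _ ij) (swt3 _ _ ij).
have right3 := keep p2 p3 swp3 (or_intror s3) right2.
exists p3; split=> //; first by rewrite E1 E2.
have cross i j : i \in C -> j \in B -> j \notin C ->
    same_pair false (k i) (k j) (disp p3 i j) (disp p' i j).
  move=> iC jB jC; split=> [|_]; first by apply: swt3; exact: ne.
  by rewrite right3 // side'.
have notC i : i \notin B -> (i \in C) = false by apply: contraNF; exact: inB.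
have notB1 i : i \notin B -> (i \in B1) = false by apply: contraNF; exact: (subsetP B1B).
move=> i j ij; have := s3 i j ij; have := s2 i j ij; have := m1 i j ij.
rewrite !in_setD.
have [iB|iB] := boolP (i \in B); last first.
  rewrite (notC i iB) (notB1 i iB) andbF /= => /same_pair_sym h1 h2 h3.
  exact: same_pair_trans h3 (same_pair_trans h2 h1).
have [jB|jB] := boolP (j \in B); last first.
  rewrite (notC j jB) (notB1 j jB) !andbF /= => /same_pair_sym h1 h2 h3.
  exact: same_pair_trans h3 (same_pair_trans h2 h1).
have [iC|iC] := boolP (i \in C); have [jC|jC] := boolP (j \in C) => //= _ h2 h3.
- exact: same_pair_trans h3 h2.
- exact: cross.
have ji : j != i by rewrite eq_sym.
rewrite (alcoveN Ap3 ji) (alcoveN A' ji); apply: same_pair_flip; exact: cross.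
Qed.

Lemma sort_block B : (forall i, i \in B -> (0 < k i)%N) -> sortable B.
Proof.
have [n] := ubnP #|B|; elim: n B => // n IHn B; rewrite ltnS => Bn k0.
have IH B1 : B1 \proper B -> sortable B1.
  move=> B1B; apply: IHn; first by apply: leq_trans (proper_card B1B) Bn.
  by move=> i iB1; apply: k0; move/proper_sub/subsetP: B1B; apply.
have [->|[x1 x1B]] := set_0Vmem B.
  move=> p gp swt bl; exists p; split=> // i j ij.
  by rewrite !inE /=; exact: same_pair_refl.
case: (@arg_minP _ R _ x1 (mem B) p' x1B) => x0 x0B x0min p gp swt bl.
have Ap := alcove_disp gp.
have [nearB|nB] := eqVneq (component (near k (disp p)) B x0) B; last first.
  by apply: (sort_disconnected k0 IH x0B x0min) => //; exists p.
have cN : cut_connected (near k (disp p)) B.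
  by rewrite -nearB; apply: component_connected => //; exact: near_sym.
have [PR|] := boolP [forall t in B, (1 < #|component (opp p) B t|)%N ==>
   ~~ (B \subset component (opp p) B t :|: inner k (disp p) B (component (opp p) B t))].
  by apply: sort_proper => // t tB T1; move/forall_inP: PR => /(_ t tB)/implyP; apply.
rewrite negb_forall_in => /exists_inP[t tB]; rewrite negb_imply negbK => /andP[T1 full].
have [r [gr Er mr]] := flip_block gp k0 bl; have Ar := alcove_disp gr.
have swr : same_wt k (disp r) (disp p').
  by move=> i j ij; have [<- _] := mr i j ij; exact: swt.
have blr : block B k (disp r).
  apply: block_same_wt k0 bl _ => i J iB JB; have iJ : i != J by apply: contraNneq JB => <-.
  by have := mr i J iJ; rewrite (negPf JB) andbF.
have oppE i j : i \in B -> j \in B -> opp r i j = agr p i j.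
  move=> iB jB; rewrite /opposed /aligned; have [//|ij] := eqVneq i j.
  have S := mr i j ij; rewrite -(same_pair_inc S); case ic: (inc _ _ _) => //=.
  have [_ /(_ ic)] := S; rewrite iB jB /= => ->.
  by case: (0 <= disp r i j); case: (0 <= disp p' i j).
have compE t' : component (opp r) B t' = component (agr p) B t'.
  by apply: eq_component => i j iB jB; exact: oppE.
have innerE (T : {set I}) : T \subset B -> inner k (disp r) B T = inner k (disp p) B T.
  move=> TB; apply/setP => J; rewrite [LHS]in_set [RHS]in_set.
  case: (J \in B) => //=; congr (_ && _).
  apply: eq_forallb => s; case: (s \in T) => //=.
  have [->|sJ] := eqVneq s J; first by rewrite (alcove0 Ap) (alcove0 Ar).
  by rewrite /inc (swt _ _ sJ) (swr _ _ sJ).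
have [|s [gs Es ss]] := sort_proper k0 IH gr swr blr.
  move=> t' t'B; rewrite compE => T'1; rewrite innerE ?component_sub //.
  apply/negP => full'.
  exact: (no_two_full A' Ap swt k0 tB t'B cN T1 T'1 full full').
exists s; split=> //; first by rewrite Er.
move=> i j ij; have := ss i j ij; have := mr i j ij.
by case: ifP => // _ /same_pair_sym h1 h2; exact: same_pair_trans h2 h1.
Qed.

Lemma gen_same_wt p : generic p -> same_wt k (disp p) (disp p') ->
  G k (disp p) = G k (disp p').
Proof.
move=> gp swt; pose B := [set i | (0 < k i)%N].
have k0 i : i \in B -> (0 < k i)%N by rewrite inE.
have [|r [gr -> sr]] := sort_block k0 gp swt.
  by move=> J; rewrite inE -eqn0Ngt => /eqP J0; exact: Or41.
apply: (gen_same_sign q x M (size_le kL) gr gp') => i j ij; rewrite inE /=.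
have := sr i j ij; rewrite !inE.
have [i0|i0] := posnP (k i); first by
  rewrite i0 => _; split; [rewrite /wt; lia|rewrite /inc /wt; lia].
have [j0|j0] := posnP (k j); last by [].
by rewrite j0 => _; split; [rewrite /wt; lia|rewrite /inc /wt; lia].
Qed.

End Chain.

Section SameWeights.
Variables (I : finType) (R : archiRealFieldType) (K : idomainType).
Variables (q : K) (x : nat -> K) (M L : nat).
Hypothesis q0 : q != 0.

Lemma sum_sq_le (k : I -> nat) : (\sum_i k i ^ 2 <= (\sum_i k i) ^ 2)%N.
Proof.
elim/big_rec2: _ => // i s t _ h; rewrite sqrnD.
by rewrite -addnA leq_add2l (leq_trans h) // leq_addr.
Qed.

Theorem gen_weights (k : I -> nat) (p p' : I -> R) : (\sum_i k i <= L.+1)%N ->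
  generic p -> generic p' -> same_wt k (disp p) (disp p') ->
  gen q x M L k (disp p) = gen q x M L k (disp p').
Proof.
have [n] := ubnP ((\sum_i k i) ^ 2 - \sum_i k i ^ 2)%N.
elim: n k p p' => // n IH k p p'; rewrite ltnS => kn kL gp gp' swt.
apply: (gen_same_wt q0 kL _ gp' gp swt) => k2 r r' sumk sqk gr gr' sw2.
apply: IH; rewrite ?sumk //; apply: leq_trans kn.
by have := sum_sq_le k2; rewrite sumk; move: sqk; clear; lia.
Qed.

End SameWeights.

(** * Horizontal-strips *)

From mathcomp Require Import finmap.
From mathcomp Require Import boolp classical_sets fsbigop.
Local Open Scope nat_scope.

Definition row_size (R : hrow) : nat := row_a R - row_b R.

Lemma mem_cells (R : hrow) (c : nat * nat) :
  (c \in cells R) = (c.1 == 1) && (row_b R < c.2 <= row_a R).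
Proof.
have := row_leq R; case: c => x y ba; apply/imfsetP/idP => [[j /=]|/= /andP[/eqP -> h]].
  by rewrite mem_iota => h [-> ->] /=; lia.
by exists y => //=; rewrite mem_iota; lia.
Qed.

Lemma cell_proof (R : hrow) (u : 'I_(row_size R)) : (1, row_b R + u.+1) \in cells R.
Proof. rewrite mem_cells /=; have := ltn_ord u; rewrite /row_size; lia. Qed.

Definition cell (R : hrow) (u : 'I_(row_size R)) : cells R := FSetSub (cell_proof u).

Definition cell_index (R : hrow) (c : cells R) : nat := (val c).2 - (row_b R).+1.

Lemma cell_index_lt (R : hrow) (c : cells R) : cell_index c < row_size R.
Proof.
case: c => -[y z] h; have h' : (y, z) \in cells R := h.
by rewrite mem_cells in h'; move: h'; rewrite /cell_index /row_size /=; lia.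
Qed.

Lemma cell_indexK (R : hrow) (c : cells R) : cell (Ordinal (cell_index_lt c)) = c.
Proof.
apply: val_inj; case: c => -[y z] h; have h' : (y, z) \in cells R := h.
rewrite mem_cells in h'; case/andP: h' => /= /eqP y1 ?.
by congr pair; rewrite /cell_index /=; lia.
Qed.

Lemma cellK (R : hrow) (u : 'I_(row_size R)) : cell_index (cell u) = u.
Proof. by rewrite /cell_index /=; lia. Qed.

Lemma content_cell (R : hrow) (u : 'I_(row_size R)) : content (val (cell u)) = row_b R + u.
Proof. by rewrite /content /=; lia. Qed.

Lemma sum_cells (R : hrow) (F : cells R -> nat) :
  \sum_(c : cells R) F c = \sum_(u < row_size R) F (cell u).
Proof.
rewrite (reindex (@cell R)) //; exists (fun c => Ordinal (cell_index_lt c)) => c _.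
  by apply: val_inj; rewrite /= cellK.
exact: cell_indexK.
Qed.

Lemma card_cells_set (R : hrow) (P : pred (cells R)) :
  #|[set u : cells R | P u]| = \sum_(u < row_size R) P (cell u).
Proof. by rewrite -sum1dep_card big_mkcond sum_cells; apply: eq_bigr => u _; case: (P _). Qed.

Lemma card_cells_set2 (R S : hrow) (P : cells R * cells S -> bool) :
  #|[set uv : cells R * cells S | P uv]| =
  \sum_(u < row_size R) \sum_(v < row_size S) P (cell u, cell v).
Proof.
rewrite -sum1dep_card big_mkcond /=.
rewrite (eq_bigr (fun uv : cells R * cells S => (P (uv.1, uv.2) : nat))); last first.
  by case=> u v _ /=; case: (P _).
rewrite -(pair_bigA _ (fun u v => (P (u, v) : nat))) sum_cells /=.
by apply: eq_bigr => u _; rewrite sum_cells.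
Qed.

Lemma card_row_cells (b m : nat) : #|` [fset (1, j) | j in iota b m]%fset| = m.
Proof.
transitivity (size [seq (1, j) | j <- iota b m]); last by rewrite size_map size_iota.
apply/perm_size/uniq_perm; first exact: fset_uniq.
  by rewrite map_inj_uniq ?iota_uniq // => i j [].
move=> c; apply/imfsetP/mapP => -[j jm ->]; by exists j.
Qed.

Lemma card_cells (R : hrow) : #|` cells R| = row_size R.
Proof. exact: card_row_cells. Qed.

Lemma card_cellsI (R S : hrow) : #|` (cells R `&` cells S)%fset| =
  minn (row_a R) (row_a S) - maxn (row_b R) (row_b S).
Proof.
rewrite -[RHS](card_row_cells (maxn (row_b R) (row_b S)).+1); congr #|` _|.
apply/fsetP => -[x y]; rewrite in_fsetI !mem_cells /=.
apply/idP/imfsetP => [/andP[/andP[/eqP -> h1] /andP[_ h2]]|[j /=]].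
  by exists y => //=; rewrite mem_iota; lia.
by rewrite mem_iota => h [-> ->]; lia.
Qed.

Local Open Scope ring_scope.

(* The fraction breaks ties between rows in the way [rowM] and [inversion] do. *)
Definition row_pos (n : nat) (lam : hstrip n) (i : 'I_n) : rat :=
  (row_b (tnth lam i))%:R + i%:R / n%:R.

Lemma row_pos_disp (n : nat) (lam : hstrip n) (i j : 'I_n) : (i < j)%N ->
  row_pos lam j - row_pos lam i \isn't a Num.int /\
  disp (row_pos lam) i j = (row_b (tnth lam j))%:Z - (row_b (tnth lam i))%:Z.
Proof.
move=> ij; rewrite /disp; apply: nonint_open; rewrite /row_pos intrD intrN -!pmulrn.
set u := (row_b _)%:R; set v := (row_b _)%:R.
have n0 : 0 < n%:R :> rat by rewrite ltr0n; have := ltn_ord i; lia.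
have h1 : i%:R / n%:R < j%:R / n%:R :> rat by rewrite ltr_pM2r ?invr_gt0 // ltr_nat.
have h2 : j%:R / n%:R < 1 + i%:R / n%:R :> rat.
  have hj : j%:R < n%:R + i%:R :> rat by rewrite -natrD ltr_nat; have := ltn_ord j; lia.
  by rewrite -ltrBlDr -mulrBl ltr_pdivrMr // mul1r; lra.
lra.
Qed.

Lemma row_pos_generic (n : nat) (lam : hstrip n) : generic (row_pos lam).
Proof.
move=> i j ij; have [h|h|h] := ltngtP i j; first by have [] := row_pos_disp lam h.
  by rewrite -nonintN opprB; have [] := row_pos_disp lam h.
by move: ij; rewrite -(inj_eq val_inj) /= h eqxx.
Qed.

Lemma rowM_wt (n : nat) (lam : hstrip n) (i j : 'I_n) : (i < j)%N ->
  (rowM (tnth lam i) (tnth lam j))%:Z =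
  wt (row_size (tnth lam i)) (row_size (tnth lam j)) (disp (row_pos lam) i j).
Proof.
move=> /(row_pos_disp lam)[_ ->]; rewrite /rowM /row_l !card_cellsI /row_shift /= /row_size.
have := row_leq (tnth lam i); have := row_leq (tnth lam j).
move: (row_a _) (row_a _) (row_b _) (row_b _) => a a' b b'.
by rewrite /wt; case: ifP; lia.
Qed.

Lemma eweight_wt (n : nat) (lam : hstrip n) (i j : 'I_n) : i != j ->
  (eweight (w := strip_graph lam) i j)%:Z =
  wt (row_size (tnth lam i)) (row_size (tnth lam j)) (disp (row_pos lam) i j).
Proof.
move=> ij /=; case: ltngtP => h; first exact: rowM_wt.
  by rewrite (rowM_wt lam h) (alcoveN (alcove_disp (row_pos_generic lam)) ij) wt_sym.
by move: ij; rewrite -(inj_eq val_inj) /= h eqxx.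
Qed.

Lemma sum_ordered_pairs (n : nat) (A : 'I_n -> 'I_n -> nat) : (forall i, A i i = 0%N) ->
  (\sum_i \sum_j A i j = \sum_(i < n) \sum_(j < n | i < j) (A i j + A j i))%N.
Proof.
move=> A0; under [RHS]eq_bigr do rewrite big_split.
have E : (\sum_(i < n) \sum_(j < n | i < j) A j i = \sum_(i < n) \sum_(j < n | j < i) A i j)%N.
  under eq_bigr do rewrite big_mkcond.
  by rewrite exchange_big; apply: eq_bigr => i _; rewrite -big_mkcond.
rewrite big_split /= E -big_split; apply: eq_bigr => i _ /=.
rewrite [LHS](bigID (fun j : 'I_n => i < j)%N) /=; congr addn.
rewrite (bigD1 i) /= ?ltnn // A0 add0n; apply: eq_bigl => j.
by rewrite -leqNgt ltn_neqAle andbC.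
Qed.

Lemma digits_inj (b d : nat) (c e : nat -> nat) :
  (forall v, v < d -> c v < b)%N -> (forall v, v < d -> e v < b)%N ->
  (\sum_(v < d) c v * b ^ v = \sum_(v < d) e v * b ^ v)%N ->
  forall v, (v < d)%N -> c v = e v.
Proof.
elim: d c e => // d IH c e cb eb; rewrite !big_ord_recl /= !muln1 => E.
have shift (f : nat -> nat) :
    (\sum_(i < d) f (bump 0 i) * b ^ bump 0 i = (\sum_(i < d) f i.+1 * b ^ i) * b)%N.
  by rewrite big_distrl; apply: eq_bigr => i _; rewrite /bump add1n expnSr mulnA.
rewrite !shift in E; have b0 : (0 < b)%N by apply: leq_ltn_trans (cb 0%N _).
have E0 : c 0%N = e 0%N.
  by have := congr1 (modn^~ b) E; rewrite /= ![(_ 0 + _)%N]addnC !modnMDl !modn_small ?cb ?eb.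
case=> [//|v] vd; apply: (IH (fun v => c v.+1) (fun v => e v.+1)) => //.
- by move=> u ud; exact: cb.
- by move=> u ud; exact: eb.
by apply/eqP; rewrite -(eqn_pmul2r b0); apply/eqP; move: E; rewrite E0 => /addnI.
Qed.

Section Coefficients.
Variables (n : nat) (lam : hstrip n) (M L : nat).
Hypothesis sizeL : forall i, (row_size (tnth lam i) <= L.+1)%N.
Local Notation k := (fun i : 'I_n => row_size (tnth lam i)).
Local Notation row := {ffun 'I_L.+1 -> 'I_M.+1}.

Definition fill (T : {ffun 'I_n -> row}) : filling lam :=
  [ffun i => [ffun c => entry (T i) (cell_index c)]].

Lemma fill_cell T i u : fill T i (@cell (tnth lam i) u) = entry (T i) u.
Proof. by rewrite !ffunE cellK. Qed.

Lemma fill_inv_num T : inv_num (fill T) =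
  (\sum_i \sum_j attacks (k i) (k j) (disp (row_pos lam) i j) (entry (T i)) (entry (T j)))%N.
Proof.
rewrite sum_ordered_pairs; last first.
  by move=> i; rewrite (alcove0 (alcove_disp (row_pos_generic lam))) attacks_self.
apply: eq_bigr => i _; apply: eq_bigr => j ij; rewrite card_cells_set2.
have [_ dij] := row_pos_disp lam ij.
have dji : disp (row_pos lam) j i = (row_b (tnth lam i))%:Z - (row_b (tnth lam j))%:Z - 1.
  rewrite (alcoveN (alcove_disp (row_pos_generic lam)) (i := i)); first by rewrite dij; lia.
  by apply: contraTneq ij => ->; rewrite ltnn.
rewrite /attacks [X in (_ + X)%N]exchange_big -big_split /= big_mkord.
apply: eq_bigr => u _; rewrite -big_split big_mkord; apply: eq_bigr => v _ /=.
rewrite /inversion !fill_cell !content_cell dij dji.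
set fu := entry _ _; set gv := entry _ _; lia.
Qed.

Definition entries (T : {ffun 'I_n -> row}) (v : nat) : nat :=
  (\sum_i \sum_(0 <= u < k i) (entry (T i) u == v))%N.

Lemma fill_entry_count T v : entry_count (fill T) v = entries T v.
Proof.
apply: eq_bigr => i _; rewrite card_cells_set big_mkord.
by apply: eq_bigr => u _; rewrite fill_cell.
Qed.

Variable m : monomial.
Hypothesis m0 : m 0%N = 0%N.
Hypothesis mM : forall v, m v != 0%N -> (v <= M)%N.

Definition good (T : {ffun 'I_n -> row}) : bool :=
  [forall i, row_filling (k i) (T i)] && [forall v : 'I_M.+1, entries T v == m v].

Lemma entries_pos T i u : (u < k i)%N -> (0 < entries T (entry (T i) u))%N.
Proof.
move=> uk; rewrite /entries (bigD1 i) //= big_mkord (bigD1 (Ordinal uk)) //=.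
by rewrite eqxx.
Qed.

Lemma fill_good T : good T -> SSYT_mon lam m (fill T).
Proof.
case/andP=> /forallP rf /forallP cnt; split=> [i|v]; last first.
  rewrite fill_entry_count; have [vM|Mv] := leqP v M.
    exact/eqP/(cnt (Ordinal (vM : (v < M.+1)%N))).
  have -> : m v = 0%N by apply/eqP; apply: contraTT Mv => /mM; rewrite -leqNgt.
  apply: big1 => i _; apply: big1 => u _; apply/eqP; rewrite eqb0; apply/negP => /eqP E.
  by have := leq_ord (T i (inord u)); rewrite -/(entry _ _) E leqNgt Mv.
have ent0 u : (u < k i)%N -> (0 < entry (T i) u)%N.
  move=> uk; rewrite lt0n; apply/negP => /eqP E.
  by have := entries_pos T uk; rewrite E (eqP (cnt ord0)) m0.
have mono u v : (u <= v)%N -> (v < k i)%N -> (entry (T i) u <= entry (T i) v)%N.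
  elim: v => [|v IH]; first by rewrite leqn0 => /eqP ->.
  rewrite leq_eqVlt => /orP[/eqP ->//|]; rewrite ltnS => uv vk.
  apply: leq_trans (IH uv (ltnW vk)) _.
  have /andP[_ /forallP/(_ (inord v))] := rf i.
  by rewrite inordK ?vk //; have := sizeL i; lia.
split=> [c|c c' cc]; rewrite !ffunE; first by apply: ent0; exact: cell_index_lt.
by apply: mono; [rewrite /cell_index; lia|exact: cell_index_lt].
Qed.

Lemma fill_inj : {in good &, injective fill}.
Proof.
move=> S T /andP[/forallP rS _] /andP[/forallP rT _] ST.
apply/ffunP => i; apply/ffunP => u.
have [ku|uk] := leqP (k i) u.
  have /andP[/forallP/(_ u) + _] := rS i; have /andP[/forallP/(_ u) + _] := rT i.
  by rewrite ku /= => /eqP -> /eqP ->.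
apply: val_inj; have := fill_cell S (Ordinal uk); rewrite ST fill_cell /entry /=.
by rewrite !inord_val => ->.
Qed.

Lemma fill_surj F : SSYT_mon lam m F -> exists2 T, good T & F = fill T.
Proof.
case=> Fs Fm.
have FM i c : (F i c <= M)%N.
  apply: mM; rewrite -Fm -lt0n /entry_count (bigD1 i) //= ltn_addr //.
  by apply/card_gt0P; exists c; rewrite inE.
pose T : {ffun 'I_n -> row} := [ffun i => [ffun u : 'I_L.+1 =>
  if insub (u : nat) is Some w then inord (F i (@cell (tnth lam i) w)) else ord0]].
have TE i (w : 'I_(k i)) : entry (T i) w = F i (cell w).
  have wL : (w < L.+1)%N by apply: leq_trans (ltn_ord w) (sizeL i).
  rewrite /entry !ffunE inordK // insubT; first exact: ltn_ord.
  by move=> h; rewrite /= inordK ?ltnS ?FM //; congr (F i (cell _)); apply: val_inj.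
have FT : F = fill T.
  apply/ffunP => i; apply/ffunP => c; rewrite -(cell_indexK c) fill_cell.
  by rewrite TE.
exists T => //; apply/andP; split; last first.
  by apply/forallP => v; rewrite -fill_entry_count -FT Fm.
apply/forallP => i; apply/andP; split; apply/forallP => u; apply/implyP => h.
  by rewrite !ffunE insubF //; apply/negbTE; rewrite -leqNgt.
rewrite (TE i (Ordinal h)) (TE i (Ordinal (ltnW h))); apply: (Fs i).2 => /=.
by lia.
Qed.

Lemma LLT_sum : LLT lam m = \sum_(T | good T) 'X^(\sum_i \sum_j
  attacks (k i) (k j) (disp (row_pos lam) i j) (entry (T i)) (entry (T j)))%N.
Proof.
pose r := [seq fill T | T <- index_enum {ffun 'I_n -> row} & good T].
have ur : uniq r.
  rewrite map_inj_in_uniq ?filter_uniq ?index_enum_uniq // => S T.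
  by rewrite !mem_filter => /andP[gS _] /andP[gT _]; exact: fill_inj.
have -> : LLT lam m = \sum_(F \in [set` r]%classic) ('X^(inv_num F) : {poly int}).
  congr (\sum_(F \in _) _); apply/seteqP; split=> F /=.
    by case/fill_surj=> T gT ->; rewrite map_f // mem_filter gT mem_index_enum.
  by case/mapP=> T; rewrite mem_filter => /andP[gT _] ->; exact: fill_good.
rewrite -fsbig_seq // big_map big_filter; apply: eq_bigr => T _.
by rewrite fill_inv_num.
Qed.

Variable b : nat.
Hypothesis sizeb : (\sum_i k i < b)%N.
Hypothesis mb : forall v, (m v < b)%N.

Lemma entries_lt T v : (entries T v < b)%N.
Proof.
apply: leq_ltn_trans sizeb; apply: leq_sum => i _.
rewrite -[leqRHS]subn0 -[leqRHS]muln1 -sum_nat_const_nat.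
by apply: leq_sum => u _; case: (_ == _).
Qed.

Lemma entries_weight (T : {ffun 'I_n -> row}) : (\sum_i \sum_(0 <= u < k i) b ^ entry (T i) u =
  \sum_(v < M.+1) entries T v * b ^ v)%N.
Proof.
under [RHS]eq_bigr do rewrite /entries big_distrl.
rewrite exchange_big; apply: eq_bigr => i _ /=.
under [RHS]eq_bigr do rewrite big_distrl.
rewrite exchange_big; apply: eq_bigr => u _ /=.
have eM : (entry (T i) u < M.+1)%N by rewrite ltnS; exact: leq_ord.
rewrite (bigD1 (Ordinal eM)) //= eqxx mul1n big1 ?addn0 // => v ne.
by rewrite (_ : _ == _ = false) //; apply: contraNF ne => /eqP E; apply/eqP/val_inj.
Qed.

Lemma monomial_weight (T : {ffun 'I_n -> row}) :
  \prod_i \prod_(0 <= u < k i) 'X^(b ^ entry (T i) u) =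
  'X^(\sum_(v < M.+1) entries T v * b ^ v)%N :> {poly {poly int}}.
Proof.
rewrite -entries_weight (big_morph _ (exprD 'X) (expr0 'X)).
by apply: eq_bigr => i _; rewrite (big_morph _ (exprD 'X) (expr0 'X)).
Qed.

(* Substituting [x_v := X^(b^v)] turns a monomial with exponents below [b] into
   the power of [X] whose base-[b] digits are those exponents. *)
Lemma LLT_coef : LLT lam m =
  (gen ('X%:P : {poly {poly int}}) (fun v => 'X^(b ^ v)) M L k (disp (row_pos lam)))`_
    (\sum_(v < M.+1) m v * b ^ v)%N.
Proof.
rewrite LLT_sum /gen coef_sum [LHS]big_mkcond [RHS]big_mkcond; apply: eq_bigr => T _.
rewrite /good; case: ifP => [/andP[-> cnt]|].
  rewrite -polyC_exp coefMC monomial_weight coefXn.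
  have -> : (\sum_(v < M.+1) entries T v * b ^ v = \sum_(v < M.+1) m v * b ^ v)%N.
    by apply: eq_bigr => v _; have /eqP -> := forallP cnt v.
  by rewrite eqxx mul1r.
case: ifP => //= _ /negP cnt.
rewrite -polyC_exp coefMC monomial_weight coefXn.
case: eqP => [E|_]; last by rewrite mul0r.
case: cnt; apply/forallP => v; apply/eqP.
by apply: (digits_inj _ _ (esym E)) => // u _; exact: entries_lt.
Qed.

End Coefficients.

Lemma LLT_eq0 (n : nat) (lam : hstrip n) (m : monomial) : m 0%N != 0%N -> LLT lam m = 0.
Proof.
move=> m0; rewrite /LLT (_ : SSYT_mon lam m = set0) ?fsbig_set0 //.
apply/seteqP; split=> // T [pos cnt]; case/negP: m0; rewrite -cnt.
apply/eqP/big1 => i _; apply/eqP; rewrite cards_eq0; apply/eqP/setP => u.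
by rewrite !inE; apply/negbTE; rewrite -lt0n; exact: (pos i).1.
Qed.

Theorem theorem2p7 (n m : nat) (lam : hstrip n) (mu : hstrip m) :
  wg_iso (strip_graph lam) (strip_graph mu) -> LLT lam = LLT mu.
Proof.
case=> /= e; case: m / e mu => mu [phi [hv he]]; apply: funext => mon.
have sizeE i : row_size (tnth lam i) = row_size (tnth mu (phi i)).
  by rewrite -!card_cells hv cast_ord_id.
have [m0|m0] := eqVneq (mon 0%N) 0%N; last by rewrite !LLT_eq0.
pose M := \max_(v <- finsupp mon) v.
have mM v : mon v != 0%N -> (v <= M)%N.
  by rewrite -mem_finsupp => vm; rewrite /M (big_rem v vm) leq_maxl.
pose L := (\sum_i row_size (tnth lam i))%N.
pose b := (L + \sum_(v < M.+1) mon v).+1.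
have mb v : (mon v < b)%N.
  have [->//|/mM vM] := eqVneq (mon v) 0%N.
  rewrite ltnS /b (bigD1 (Ordinal (vM : (v < M.+1)%N))) //=.
  by rewrite addnCA leq_addr.
have LE : L = (\sum_i row_size (tnth mu i))%N.
  by rewrite [RHS](reindex_inj (@perm_inj _ phi)); apply: eq_bigr => i _; rewrite sizeE.
have sL i : (row_size (tnth lam i) <= L.+1)%N.
  by rewrite ltnW // ltnS /L (bigD1 i) //= leq_addr.
have sL' i : (row_size (tnth mu i) <= L.+1)%N.
  by rewrite ltnW // ltnS LE (bigD1 i) //= leq_addr.
have Lb : (L < b)%N by rewrite ltnS leq_addr.
rewrite (LLT_coef sL m0 mM Lb mb).
rewrite (LLT_coef (lam := mu) sL' m0 mM _ mb); last by rewrite -LE.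
congr (polyseq _)`_ _; pose p' i := row_pos mu (phi i).
rewrite -[RHS](gen_relabel _ _ _ _ phi).
transitivity (gen ('X%:P : {poly {poly int}}) (fun v => 'X^(b ^ v)) M L
    (fun i => row_size (tnth lam i)) (disp p')); last by apply: eq_gen => [i|//]; rewrite sizeE.
apply: gen_weights.
- by rewrite polyC_eq0 polyX_eq0.
- exact: leqnSn.
- exact: row_pos_generic.
- by move=> i j ij; apply: row_pos_generic; rewrite (inj_eq perm_inj).
move=> i j ij; rewrite -eweight_wt // /= (he i j) !cast_ord_id !sizeE.
by rewrite -[disp p' i j]/(disp (row_pos mu) (phi i) (phi j)) -eweight_wt ?(inj_eq perm_inj).
Qed.
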